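(* Let $n\ge1$ and let $f\in H^\infty(\mathbb{D}^n)$ be nonzero. If $I_{H^\infty(\mathbb{D}^n)}(f)$ is an $M$-ideal in $H^\infty(\mathbb{D}^n)$, then $$I_{H^2(\mathbb{D}^n)}(f)=H^2(\mathbb{D}^n).$$
   Context: $\mathbb{D}$ is the open unit disc in $\mathbb{C}$, $\mathbb{T}$ the unit circle, $\mu$ normalized Lebesgue measure on $\mathbb{T}^n$. $H^\infty(\mathbb{D}^n)$ is the Banach algebra of bounded holomorphic functions on $\mathbb{D}^n$ with the supremum norm, and $H^2(\mathbb{D}^n)$ is the Hardy space of holomorphic $f$ on $\mathbb{D}^n$ with $\|f\|_2=\left(\sup_{0<r<1}\int_{\mathbb{T}^n}|f(rz)|^2\,d\mu(z)\right)^{1/2}<\infty$; $H^\infty(\mathbb{D}^n)\subseteq H^2(\mathbb{D}^n)$. $I_{H^\infty(\mathbb{D}^n)}(f)$ is the closed principal ideal generated by $f$: the norm closure in $H^\infty(\mathbb{D}^n)$ of $\{fg: g\in H^\infty(\mathbb{D}^n)\}$. For $f\in H^2(\mathbb{D}^n)$, $I_{H^2(\mathbb{D}^n)}(f)$ is the closure in $H^2(\mathbb{D}^n)$ of $\{pf: p\in\mathbb{C}[z_1,\dots,z_n]\}$. (For $n=1$, a function $f\in H^\infty(\mathbb{D})$ is called outer if $I_{H^2(\mathbb{D})}(f)=H^2(\mathbb{D})$.) $M$-ideal: a closed subspace $C$ of a complex Banach space $X$ is an $M$-ideal in $X$ if there is a bounded linear projection $P:X^*\to X^*$ ($P^2=P$)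 with $\operatorname{ran}P=C^\perp=\{x^*\in X^*: x^*|_C\equiv0\}$ and $\|Px^*\|+\|(I-P)x^*\|=\|x^*\|$ for all $x^*\in X^*$. *)

(* Defs.v *)
From HB Require Import structures.
From mathcomp Require Import all_boot all_order all_algebra.
From mathcomp Require Import all_classical all_reals all_analysis.
From mathcomp Require Import complex.
From mathcomp Require mpoly.

Set Implicit Arguments.
Unset Strict Implicit.
Unset Printing Implicit Defensive.

Import Order.TTheory GRing.Theory Num.Theory.
Import numFieldNormedType.Exports.

Local Open Scope classical_set_scope.
Local Open Scope ring_scope.
Local Open Scope complex_scope.

Notation cabs := Normc.normc.

Section supnorm.
Context {R : realType} {T : Type}.
Implicit Types (D : set T) (f g : T -> R[i]^o).

Definition bounded_on D f := exists M : R, forall z, D z -> cabs (f z) <= M.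

(* sup set0 = 0, so this is 0 on an empty D; the value is meaningful only when
   bounded_on D f holds. *)
Definition supnorm D f : R := sup [set cabs (f z) | z in D].

Lemma cabs_ge0 (z : R[i]) : 0 <= cabs z.
Proof. by case: z => a b; exact: sqrtr_ge0. Qed.

Lemma supnorm_ge0 D f : 0 <= supnorm D f.
Proof.
rewrite /supnorm; have [hs|/sup_out->//] := pselect (has_sup [set cabs (f z) | z in D]).
have [[_ [z Dz _]] ub] := hs; rewrite (le_trans (cabs_ge0 (f z)))//.
by apply: ub_le_sup => //; exists z.
Qed.

Lemma supnorm_ub D f z : bounded_on D f -> D z -> cabs (f z) <= supnorm D f.
Proof.
move=> [M fM] Dz; apply: ub_le_sup; last by exists z.
by exists M => _ [w Dw <-]; exact: fM.
Qed.

Lemma supnorm_le D f (M : R) : 0 <= M ->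
  (forall z, D z -> cabs (f z) <= M) -> supnorm D f <= M.
Proof.
move=> M0 fM; rewrite /supnorm.
have [->|/set0P[x Dx]] := eqVneq [set cabs (f z) | z in D] set0.
  by rewrite sup0.
by apply: ge_sup; [exists x|move=> _ [z Dz <-]; exact: fM].
Qed.

Lemma bounded_onD D f g :
  bounded_on D f -> bounded_on D g -> bounded_on D (f + g).
Proof.
move=> [M fM] [N gN]; exists (M + N) => z Dz.
by rewrite (le_trans (le_normcD _ _))// lerD ?fM ?gN.
Qed.

Lemma bounded_onZ D (a : R[i]) f : bounded_on D f -> bounded_on D (a *: f).
Proof.
move=> [M fM]; exists (cabs a * M) => z Dz.
by rewrite [X in cabs X](_ : _ = a * f z)// Normc.normcM ler_wpM2l ?cabs_ge0 ?fM.
Qed.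

Lemma ler_supnormD D f g : bounded_on D f -> bounded_on D g ->
  supnorm D (f + g) <= supnorm D f + supnorm D g.
Proof.
move=> bf bg; apply: supnorm_le => [|z Dz]; first by rewrite addr_ge0 ?supnorm_ge0.
by rewrite (le_trans (le_normcD _ _))// lerD ?supnorm_ub.
Qed.

Lemma supnormZ D (a : R[i]) f : bounded_on D f ->
  supnorm D (a *: f) = cabs a * supnorm D f.
Proof.
have supnormZ_le (b : R[i]) g : bounded_on D g ->
    supnorm D (b *: g) <= cabs b * supnorm D g.
  move=> bg; apply: supnorm_le => [|z Dz]; first by rewrite mulr_ge0 ?cabs_ge0 ?supnorm_ge0.
  by rewrite [X in cabs X](_ : _ = b * g z)// Normc.normcM ler_wpM2l ?cabs_ge0 ?supnorm_ub.
move=> bf; apply/le_anti; rewrite supnormZ_le//=.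
have [->|a0] := eqVneq a 0; first by rewrite Normc.normc0 mul0r supnorm_ge0.
have ca0 : 0 < cabs a.
  rewrite lt_neqAle cabs_ge0 andbT eq_sym; apply: contra_neq a0.
  exact: Normc.eq0_normc.
rewrite -ler_pdivlMl// -Normc.normcV -{1}(scalerK a0 f).
exact/supnormZ_le/bounded_onZ.
Qed.

Lemma supnorm_eq0 D f : bounded_on D f -> supnorm D f = 0 ->
  forall z, D z -> f z = 0.
Proof.
move=> bf f0 z Dz; apply: Normc.eq0_normc; apply/le_anti.
by rewrite cabs_ge0 andbT -f0 supnorm_ub.
Qed.

End supnorm.


Section dual.
Context {R : realType} (X : normedModType R[i]).

Definition dual_pred : {pred X -> R[i]^o} :=
  fun phi => `[< linear phi /\ continuous phi >].

Lemma dual_pred_submod_closed : GRing.submod_closed dual_pred.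
Proof.
split.
  apply/asboolP; split; last by move=> x; exact: cvg_cst.
  by move=> a x y; rewrite scaler0 addr0.
move=> a f g /asboolP[lf cf] /asboolP[lg cg]; apply/asboolP; split.
  move=> b x y.
  change (a *: f (b *: x + y) + g (b *: x + y) =
    b *: (a *: f x + g x) + (a *: f y + g y)).
  rewrite lf lg !scalerDr !addrA; congr (_ + _).
  by rewrite !scalerA (mulrC a b) -!addrA; congr (_ + _); rewrite addrC.
by move=> x; apply: cvgD; [apply: cvgZl_tmp; exact: cf|exact: cg].
Qed.

HB.instance Definition _ :=
  GRing.isSubmodClosed.Build R[i] (X -> R[i]^o) dual_pred
    dual_pred_submod_closed.

(* The dual space X^* of continuous (equivalently, bounded) linear functionals,
   normed below by the operator norm. *)
Record dual := Dual {
  dual_fun :> X -> R[i]^o ;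
  dual_funP : dual_fun \in dual_pred }.

HB.instance Definition _ := [isSub for dual_fun].
HB.instance Definition _ := [Choice of dual by <:].
HB.instance Definition _ := [SubChoice_isSubLmodule of dual by <:].

Definition unit_ball : set X := [set x | `|x| <= 1].

(* Norms on a normedModType R[i] take their values in R[i]. *)
Definition dual_norm (phi : dual) : R[i] := (supnorm unit_ball phi)%:C.

Lemma dual_linear (phi : dual) : linear phi.
Proof. by case: phi => f /= /asboolP[]. Qed.

HB.instance Definition _ (phi : dual) :=
  GRing.isLinear.Build R[i] X R[i]^o *:%R (dual_fun phi) (dual_linear phi).

Lemma dual_bounded (phi : dual) : bounded_on unit_ball phi.
Proof.
have /asboolP[_ cphi] := dual_funP phi.
have /linear_boundedP [M [Mr HM]] := (linear_bounded_continuous phi).2 cphi.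
have [N N0 MN] : exists2 N : R, 0 <= N & M < N%:C.
  have /complex_realP[m ->] := Mr.
  by exists (`|m| + 1); rewrite ?addr_ge0// ltcR ltr_pwDr// ler_norm.
exists N => x x1.
have Nx : `|phi x| <= N%:C * `|x| := HM _ MN x.
rewrite -lecR; apply: (le_trans Nx).
by rewrite -[leRHS]mulr1 ler_wpM2l// lecR.
Qed.

Lemma dual_norm0 (phi : dual) : dual_norm phi = 0 -> phi = 0.
Proof.
move=> [phi0]; apply/val_inj/funext => x; change (phi x = 0).
have [->|x0] := eqVneq x 0; first by rewrite linear0.
have := supnorm_eq0 (dual_bounded phi) phi0 (z := `|x|^-1 *: x).
rewrite /unit_ball/= normfZV// lexx => /(_ isT)/eqP.
by rewrite linearZ scaler_eq0 invr_eq0 normr_eq0 (negbTE x0) => /eqP.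
Qed.

Lemma ler_dual_normD (phi psi : dual) :
  dual_norm (phi + psi) <= dual_norm phi + dual_norm psi.
Proof. by rewrite -rmorphD/= lecR ler_supnormD//; exact: dual_bounded. Qed.

Lemma dual_normZ (a : R[i]) (phi : dual) :
  dual_norm (a *: phi) = `|a| * dual_norm phi.
Proof. by rewrite /dual_norm supnormZ ?rmorphM//; exact: dual_bounded. Qed.

HB.instance Definition _ :=
  Lmodule_isNormed.Build R[i] dual ler_dual_normD dual_normZ dual_norm0.

Definition annihilator (C : set X) : set dual :=
  [set phi | forall x, C x -> phi x = 0].

(* For a {linear} map between normed modules, continuous means bounded:
   see linear_bounded_continuous. *)
Definition Mideal (C : set X) : Prop :=
  [/\ GRing.submod_closed (mem C),
      closed C &
      exists P : {linear dual -> dual},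
        [/\ continuous P,
            (forall phi, P (P phi) = P phi),
            range P = annihilator C &
            forall phi, `|P phi| + `|phi - P phi| = `|phi|]].

End dual.

Section hardy.
Context (R : realType) (n : nat).

Local Notation Cn := ('rV[R[i]]_n : normedModType R[i]).

Definition polydisc : set 'rV[R[i]]_n := [set z | forall j, `|z 0 j| < 1].

(* Complex (Frechet) differentiability; the polydisc being open, this does not
   depend on the values of f outside it. *)
Definition holomorphic (f : Cn -> R[i]^o) :=
  forall z : Cn, polydisc z -> differentiable f z.

(* A function on the polydisc is represented by its extension by zero to C^n,
   so that Leibniz equality is equality of functions on the polydisc. *)
Definition zero_outside (f : Cn -> R[i]^o) :=
  forall z, ~ polydisc z -> f z = 0.

Definition Hinf_pred : {pred Cn -> R[i]^o} :=
  fun f => `[< [/\ holomorphic f, bounded_on polydisc f & zero_outside f] >].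

Lemma Hinf_pred_submod_closed : GRing.submod_closed Hinf_pred.
Proof.
split.
  apply/asboolP; split=> [z _| |//]; first exact: differentiable_cst.
  by exists 0 => z _; rewrite Normc.normc0.
move=> a f g /asboolP[hf bf zf] /asboolP[hg bg zg]; apply/asboolP; split.
- by move=> z Dz; apply: differentiableD; [apply: differentiableZ; exact: hf|exact: hg].
- exact/bounded_onD/bg/bounded_onZ.
- move=> z Dz; change (a *: f z + g z = 0).
  by rewrite zf// zg// scaler0 addr0.
Qed.

HB.instance Definition _ :=
  GRing.isSubmodClosed.Build R[i] (Cn -> R[i]^o) Hinf_pred
    Hinf_pred_submod_closed.

(* The bounded holomorphic functions on the polydisc, normed below by the
   supremum norm. *)
Record Hinf := MkHinf {
  Hinf_fun :> Cn -> R[i]^o ;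
  Hinf_funP : Hinf_fun \in Hinf_pred }.

HB.instance Definition _ := [isSub for Hinf_fun].
HB.instance Definition _ := [Choice of Hinf by <:].
HB.instance Definition _ := [SubChoice_isSubLmodule of Hinf by <:].

Definition Hinf_norm (f : Hinf) : R[i] := (supnorm polydisc f)%:C.

Lemma Hinf_bounded (f : Hinf) : bounded_on polydisc f.
Proof. by case: f => f /= /asboolP[]. Qed.

Lemma Hinf_norm0 (f : Hinf) : Hinf_norm f = 0 -> f = 0.
Proof.
move=> [f0]; apply/val_inj/funext => z /=.
have [Dz|Dz] := pselect (polydisc z).
  by rewrite (supnorm_eq0 (Hinf_bounded f) f0 Dz).
by case: f {f0} => f /= /asboolP[_ _ ->].
Qed.

Lemma ler_Hinf_normD (f g : Hinf) :
  Hinf_norm (f + g) <= Hinf_norm f + Hinf_norm g.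
Proof. by rewrite -rmorphD/= lecR ler_supnormD//; exact: Hinf_bounded. Qed.

Lemma Hinf_normZ (a : R[i]) (f : Hinf) :
  Hinf_norm (a *: f) = `|a| * Hinf_norm f.
Proof. by rewrite /Hinf_norm supnormZ ?rmorphM//; exact: Hinf_bounded. Qed.

HB.instance Definition _ :=
  Lmodule_isNormed.Build R[i] Hinf ler_Hinf_normD Hinf_normZ Hinf_norm0.

Lemma Hinf_mul_subproof (f g : Hinf) :
  (fun z => f z * g z : R[i]^o) \in Hinf_pred.
Proof.
case: f => f /= /asboolP[hf bf zf]; case: g => g /= /asboolP[hg bg zg].
apply/asboolP; split.
- by move=> z Dz; apply: differentiableM; [exact: hf|exact: hg].
- have [M fM] := bf; have [N gN] := bg; exists (M * N) => z Dz.
  by rewrite Normc.normcM ler_pM ?cabs_ge0 ?fM ?gN.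
- by move=> z Dz; rewrite zf// mul0r.
Qed.

Definition Hinf_mul (f g : Hinf) : Hinf := MkHinf (Hinf_mul_subproof f g).

Definition Hinf_ideal (f : Hinf) : set Hinf :=
  closure [set Hinf_mul f g | g in [set: Hinf]].

End hardy.

Section torus_measure.
Context (R : realType).

Fact two_pi_gt0 : (0 : R) < 2 * pi.
Proof. by rewrite mulr_gt0 ?pi_gt0. Qed.

Fact measurable_tuple_cons n : measurable_fun setT
  (fun p : measurableTypeR R * n.-tuple (measurableTypeR R) =>
     [tuple of p.1 :: p.2]).
Proof. exact: measurable_cons. Qed.

(* The product of n copies of the uniform probability on [0, 2 pi]. Its image
   under t |-> (e^{i t_1}, ..., e^{i t_n}) is the normalized Lebesgue measure of
   the torus, and integrals over the torus are written in the angles t. *)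
Fixpoint torus_measure (n : nat) : probability (n.-tuple (measurableTypeR R)) R :=
  match n with
  | 0%N => \d_ [tuple]
  | m.+1 => distribution (uniform_prob two_pi_gt0 \x torus_measure m)%E
      (mfun_Sub (mem_set (@measurable_tuple_cons m)))
  end.
End torus_measure.

Section hardy2.
Context (R : realType) (n : nat).

Local Notation Cn := ('rV[R[i]]_n : normedModType R[i]).

(* r e^{i t}, coordinatewise *)
Definition torus_point (r : R) (t : n.-tuple R) : 'rV[R[i]]_n :=
  \row_j (r * cos (tnth t j) +i* (r * sin (tnth t j))).

Definition H2_norm (f : Cn -> R[i]^o) : \bar R :=
  sqrte (ereal_sup
    [set (\int[torus_measure R n]_t (cabs (f (torus_point r t)) ^+ 2)%:E)%E
      | r in `]0, 1[]).

Definition H2 : set (Cn -> R[i]^o) :=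
  [set f | [/\ holomorphic f, zero_outside f & (H2_norm f < +oo)%E]].

(* Norm closure in the Hardy space H2. *)
Definition H2_closure (A : set (Cn -> R[i]^o)) : set (Cn -> R[i]^o) :=
  [set g | H2 g /\
    forall e : R, 0 < e -> exists2 h, A h & (H2_norm (g - h)%R < e%:E)%E].

Definition H2_ideal (f : Cn -> R[i]^o) : set (Cn -> R[i]^o) :=
  H2_closure
    [set (fun z : Cn => mpoly.meval (fun j => z 0 j) p * f z)
      | p in [set: mpoly.mpoly n R[i]]].

End hardy2.

Arguments H2 : clear implicits.

(* Main.v *)
From HB Require Import structures.
Require Import Defs.
From mathcomp Require Import all_boot all_order all_algebra.
From mathcomp Require Import all_classical all_reals all_analysis.
From mathcomp Require Import measurable_realfun.
From mathcomp Require Import complex.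
From mathcomp Require mpoly.
From mathcomp Require Import ring lra.

(* Evaluations at points of the polydisc are functionals of norm 1 on the
   algebra of bounded holomorphic functions. If the closed ideal J of f is an
   M-ideal, the L-projection P onto its annihilator splits the evaluation at z
   into two multiples of states, and multiplicativity of the evaluation forces
   one of them to vanish: P either fixes or kills it. It is killed when f z != 0
   because f is in J, and then also at every point close to z, since two
   evaluations separated by P would be at distance 2; following the segment to
   the origin, P kills the evaluation at 0. By Hahn-Banach this evaluation
   therefore keeps its norm on J, so that J contains multiples e = f g with
   |e| <= 1 + d and Re (e 0) >= 1 - d. Hence |e - 1|^2 = |e|^2 - 2 Re (e 0) + 1
   is small in the Hardy space, and 1, then every polynomial, then the whole
   space belongs to the closure of the polynomial multiples of f.

   Density of the polynomials rests on their uniform density in the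
   holomorphic functions on smaller polydiscs. This is obtained without contour
   integrals: Goursat's bisection works for midpoint Riemann sums, and it shows
   that the interpolation of a function at the N-th roots of unity converges to
   it as N grows, one variable after the other. *)

Set Implicit Arguments.
Unset Strict Implicit.
Unset Printing Implicit Defensive.

Import Order.TTheory GRing.Theory Num.Theory.
Import numFieldNormedType.Exports.
Import (canonicals, coercions) mpoly.

Local Open Scope classical_set_scope.
Local Open Scope ring_scope.

(** * Goursat's lemma *)

(** An L-projection makes norms add: if [phi] is an evaluation, [phi1 = P phi] and
    [phi2 = phi - P phi], then [dnorm phi1 + dnorm phi2 = 1 = phi one], so each part attains its
    norm at [one]. That makes both positive functionals, and positivity stands in for representing
    measures: pointwise inequalities on the polydisc pass to [phi1] and [phi2].

    The closed ideal only provides multiples [f g] with [g] bounded holomorphic, whereas the Hardy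
    ideal admits polynomial multipliers only. Density of the polynomials is therefore applied twice,
    to the target function and to a product [q g]; the second replacement is harmless because
    multiplication by the bounded [f] is continuous for quadratic means.

    Boundary values never appear. All estimates concern means over the tori of radius [r < 1];
    Parseval's identity is needed for polynomials alone, and other functions are compared with
    polynomials uniformly on a closed polydisc. *)

Section complex_modulus.
Context {R : realType}.
Implicit Types x y z : R[i].

Lemma cabs_real (r : R) : cabs (real_complex R r) = `|r|.
Proof. by rewrite /= expr0n addr0 sqrtr_sqr. Qed.

Lemma ReD x y : complex.Re (x + y) = complex.Re x + complex.Re y.
Proof. by case: x y => a b [c d]. Qed.

Lemma ReB x y : complex.Re (x - y) = complex.Re x - complex.Re y.
Proof. by case: x y => a b [c d]. Qed.

Lemma ImB x y : complex.Im (x - y) = complex.Im x - complex.Im y.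
Proof. by case: x y => a b [c d]. Qed.

Lemma cabsE z : `|z| = real_complex R (cabs z).
Proof. by []. Qed.

Lemma cabs_eq0 z : (cabs z == 0) = (z == 0).
Proof.
apply/eqP/eqP => [|->]; [exact: Normc.eq0_normc|exact: Normc.normc0].
Qed.

Lemma cabs_gt0 z : (0 < cabs z) = (z != 0).
Proof. by rewrite lt_neqAle cabs_ge0 andbT eq_sym cabs_eq0. Qed.

Lemma cabs_sub x y : cabs (x - y) = cabs (y - x).
Proof. by rewrite -normcN opprB. Qed.

Lemma cabs_triangle x y z : cabs (x - z) <= cabs (x - y) + cabs (y - z).
Proof. by rewrite (le_trans _ (le_normcD _ _))// addrA subrK. Qed.

Lemma ler_cabsB x y : cabs (x - y) <= cabs x + cabs y.
Proof. by rewrite (le_trans (le_normcD _ _))// normcN. Qed.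

Lemma ler_cabs_sum (I : Type) (s : seq I) (P : pred I) (F : I -> R[i]) :
  cabs (\sum_(i <- s | P i) F i) <= \sum_(i <- s | P i) cabs (F i).
Proof.
elim/big_ind2 : _ => [|x a y b xa yb|//]; first by rewrite Normc.normc0.
by rewrite (le_trans (le_normcD _ _))// lerD.
Qed.

Lemma cabsX z k : cabs (z ^+ k) = cabs z ^+ k.
Proof.
elim: k => [|k IH]; first by rewrite !expr0 Normc.normc1.
by rewrite !exprS Normc.normcM IH.
Qed.

Lemma cabs_Re z : `|complex.Re z| <= cabs z.
Proof. by have := normc_ge_Re z; rewrite lecR. Qed.

Lemma cabs_Im z : `|complex.Im z| <= cabs z.
Proof.
case: z => a b /=; rewrite -sqrtr_sqr ler_wsqrtr//.
by rewrite lerDr sqr_ge0.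
Qed.

Lemma cabs_le_ReIm z : cabs z <= `|complex.Re z| + `|complex.Im z|.
Proof.
case: z => a b /=; rewrite -[leRHS]ger0_norm ?addr_ge0// -sqrtr_sqr ler_wsqrtr//.
by rewrite sqrrD !real_normK ?num_real// -addrA lerD2l lerDr mulrn_wge0// mulr_ge0.
Qed.

Lemma cabs_nat k : cabs (k%:R : R[i]) = k%:R.
Proof.
have -> : (k%:R : R[i]) = real_complex R k%:R by rewrite rmorph_nat.
by rewrite cabs_real ger0_norm.
Qed.

Lemma cabs_half z : cabs (z / 2) = cabs z / 2.
Proof. by rewrite Normc.normcM Normc.normcV cabs_nat. Qed.

End complex_modulus.

(* Goursat's lemma is stated for midpoint Riemann sums instead of integrals:
   [msum g k a b] is the sum over the [2 ^ k] equal pieces of the segment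
   from [a] to [b], so that bisecting a segment is exact, and so is the value
   on affine functions. *)
Section midpoint_sums.
Context {R : realType}.
Local Notation C := R[i].
Implicit Types (g h : C -> C) (a b c d x y z : C) (K : C -> Prop).

Definition mid a b : C := (a + b) / 2.

Fixpoint msum g k a b : C :=
  if k is k'.+1 then msum g k' a (mid a b) + msum g k' (mid a b) b
  else g (mid a b) * (b - a).

(** Bisection only ever produces midpoints, so no other convex combination has to stay in [K]. *)
Definition midconvex K := forall a b, K a -> K b -> K (mid a b).

Lemma two_neq0 : 2 != 0 :> C. Proof. by rewrite pnatr_eq0. Qed.

Lemma midC a b : mid a b = mid b a.
Proof. by rewrite /mid addrC. Qed.

Lemma msumN g k a b : msum g k b a = - msum g k a b.
Proof.
elim: k a b => [|k IH] a b /=; first by rewrite midC -mulrN opprB.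
by rewrite opprD [in RHS]addrC -!IH (midC b a).
Qed.

Lemma msumB g h k a b :
  msum (fun z => g z - h z) k a b = msum g k a b - msum h k a b.
Proof. by elim: k a b => [|k IH] a b /=; rewrite ?mulrBl// !IH; ring. Qed.

Lemma msum_affine c d k a b :
  msum (fun z => c + d * z) k a b = c * (b - a) + d * (b ^+ 2 - a ^+ 2) / 2.
Proof.
have n2 := two_neq0.
by elim: k a b => [|k IH] a b /=; rewrite ?IH /mid; field.
Qed.

Lemma msum_bound K g (M : R) k a b : midconvex K ->
  (forall z, K z -> cabs (g z) <= M) -> K a -> K b ->
  cabs (msum g k a b) <= M * cabs (b - a).
Proof.
move=> cK gM; elim: k a b => [|k IH] a b Ka Kb /=.
  by rewrite Normc.normcM ler_wpM2r ?cabs_ge0// gM//; exact: cK.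
have Km := cK _ _ Ka Kb; apply: (le_trans (le_normcD _ _)).
apply: (le_trans (lerD (IH _ _ Ka Km) (IH _ _ Km Kb))).
have n2 := two_neq0.
have -> : mid a b - a = (b - a) / 2 by rewrite /mid; field.
have -> : b - mid a b = (b - a) / 2 by rewrite /mid; field.
by rewrite cabs_half -mulrDr -splitr.
Qed.

Lemma msum_const c k a b : msum (fun=> c) k a b = c * (b - a).
Proof.
have -> : (fun=> c) = (fun z => c + 0 * z).
  by apply/funext => z; rewrite mul0r addr0.
by rewrite msum_affine !mul0r addr0.
Qed.

Lemma msum_osc K g c (M : R) k a b : midconvex K ->
  (forall z, K z -> cabs (g z - c) <= M) -> K a -> K b ->
  cabs (msum g k a b - c * (b - a)) <= M * cabs (b - a).
Proof.
move=> cK gM Ka Kb; rewrite -(msum_const c k) -msumB.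
exact: (msum_bound k cK gM Ka Kb).
Qed.

Definition tri g k a b c := msum g k a b + msum g k b c + msum g k c a.

(** The sides of the medial triangle are traversed twice in opposite directions and cancel. Halving
    the outer sides uses up one level, hence [k.+1] on the left. *)
Lemma tri_split g k a b c : tri g k.+1 a b c =
  tri g k a (mid a b) (mid c a) + tri g k (mid a b) b (mid b c) +
  tri g k (mid c a) (mid b c) c + tri g k (mid a b) (mid b c) (mid c a).
Proof.
rewrite /tri /= (msumN g k (mid c a) (mid a b)) (msumN g k (mid a b) (mid b c)).
by rewrite (msumN g k (mid b c) (mid c a)); ring.
Qed.

(** With [d n = D / 2 ^+ n], the intervals of centre [u n] and radius [d n] are nested, since each
    step is at most [d n - d n.+1]. The limit is the supremum of their left endpoints. *)
Lemma dyadic_limit_real (u : nat -> R) (D : R) :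
  (forall n, `|u n.+1 - u n| <= D / 2 ^+ n.+1) ->
  exists l, forall n, `|u n - l| <= D / 2 ^+ n.
Proof.
move=> uD; pose d n := D / 2 ^+ n.
have dS n : d n.+1 = d n / 2 by rewrite /d exprS invfM mulrCA mulrC.
have lo m n : (m <= n)%N -> u m - d m <= u n - d n.
  elim: n => [|n IH]; first by rewrite leqn0 => /eqP ->.
  rewrite leq_eqVlt => /orP[/eqP ->//|/IH/le_trans]; apply.
  have := uD n; rewrite -/(d _) dS ler_norml => /andP[? ?].
  lra.
have hi m n : (m <= n)%N -> u n + d n <= u m + d m.
  elim: n => [|n IH]; first by rewrite leqn0 => /eqP ->.
  rewrite leq_eqVlt => /orP[/eqP ->//|/IH]; apply: le_trans.
  have := uD n; rewrite -/(d _) dS ler_norml => /andP[? ?].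
  lra.
have D0 n : 0 <= d n.
  suff : 0 <= d n.+1 by rewrite dS; lra.
  exact: le_trans (uD n).
have lohi m n : u m - d m <= u n + d n.
  have [mn|/ltnW nm] := leqP m n.
    have := lo _ _ mn; have := D0 n; lra.
  have := hi _ _ nm; have := D0 m; lra.
pose A := [set u m - d m | m in setT].
have hA : has_sup A.
  split; first by exists (u 0%N - d 0%N), 0%N.
  by exists (u 0%N + d 0%N) => _ [m _ <-].
exists (sup A) => n; rewrite -/(d n) ler_norml; apply/andP; split.
  have : sup A <= u n + d n by apply: ge_sup; [exact: hA.1|move=> _ [m _ <-]].
  lra.
have : u n - d n <= sup A by apply: sup_upper_bound => //; exists n.
lra.
Qed.

Lemma dyadic_limit (u : nat -> C) (D : R) :
  (forall n, cabs (u n.+1 - u n) <= D / 2 ^+ n.+1) ->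
  exists x, forall n, cabs (u n - x) <= 2 * D / 2 ^+ n.
Proof.
move=> uD.
have [n|x hx] := @dyadic_limit_real (fun n => complex.Re (u n)) D.
  by rewrite (le_trans _ (uD n))// -ReB cabs_Re.
have [n|y hy] := @dyadic_limit_real (fun n => complex.Im (u n)) D.
  by rewrite (le_trans _ (uD n))// -ImB cabs_Im.
exists (Complex x y) => n; rewrite (le_trans (cabs_le_ReIm _))// !(ReB, ImB)/=.
by rewrite -mulrA mulr_natl mulr2n lerD.
Qed.

Definition closed_in_C K :=
  forall x, (forall e, 0 < e -> exists2 y, K y & cabs (y - x) < e) -> K x.

Definition cdiff_within K g x := exists d : C, forall e : R, 0 < e ->
  exists2 r : R, 0 < r & forall y, K y -> cabs (y - x) < r ->
    cabs (g y - g x - d * (y - x)) <= e * cabs (y - x).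

Definition tends_to0 (u : nat -> C) :=
  forall e : R, 0 < e -> exists k0, forall k, (k0 <= k)%N -> cabs (u k) <= e.

Lemma geometric_lt (D e : R) : 0 < e -> exists n, D / 2 ^+ n < e.
Proof.
move=> e0; have [n nD] : exists n : nat, D / e < n%:R.
  exists (Num.truncn (`|D / e|)).+1.
  by rewrite (le_lt_trans (ler_norm _))// truncnS_gt.
exists n; rewrite ltr_pdivrMr ?exprn_gt0// mulrC -ltr_pdivrMr//.
apply: lt_trans nD _; rewrite -natrX ltr_nat; exact: ltn_expl.
Qed.

(** Sums that do not tend to 0 on a triangle fail to do so, at a quarter of the size, on one of its
    four halves; the nested triangles converge to a point [x] of [K]. There the affine part of [g]
    contributes nothing, and the remainder times the perimeter is of smaller order than [4 ^- n]. *)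
Lemma goursat K g a b c : midconvex K -> closed_in_C K ->
  (forall x, K x -> cdiff_within K g x) -> K a -> K b -> K c ->
  tends_to0 (fun k => tri g k a b c).
Proof.
move=> cK clK dg Ka Kb Kc.
(* Failure at arbitrarily large levels, rather than at a fixed one, is what a pigeonhole on the four
   pieces preserves. *)
pose bad (e : R) (t : C * C * C) := forall k0, exists2 k, (k0 <= k)%N &
  e < cabs (tri g k t.1.1 t.1.2 t.2).
move=> e0 e00; apply: contrapT => nlim.
have bad0 : bad e0 (a, b, c).
  move=> k0; apply: contrapT => H; apply: nlim; exists k0 => k kk0.
  by rewrite leNgt; apply/negP => Hk; apply: H; exists k.
pose D := cabs (b - a) + cabs (c - b) + cabs (a - c).
pose good n (t : C * C * C) := [/\ K t.1.1, K t.1.2 & K t.2] /\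
  [/\ cabs (t.1.2 - t.1.1) <= D / 2 ^+ n, cabs (t.2 - t.1.2) <= D / 2 ^+ n,
     cabs (t.1.1 - t.2) <= D / 2 ^+ n & bad (e0 / 4 ^+ n) t].
have n2 := two_neq0.
have step n t : exists t', good n t ->
    good n.+1 t' /\ cabs (t'.1.1 - t.1.1) <= D / 2 ^+ n.+1.
  have [gt|ngt] := pselect (good n t); last by exists t.
  suff [t' h] : exists t', good n.+1 t' /\ cabs (t'.1.1 - t.1.1) <= D / 2 ^+ n.+1.
    by exists t'.
  case: t gt => -[p q] r [[/= Kp Kq Kr] [/= h1 h2 h3 bt]].
  set e := e0 / 4 ^+ n in bt.
  have eS : e0 / 4 ^+ n.+1 = e / 4 by rewrite /e exprS invfM mulrCA mulrC.
  have dS : D / 2 ^+ n.+1 = (D / 2 ^+ n) / 2 by rewrite exprS invfM mulrCA mulrC.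
  rewrite /good eS dS; set d := D / 2 ^+ n in h1 h2 h3 *.
  have [Kpq Kqr Krp] : [/\ K (mid p q), K (mid q r) & K (mid r p)] by split; exact: cK.
  have d0 : 0 <= d by exact: le_trans (cabs_ge0 _) h1.
  have E x y z t : x - y = (z - t) / 2 -> cabs (z - t) <= d -> cabs (x - y) <= d / 2.
    by move=> -> ?; rewrite cabs_half; lra.
  have E' x y z t : x - y = (z - t) / 2 -> cabs (t - z) <= d -> cabs (x - y) <= d / 2.
    by move=> exy; rewrite (cabs_sub t z) => ?; exact: E exy _.
  have Z x : cabs (x - x) <= d / 2 by rewrite subrr Normc.normc0 divr_ge0.
  have bad4 : [\/ bad (e / 4) (p, mid p q, mid r p), bad (e / 4) (mid p q, q, mid q r),
      bad (e / 4) (mid r p, mid q r, r) | bad (e / 4) (mid p q, mid q r, mid r p)].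
    apply: contrapT => nb.
    have nbad t : ~ bad (e / 4) t -> exists k0, forall k, (k0 <= k)%N ->
        cabs (tri g k t.1.1 t.1.2 t.2) <= e / 4.
      move=> /existsNP[k0 H]; exists k0 => k kk0; rewrite leNgt; apply/negP => Hk.
      by apply: H; exists k.
    have [k1 H1] := nbad _ (fun B => nb (Or41 _ _ _ B)).
    have [k2 H2] := nbad _ (fun B => nb (Or42 _ _ _ B)).
    have [k3 H3] := nbad _ (fun B => nb (Or43 _ _ _ B)).
    have [k4 H4] := nbad _ (fun B => nb (Or44 _ _ _ B)).
    pose k0 := maxn (maxn k1 k2) (maxn k3 k4).
    (* [tri_split] lowers the level by one, so a bad level above [k0.+1] leaves the four pieces at a
       level at least [k0]. *)
    have [k kk0] := bt k0.+1.
    case: k kk0 => [//|k]; rewrite ltnS !geq_max => /andP[/andP[l1 l2] /andP[l3 l4]].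
    apply/negP; rewrite -leNgt /= tri_split.
    have := H1 _ l1; have := H2 _ l2; have := H3 _ l3; have := H4 _ l4 => /=.
    set x1 := tri _ _ _ _ _; set x2 := tri _ _ _ _ _; set x3 := tri _ _ _ _ _.
    set x4 := tri _ _ _ _ _ => A1 A2 A3 A4.
    have := le_normcD (x4 + x3 + x2) x1; have := le_normcD (x4 + x3) x2.
    have := le_normcD x4 x3; lra.
  case: bad4 => B.
  - exists (p, mid p q, mid r p); split; last exact: Z.
    split=> //; split => //=.
    + by apply: E h1; rewrite /mid; field.
    + by apply: E h2; rewrite /mid; field.
    + by apply: E h3; rewrite /mid; field.
  - exists (mid p q, q, mid q r); split; last by move=> /=; apply: E h1; rewrite /mid; field.
    split=> //; split => //=.
    + by apply: E h1; rewrite /mid; field.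
    + by apply: E h2; rewrite /mid; field.
    + by apply: E h3; rewrite /mid; field.
  - exists (mid r p, mid q r, r); split; last by move=> /=; apply: E' h3; rewrite /mid; field.
    split=> //; split => //=.
    + by apply: E h1; rewrite /mid; field.
    + by apply: E h2; rewrite /mid; field.
    + by apply: E h3; rewrite /mid; field.
  - exists (mid p q, mid q r, mid r p); split; last by move=> /=; apply: E h1; rewrite /mid; field.
    split=> //; split => //=.
    + by apply: E' h3; rewrite /mid; field.
    + by apply: E' h1; rewrite /mid; field.
    + by apply: E' h2; rewrite /mid; field.
pose next n t := projT1 (cid (step n t)).
pose fix T n := if n is n'.+1 then next n' (T n') else (a, b, c).
have goodT n : good n (T n).
  elim: n => [|n IH]; last exact: (projT2 (cid (step n (T n))) IH).1.
  have := cabs_ge0 (b - a); have := cabs_ge0 (c - b); have := cabs_ge0 (a - c).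
  by split => //=; rewrite !expr0 !divr1 /D; split => //; lra.
have Tlim n : cabs ((T n.+1).1.1 - (T n).1.1) <= D / 2 ^+ n.+1.
  exact: (projT2 (cid (step n (T n))) (goodT n)).2.
have [x hx] := dyadic_limit Tlim.
have Kx : K x.
  apply: clK => e e_gt0; have [n hn] := geometric_lt (2 * D) e_gt0.
  by exists (T n).1.1; [case: (goodT n) => -[]|exact: le_lt_trans (hx n) hn].
have D0 : 0 <= D by rewrite /D !addr_ge0 ?cabs_ge0.
have [d hd] := dg _ Kx.
(* Each of the three sides will contribute at most [e * (3 * d') * d'], in all
   [9 * e * D ^+ 2 / 4 ^+ n], which has to stay below [e0 / 4 ^+ n]. The added 1 covers [D = 0]. *)
pose e := e0 / (9 * D ^+ 2 + 1).
have den0 : 0 < 9 * D ^+ 2 + 1 by rewrite ltr_wpDl// mulr_ge0// sqr_ge0.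
have e_gt0 : 0 < e by rewrite divr_gt0.
have [r r0 hr] := hd _ e_gt0.
have [n hn] := geometric_lt (3 * D) r0.
have [[Kp Kq Kr] [h1 h2 h3 bn]] := goodT n.
set p := (T n).1.1 in Kp h1 h3 bn; set q := (T n).1.2 in Kq h1 h2 bn.
set s := (T n).2 in Kr h2 h3 bn.
have := hx n; rewrite -/p => hxp.
pose d' := D / 2 ^+ n; rewrite -/d' in h1 h2 h3 hxp hn.
have d'0 : 0 <= d' by rewrite /d' divr_ge0// exprn_ge0.
have {}hxp : cabs (p - x) <= 2 * d' by move: hxp; rewrite /d' mulrA.
have {}hn : 3 * d' < r by move: hn; rewrite /d' mulrA.
(* The vertex [p] is within [2 * d'] of the limit [x], and the other two vertices are within [d'] of
   [p]. *)
pose K' y := K y /\ cabs (y - x) <= 3 * d'.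
have cK' : midconvex K'.
  move=> u v [Ku hu] [Kv hv]; split; first exact: cK.
  have -> : mid u v - x = ((u - x) + (v - x)) / 2 by rewrite /mid; field.
  rewrite cabs_half; have := le_normcD (u - x) (v - x); lra.
have K'p : K' p by split=> //; lra.
have K'q : K' q.
  by split=> //; have := cabs_triangle q p x; lra.
have K's : K' s.
  by split=> //; have := cabs_triangle s p x; rewrite (cabs_sub s p); lra.
pose aff (z : C) := g x - d * x + d * z.
have gM z : K' z -> cabs (g z - aff z) <= e * (3 * d').
  move=> [Kz hz]; have := hr _ Kz (le_lt_trans hz hn).
  have -> : g z - g x - d * (z - x) = g z - aff z by rewrite /aff; ring.
  by move/le_trans; apply; rewrite ler_pM2l.
have [k _] := bn 0%N; apply/negP; rewrite -leNgt /=.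
have -> : tri g k p q s = tri (fun z => g z - aff z) k p q s.
  by rewrite /tri !msumB /aff !msum_affine; field.
have B u v : K' u -> K' v -> cabs (v - u) <= d' ->
    cabs (msum (fun z => g z - aff z) k u v) <= e * (3 * d') * d'.
  move=> Ku Kv uv; apply: (le_trans (msum_bound k cK' gM Ku Kv)).
  by rewrite ler_wpM2l// mulr_ge0 ?(ltW e_gt0)// mulr_ge0.
apply: (@le_trans _ _ (e * 9 * d' ^+ 2)).
  have := B _ _ K'p K'q h1; have := B _ _ K'q K's h2; have := B _ _ K's K'p h3.
  rewrite /tri; set x1 := msum _ _ _ _; set x2 := msum _ _ _ _.
  set x3 := msum _ _ _ _ => A1 A2 A3.
  have := le_normcD (x3 + x2) x1; have := le_normcD x3 x2.
  have -> : e * 9 * d' ^+ 2 = e * (3 * d') * d' + e * (3 * d') * d' + e * (3 * d') * d' by ring.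
  lra.
have -> : d' ^+ 2 = D ^+ 2 / 4 ^+ n.
  by rewrite /d' expr_div_n -exprM mulnC exprM; congr (_ / _ ^+ _); ring.
rewrite mulrA ler_pM2r ?invr_gt0 ?exprn_gt0// -(mulrA e) /e mulrAC.
by rewrite ler_pdivrMr// ler_pM2l// lerDl.
Qed.
End midpoint_sums.

(** * Midpoint sums along closed polygons around a puncture *)

Section polygon.
Context {R : realType}.
Local Notation C := R[i].
Implicit Types (g : C -> C) (a u v w z : C) (K : C -> Prop).

Lemma tends_to0D (s t : nat -> C) : tends_to0 s -> tends_to0 t ->
  tends_to0 (fun k => s k + t k).
Proof.
move=> hs ht e e0; have e20 : 0 < e / 2 by rewrite divr_gt0.
have [k1 h1] := hs _ e20; have [k2 h2] := ht _ e20.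
exists (maxn k1 k2) => k; rewrite geq_max => /andP[kk1 kk2].
rewrite (le_trans (le_normcD _ _))// [leRHS]splitr lerD//; [exact: h1|exact: h2].
Qed.

Lemma tends_to0_sum N (s : 'I_N -> nat -> C) :
  (forall j, tends_to0 (s j)) -> tends_to0 (fun k => \sum_j s j k).
Proof.
elim: N s => [|N IH] s hs.
  by move=> e e0; exists 0%N => k _; rewrite big_ord0 Normc.normc0 ltW.
under [X in tends_to0 X]eq_fun do rewrite big_ord_recl.
by apply: tends_to0D => //; apply: IH.
Qed.

(** The Euclidean inner product of the plane. *)
Definition cdot u v : R := complex.Re (conjc u * v).

Lemma cdotDr u v w : cdot u (v + w) = cdot u v + cdot u w.
Proof. by rewrite /cdot mulrDr ReD. Qed.

Lemma cdot_half u v : cdot u (v / 2) = cdot u v / 2.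
Proof.
suff : cdot u v = cdot u (v / 2) + cdot u (v / 2) by lra.
by rewrite -cdotDr; congr cdot; field.
Qed.

Lemma cdot_cauchy_schwarz u v : `|cdot u v| <= cabs u * cabs v.
Proof.
rewrite (le_trans (cabs_Re _))// Normc.normcM.
by rewrite [cabs (conjc u)](_ : _ = cabs u)//; case: u => x y /=; rewrite sqrrN.
Qed.

Lemma cdot_self u : cdot u u = cabs u ^+ 2.
Proof.
case: u => x y; rewrite /cdot /= sqr_sqrtr ?addr_ge0 ?sqr_ge0//.
by rewrite !expr2 mulNr opprK.
Qed.

Definition disc (r : R) : C -> Prop := fun z => cabs z <= r.

Lemma disc_midconvex r : midconvex (disc r).
Proof.
move=> a b; rewrite /disc /mid cabs_half => ha hb.
by have := le_normcD a b; lra.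
Qed.

Lemma disc_closed r : closed_in_C (disc r).
Proof.
move=> x hx; rewrite /disc leNgt; apply/negP => xr.
have [|y yr] := hx (cabs x - r); first by rewrite subr_gt0.
rewrite /disc in yr; have := cabs_triangle x y 0; rewrite !subr0 (cabs_sub x y).
lra.
Qed.

Definition capped_disc r a u (d : R) : C -> Prop :=
  fun z => disc r z /\ d <= cdot u (z - a).

Lemma capped_disc_midconvex r a u d : midconvex (capped_disc r a u d).
Proof.
move=> y z [ry hy] [rz hz]; split; first exact: disc_midconvex.
have -> : mid y z - a = (y - a) / 2 + (z - a) / 2 by rewrite /mid; field.
by rewrite cdotDr !cdot_half; lra.
Qed.

Lemma capped_disc_closed r a u d : closed_in_C (capped_disc r a u d).
Proof.
move=> x hx; split.
  by apply: disc_closed => e /hx[y [? _] ?]; exists y.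
rewrite leNgt; apply/negP => xd.
pose e := (d - cdot u (x - a)) / (cabs u + 1).
have u0 := cabs_ge0 u.
have u1 : 0 < cabs u + 1 by rewrite ltr_wpDl.
have [|y [_ hy] yx] := hx e; first by rewrite divr_gt0// subr_gt0.
have := hy; rewrite [y - a](_ : _ = (x - a) + (y - x)); last by ring.
rewrite cdotDr; have := cdot_cauchy_schwarz u (y - x).
rewrite ltr_pdivlMr// in yx; rewrite ler_norml => /andP[_].
have := cabs_ge0 (y - x); nra.
Qed.

Lemma cdiff_withinS K K' g z : (forall y, K' y -> K y) ->
  cdiff_within K g z -> cdiff_within K' g z.
Proof.
move=> sKK [d hd]; exists d => e /hd[r r0 hr]; exists r => // y /sKK; exact: hr.
Qed.

Lemma mid_sub a z : mid a z - a = (z - a) / 2.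
Proof. by rewrite /mid; field. Qed.

(* The polygon is shrunk towards [a]: by Goursat's lemma each halving changes
   the sum by a quantity vanishing in the limit, and the shrunk polygons have
   arbitrarily small perimeter. *)
Lemma polygon_tends_to0 g N (x : nat -> C) (r M : R) a :
  x N = x 0%N -> disc r a -> (forall j, disc r (x j)) ->
  (forall j, (j < N)%N -> 0 < cdot (x j - a) (x j.+1 - a)) ->
  (forall z, disc r z -> z != a -> cdiff_within (disc r) g z) ->
  (forall z, disc r z -> z != a -> cabs (g z) <= M) ->
  tends_to0 (fun k => \sum_(j < N) msum g k (x j) (x j.+1)).
Proof.
move=> xN ra rx hx dg gM.
pose h := fix h m j := if m is m'.+1 then mid a (h m' j) else x j.
have rh m j : disc r (h m j).
  by elim: m => [|m IH]; [exact: rx|exact: disc_midconvex].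
have hN m : h m N = h m 0%N by elim: m => //= m ->.
(* A side of the polygon and its halved copy lie in a common half plane that misses [a], because the
   endpoints of the side make an acute angle seen from [a]. Goursat's lemma thus applies between two
   successive polygons, although [g] may be singular at [a]. *)
have cap m j : (j < N)%N -> exists K : C -> Prop,
  [/\ midconvex K, closed_in_C K,
      forall z, K z -> disc r z /\ z != a,
      K (h m j) /\ K (h m j.+1) & K (h m.+1 j) /\ K (h m.+1 j.+1)].
  move=> jN; pose u := x j - a.
  have uu : 0 < cdot u u.
    rewrite cdot_self exprn_gt0// cabs_gt0; apply: contraTneq (hx _ jN).
    by rewrite -/u => ->; rewrite /cdot conjc0 mul0r ltxx.
  pose c := Num.min (cdot u u) (cdot u (x j.+1 - a)).
  have c0 : 0 < c by rewrite lt_min uu hx.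
  have ch m' j' : (j' == j) || (j' == j.+1) -> c / 2 ^+ m' <= cdot u (h m' j' - a).
    move=> jj'; elim: m' => [|m' IH].
      by rewrite expr0 divr1 /= /c ge_min; case/orP: jj' => /eqP ->; rewrite lexx ?orbT.
    rewrite /= mid_sub cdot_half exprS invfM mulrCA mulrC; lra.
  have d0 : 0 < c / 2 ^+ m.+1 by rewrite divr_gt0 ?exprn_gt0.
  have dm : c / 2 ^+ m.+1 <= c / 2 ^+ m.
    rewrite exprS invfM mulrCA mulrC; have : 0 < c / 2 ^+ m by rewrite divr_gt0 ?exprn_gt0.
    lra.
  exists (capped_disc r a u (c / 2 ^+ m.+1)); split.
  - exact: capped_disc_midconvex.
  - exact: capped_disc_closed.
  - move=> z [rz hz]; split => //; apply: contraTneq hz => ->.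
    by rewrite subrr /cdot mulr0 -ltNge.
  - by split; split=> //; apply: le_trans dm _; apply: ch; rewrite eqxx ?orbT.
  - by split; split=> //; apply: ch; rewrite eqxx ?orbT.
pose W m k := \sum_(j < N) msum g k (h m j) (h m j.+1).
have Wstep m : tends_to0 (fun k => W m k - W m.+1 k).
  (* Each quadrilateral between a side and its halved copy is cut into two triangles; the radial
     sides [l j] telescope around the closed polygon. *)
  have -> : (fun k => W m k - W m.+1 k) = (fun k => \sum_(j < N)
     (tri g k (h m.+1 j) (h m j) (h m j.+1) + tri g k (h m.+1 j) (h m j.+1) (h m.+1 j.+1))).
    apply/funext => k; rewrite /W -sumrB.
    pose l j := msum g k (h m.+1 j) (h m j).
    transitivity (\sum_(j < N) (msum g k (h m j) (h m j.+1) -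
      msum g k (h m.+1 j) (h m.+1 j.+1) - (l j.+1 - l j))).
      rewrite [in RHS]big_split/= sumrN -(big_mkord xpredT (fun j => l j.+1 - l j)).
      by rewrite telescope_sumr// /l !hN subrr subr0.
    apply: eq_bigr => j _; rewrite /l /tri.
    rewrite (msumN g k (h m.+1 j) (h m j.+1)) (msumN g k (h m.+1 j) (h m.+1 j.+1)).
    by rewrite (msumN g k (h m.+1 j.+1) (h m j.+1)); ring.
  apply: tends_to0_sum => j; have [K [cK clK Ka [K1 K2] [K3 K4]]] := cap m j (ltn_ord j).
  have dK z : K z -> cdiff_within K g z.
    move=> Kz; have [rz za] := Ka _ Kz.
    by apply: cdiff_withinS (dg _ rz za) => y /Ka[].
  by apply: tends_to0D; exact: goursat dK _ _ _.
have W0 m : tends_to0 (fun k => W 0%N k - W m k).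
  elim: m => [|m IH].
    by move=> e e0; exists 0%N => k _; rewrite subrr Normc.normc0 ltW.
  have := tends_to0D IH (Wstep m); congr tends_to0; apply/funext => k.
  by rewrite addrA subrK.
pose D := `|M| * \sum_(j < N) cabs (x j.+1 - x j).
have hD m j : cabs (h m j.+1 - h m j) = cabs (x j.+1 - x j) / 2 ^+ m.
  elim: m => [|m IH]; first by rewrite expr0 divr1.
  rewrite /= exprS invfM mulrCA mulrC -IH -cabs_half; congr cabs.
  by rewrite /mid; field.
have Wb m k : cabs (W m k) <= D / 2 ^+ m.
  rewrite /W (le_trans (ler_cabs_sum _ _ _))// /D -mulrA mulr_suml mulr_sumr.
  apply: ler_sum => j _; have [K [cK _ Ka [K1 K2] _]] := cap m j (ltn_ord j).
  rewrite -hD (msum_bound k cK _ K1 K2)// => z /Ka[rz za].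
  by rewrite (le_trans (gM _ rz za))// ler_norm.
move=> e e0; have e20 : 0 < e / 2 by rewrite divr_gt0.
have [m hm] := geometric_lt D e20.
have [k0 hk0] := W0 m _ e20; exists k0 => k kk0.
rewrite -/(W 0%N k) -(subrK (W m k) (W 0%N k)).
rewrite (le_trans (le_normcD _ _))// [leRHS]splitr lerD ?hk0//.
exact: le_trans (Wb m k) (ltW hm).
Qed.
End polygon.

(** * Interpolation at roots of unity *)

Section interpolation.
Context {R : realType}.
Local Notation C := R[i].
Implicit Types (phi : C -> C) (a z w : C).

Definition cis (t : R) : C := Complex (cos t) (sin t).

Lemma cisD s t : cis (s + t) = cis s * cis t.
Proof. by rewrite /cis cosD sinD; congr Complex; ring. Qed.

Lemma cis0 : cis 0 = 1. Proof. by rewrite /cis cos0 sin0. Qed.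

Lemma cisX t k : cis t ^+ k = cis (k%:R * t).
Proof.
elim: k => [|k IH]; first by rewrite expr0 mul0r cis0.
by rewrite exprS IH -cisD -[in RHS]natr1 mulrDl mul1r addrC.
Qed.

Lemma cabs_cis t : cabs (cis t) = 1.
Proof. by rewrite /= cos2Dsin2 sqrtr1. Qed.

Lemma cis_neq1 t : 0 < t -> t < 2 * pi -> cis t != 1.
Proof.
move=> t0 t2; have t'0 : 0 < sin (t / 2).
  by apply: sin_gt0_pi; rewrite divr_gt0//= ltr_pdivrMr// mulrC.
apply/eqP => /(congr1 (@complex.Re R)) /=.
have -> : t = t / 2 + t / 2 by rewrite -splitr.
rewrite cosD -!expr2 cos2sin2; nra.
Qed.

Definition root_of_unity N (w : C) :=
  [/\ w ^+ N = 1, forall k, (0 < k < N)%N -> w ^+ k != 1 & cabs w = 1].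

Lemma root_of_unity_near1 (d : R) : 0 < d ->
  exists N w, [/\ (1 < N)%N, root_of_unity N w & cabs (w - 1) < d].
Proof.
move=> d0; have d20 : 0 < d / 2 by rewrite divr_gt0.
have /cvgrPdist_lt/(_ _ d20)[/= e1 e10 h1] := @continuous_cos R 0.
have /cvgrPdist_lt/(_ _ d20)[/= e2 e20 h2] := @continuous_sin R 0.
pose e := Num.min e1 e2; have e0 : 0 < e by rewrite lt_min e10.
have pi0 := @pi_gt0 R.
(* One successor puts [N] above [2 * pi / e], the second one ensures [1 < N]. *)
pose N := (Num.truncn (2 * pi / e)).+2.
have Ngt : 2 * pi / e < N%:R.
  by apply: (lt_trans (truncnS_gt _)); rewrite ltr_nat.
have N0 : (0 : R) < N%:R by rewrite ltr0n.
pose t : R := 2 * pi / N%:R.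
have t0 : 0 < t by rewrite divr_gt0// mulr_gt0.
have te : t < e by rewrite /t ltr_pdivrMr// (mulrC e) -ltr_pdivrMr.
have Nt : N%:R * t = 2 * pi by rewrite /t mulrC divfK// gt_eqF.
exists N, (cis t); split=> //; first split.
- by rewrite cisX Nt /cis mulr_natl cos2pi sin2pi.
- move=> k /andP[k0 kN]; rewrite cisX; apply: cis_neq1.
    by rewrite mulr_gt0// ltr0n.
  by rewrite -Nt ltr_pM2r// ltr_nat.
- exact: cabs_cis.
have tb e' : e <= e' -> `|0 - t| < e'.
  by move=> ee'; rewrite sub0r normrN gtr0_norm// (lt_le_trans te).
rewrite (le_lt_trans (cabs_le_ReIm _))// [ltRHS]splitr ltrD//=.
  by have := h1 t (tb _ _); rewrite cos0 distrC; apply; rewrite ge_min lexx.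
have := h2 t (tb _ _); rewrite sin0 sub0r normrN subr0.
by apply; rewrite ge_min lexx orbT.
Qed.

(* The polynomial in [a] of degree less than [N] interpolating [phi] at the
   points [r * w ^+ j]. *)
Definition interp N (r : R) (w : C) phi a : C :=
  N%:R^-1 * \sum_(j < N) phi (real_complex R r * w ^+ j) *
    \sum_(k < N) (a / (real_complex R r * w ^+ j)) ^+ k.

Lemma sum_root_of_unity N w k : root_of_unity N w -> (0 < k < N)%N ->
  \sum_(j < N) (w ^- k) ^+ j = 0.
Proof.
move=> [wN w1 _] kN; have vN : (w ^- k) ^+ N = 1.
  by rewrite exprVn -exprM mulnC exprM wN expr1n invr1.
have v1 : w ^- k - 1 != 0.
  by rewrite subr_eq0 -[X in _ != X]invr1 (inj_eq invr_inj) w1.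
by apply: (mulfI v1); rewrite -subrX1 vN subrr mulr0.
Qed.

(** Interpolation reproduces constants: after exchanging the sums, only [k = 0] survives. *)
Lemma sum_interp_weights N (r : R) w a : 0 < r -> root_of_unity N w ->
  \sum_(j < N) \sum_(k < N) (a / (real_complex R r * w ^+ j)) ^+ k = N%:R.
Proof.
move=> r0 hw; rewrite exchange_big/=; case: N hw => [|N] hw.
  by rewrite big_ord0.
rewrite big_ord_recl/= [X in _ + X]big1 ?addr0.
  rewrite (eq_bigr (fun=> 1)) ?sumr_const ?card_ord// => j _; exact: expr0.
move=> k _; rewrite /bump /= add1n.
transitivity ((a / real_complex R r) ^+ k.+1 * \sum_(j < N.+1) (w ^- k.+1) ^+ j).
  rewrite mulr_sumr; apply: eq_bigr => j _.
  by rewrite invfM mulrA exprMn; congr (_ * _); rewrite !exprVn -!exprM mulnC.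
by rewrite sum_root_of_unity ?mulr0//= ltnS ltn_ord.
Qed.

Definition dquot phi a z := (phi z - phi a) / (z - a).

(** All nodes [x] satisfy [x ^+ N = r ^+ N], so the geometric sum at each node has the common factor
    [1 - (a / r) ^+ N] and the kernel [x / (x - a)]. As constants are reproduced, the error is a
    discrete Cauchy integral of the difference quotient. *)
Lemma interp_error N (r : R) w phi a : 0 < r -> cabs a < r -> (0 < N)%N ->
    root_of_unity N w ->
  interp N r w phi a - phi a = (1 - (a / real_complex R r) ^+ N) *
    (N%:R^-1 * \sum_(j < N) dquot phi a (real_complex R r * w ^+ j) *
       (real_complex R r * w ^+ j)).
Proof.
move=> r0 ar N0 hw; have [wN _ w1] := hw.
have NC : N%:R != 0 :> C by rewrite pnatr_eq0 -lt0n.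
rewrite mulrCA mulr_sumr.
rewrite /interp -[phi a in LHS](mulKf NC) -mulrBr; congr (_ * _).
rewrite -(sum_interp_weights a r0 hw) mulr_suml -sumrB.
apply: eq_bigr => j _; set x := real_complex R r * w ^+ j.
have xr : cabs x = r by rewrite Normc.normcM cabsX w1 expr1n mulr1 cabs_real gtr0_norm.
have x0 : x != 0 by rewrite -cabs_gt0 xr.
have xa : x - a != 0 by rewrite subr_eq0; apply: contraTneq ar => <-; rewrite xr ltxx.
have -> : (a / real_complex R r) ^+ N = (a / x) ^+ N.
  rewrite /x invfM mulrA [in RHS]exprMn [X in _ = _ * X](_ : _ = 1) ?mulr1//.
  by rewrite exprVn -exprM mulnC exprM wN expr1n invr1.
have -> : 1 - (a / x) ^+ N = (1 - a / x) * \sum_(k < N) (a / x) ^+ k.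
  by rewrite -opprB subrX1 -mulNr opprB.
rewrite mulrC -mulrBr mulrC; set s := \sum_(k < N) _.
by rewrite /dquot; field; rewrite x0 xa.
Qed.

Lemma dquot_cdiff K phi a z : z != a -> cdiff_within K phi z ->
  cdiff_within K (dquot phi a) z.
Proof.
move=> za [d hd]; pose B := d * (z - a) - (phi z - phi a).
exists (B / (z - a) ^+ 2) => e e0.
have za0 : z - a != 0 by rewrite subr_eq0.
pose c := cabs (z - a) / 2; have c0 : 0 < c by rewrite divr_gt0// cabs_gt0.
have [|r1 r10 h1] := hd (e * c / 2); first by rewrite divr_gt0// mulr_gt0.
(* Since [y] stays at distance [c] from [a], this makes the quadratic term with factor [B] at most
   [e / 2] times [cabs (y - z)]; the choice of [r1] does the same for [rho]. *)
pose b := e * c * cabs (z - a) ^+ 2 / (2 * (cabs B + 1)).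
have B1 : 0 < cabs B + 1 by rewrite ltr_wpDl// cabs_ge0.
have b0 : 0 < b.
  by rewrite divr_gt0 ?mulr_gt0 ?exprn_gt0 ?cabs_gt0.
exists (Num.min r1 (Num.min c b)); first by rewrite !lt_min r10 c0.
move=> y Ky; rewrite !lt_min => /and3P[y1 yc yb].
have yac : c <= cabs (y - a).
  have := cabs_triangle z y a; rewrite (cabs_sub z y) => h.
  have : cabs (z - a) = c + c by rewrite -splitr.
  lra.
have ya0 : y - a != 0 by rewrite -cabs_gt0 (lt_le_trans c0).
pose rho := phi y - phi z - d * (y - z).
have -> : dquot phi a y - dquot phi a z - B / (z - a) ^+ 2 * (y - z) =
    rho / (y - a) - B * (y - z) ^+ 2 / ((y - a) * (z - a) ^+ 2).
  by rewrite /dquot /rho /B; field; rewrite ya0 za0.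
rewrite (le_trans (ler_cabsB _ _))// (Normc.normcM rho) (Normc.normcM (B * _)).
rewrite (Normc.normcM B) !Normc.normcV (Normc.normcM (y - a)) !cabsX.
have hrho := h1 _ Ky y1; rewrite -/rho in hrho.
have yac0 : 0 < cabs (y - a) by exact: lt_le_trans yac.
have Z0 : 0 < cabs (z - a) ^+ 2 by rewrite exprn_gt0// cabs_gt0.
have yz0 := cabs_ge0 (y - z); have CB0 := cabs_ge0 B.
have -> : e * cabs (y - z) = e / 2 * cabs (y - z) + e / 2 * cabs (y - z) by lra.
apply: lerD.
  rewrite ler_pdivrMr//; apply: (le_trans hrho).
  rewrite [leLHS](_ : _ = e / 2 * cabs (y - z) * c); last by lra.
  by rewrite ler_wpM2l// mulr_ge0// divr_ge0// ltW.
rewrite ler_pdivrMr ?mulr_gt0 ?cabs_gt0//.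
move: yb; rewrite /b ltr_pdivlMr ?mulr_gt0// => yb.
set u := cabs (y - z) in yz0 yb *; set Z := cabs (z - a) ^+ 2 in Z0 yb *.
apply: (@le_trans _ _ (u * (u * (cabs B + 1)))).
  by have := mulr_ge0 yz0 yz0; rewrite expr2; lra.
apply: (@le_trans _ _ (e / 2 * u * (c * Z))).
  rewrite [leRHS](_ : _ = u * (e / 2 * (c * Z))); last by ring.
  by rewrite ler_wpM2l//; lra.
rewrite ler_wpM2l//; first by rewrite mulr_ge0// divr_ge0// ltW.
by rewrite ler_wpM2r// ltW.
Qed.

(** Close to [a] the derivative bounds the quotient, further away the bound on [phi] does.
    [polygon_tends_to0] needs this at its puncture. *)
Lemma dquot_bounded (r M : R) phi a : disc r a -> cdiff_within (disc r) phi a ->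
  (forall z, disc r z -> cabs (phi z) <= M) ->
  exists M', forall z, disc r z -> z != a -> cabs (dquot phi a z) <= M'.
Proof.
move=> ra [d hd] phiM; have [e e0 he] := hd 1 ltr01.
have M0 : 0 <= M := le_trans (cabs_ge0 _) (phiM _ ra).
exists (cabs d + 1 + 2 * M / e) => z rz za.
have za0 : 0 < cabs (z - a) by rewrite cabs_gt0 subr_eq0.
rewrite /dquot Normc.normcM Normc.normcV ler_pdivrMr//.
have Me : 0 <= 2 * M / e by rewrite divr_ge0 ?mulr_ge0 ?(ltW e0).
have d0 := cabs_ge0 d.
have [ze|ze] := ltP (cabs (z - a)) e.
  have := he _ rz ze; have := le_normcD (phi z - phi a - d * (z - a)) (d * (z - a)).
  rewrite subrK Normc.normcM; have := mulr_ge0 Me (ltW za0); nra.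
apply: (@le_trans _ _ (2 * M)).
  by rewrite (le_trans (ler_cabsB _ _))// mulr_natl mulr2n lerD// phiM.
apply: (@le_trans _ _ (2 * M / e * cabs (z - a))).
  by rewrite mulrAC ler_pdivlMr// ler_wpM2l// mulr_ge0.
by rewrite ler_wpM2r ?(ltW za0)// lerDr addr_ge0.
Qed.

(** Multiplied by [w - 1], the sum in [interp_error] becomes a left-endpoint Riemann sum of the
    difference quotient along the polygon of nodes. It differs from the midpoint sums, which tend to
    0, only by the oscillation of the quotient on each side. The order of the quantifiers lets one
    [N] and one [w] serve all functions with the same bound and the same modulus of continuity,
    hence all slices of a function of several variables. *)
Lemma interp_approx (r r' M e : R) : 0 <= r -> r < r' -> 0 <= M -> 0 < e ->
  exists2 eta, 0 < eta & forall d : R, 0 < d ->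
  exists N w, [/\ (0 < N)%N, root_of_unity N w &
  forall phi, (forall z, disc r' z -> cdiff_within (disc r') phi z) ->
    (forall z, disc r' z -> cabs (phi z) <= M) ->
    (forall y z, disc r' y -> disc r' z -> cabs (y - z) < d ->
       cabs (phi y - phi z) <= eta) ->
    forall a, disc r a -> cabs (interp N r' w phi a - phi a) <= e].
Proof.
(* Nodes are at distance at least [2 * c] from [a] and the sides will be shorter than [c], so that
   the sides stay at distance [c] from [a]. *)
move=> r0 rr' M0 e0; pose c := (r' - r) / 2.
have c0 : 0 < c by rewrite divr_gt0// subr_gt0.
have r'0 : 0 < r' := le_lt_trans r0 rr'.
(* The final error is at most [2 * osc * r'] with [osc = eta / c + 2 * M * s / c ^+ 2], where [s] is
   the length of a side. This [eta] turns the first term into [e / 2]; the last bound in [b] limits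
   the second one to [e / 2]. *)
pose eta := e * c / (4 * r').
have r40 : 0 < 4 * r' by lra.
exists eta; first by rewrite /eta divr_gt0// mulr_gt0.
move=> d d0; pose b := Num.min d (Num.min c (e * c ^+ 2 / (8 * r' * (M + 1)))).
have M1 : 0 < M + 1 by rewrite ltr_wpDl.
have r80 : 0 < 8 * r' * (M + 1) by rewrite !mulr_gt0.
have c20 : 0 < c ^+ 2 by rewrite exprn_gt0.
have b0 : 0 < b by rewrite !lt_min d0 c0 divr_gt0// mulr_gt0.
have [|N [w [N1 hw wb]]] := @root_of_unity_near1 (b / r'); first by rewrite divr_gt0.
have N0 : (0 < N)%N := ltnW N1.
exists N, w; split=> // phi dphi phiM phiu a ra.
have ar : cabs a < r' := le_lt_trans ra rr'.
pose x j := real_complex R r' * w ^+ j.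
have [wN wk w1] := hw.
have xr j : cabs (x j) = r'.
  by rewrite /x Normc.normcM cabsX w1 expr1n mulr1 cabs_real gtr0_norm.
pose s := r' * cabs (w - 1).
have xx j : x j.+1 - x j = x j * (w - 1) by rewrite /x exprSr; ring.
have xs j : cabs (x j.+1 - x j) = s by rewrite xx Normc.normcM xr.
have sb : s < b by rewrite /s mulrC -ltr_pdivlMr.
have [sd sc se] : [/\ s < d, s < c & s * (8 * r' * (M + 1)) < e * c ^+ 2].
  by rewrite -(ltr_pdivlMr _ _ r80); move: sb; rewrite !lt_min => /and3P.
have w10 : 0 < cabs (w - 1).
  by rewrite cabs_gt0 subr_eq0 -[w]expr1 wk.
have s0 : 0 < s by rewrite mulr_gt0.
have rc : r' - r = 2 * c by rewrite /c mulrC divfK.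
have da : disc r' a by rewrite /disc ltW.
have dx j : disc r' (x j) by rewrite /disc xr.
have far y j : cabs (y - x j) <= s -> c <= cabs (y - a).
  move=> yx; have := cabs_triangle (x j) y a; rewrite (cabs_sub (x j) y).
  have := cabs_triangle (x j) a 0; rewrite !subr0 xr; rewrite /disc in ra.
  lra.
pose osc := eta / c + 2 * M * s / c ^+ 2.
have osc_ok j y : disc r' y -> cabs (y - x j) <= s ->
    cabs (dquot phi a y - dquot phi a (x j)) <= osc.
  move=> ry yx; have fy := far _ _ yx.
  have fx : c <= cabs (x j - a) by apply: (far _ j); rewrite subrr Normc.normc0 ltW.
  have ya0 : y - a != 0 by rewrite -cabs_gt0 (lt_le_trans c0).
  have xa0 : x j - a != 0 by rewrite -cabs_gt0 (lt_le_trans c0).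
  have -> : dquot phi a y - dquot phi a (x j) = (phi y - phi (x j)) / (y - a) +
      (phi (x j) - phi a) * (x j - y) / ((y - a) * (x j - a)).
    by rewrite /dquot; field; rewrite ya0 xa0.
  rewrite (le_trans (le_normcD _ _))// !Normc.normcM !Normc.normcV !Normc.normcM.
  have cy : (cabs (y - a))^-1 <= c^-1 by rewrite lef_pV2// posrE (lt_le_trans c0).
  apply: lerD.
    apply: ler_pM; rewrite ?cabs_ge0 ?invr_ge0 ?cabs_ge0//.
    by apply: phiu => //; exact: le_lt_trans yx sd.
  apply: ler_pM; rewrite ?mulr_ge0 ?invr_ge0 ?mulr_ge0 ?cabs_ge0//.
    apply: ler_pM; rewrite ?cabs_ge0//; last by rewrite cabs_sub.
    by rewrite (le_trans (ler_cabsB _ _))// mulr_natl mulr2n lerD// phiM.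
  have p0 : 0 < cabs (y - a) * cabs (x j - a) by rewrite mulr_gt0 ?cabs_gt0.
  rewrite lef_pV2 ?posrE//.
  by rewrite expr2 ler_pM// ltW.
pose G := \sum_(j < N) dquot phi a (x j) * x j.
have Gle : cabs G <= osc * N%:R * r'.
  (* The factor [w - 1] is inserted because [x j.+1 - x j = x j * (w - 1)]. *)
  rewrite -(ler_pM2l w10); have -> : cabs (w - 1) * (osc * N%:R * r') = osc * N%:R * s.
    by rewrite /s; ring.
  apply/ler_addgt0Pr => e' e'0.
  have [M' hM'] := dquot_bounded da (dphi _ da) phiM.
  have xN : x N = x 0%N by rewrite /x wN expr0.
  have xdot : forall i, (i < N)%N -> 0 < cdot (x i - a) (x i.+1 - a).
    move=> i _; have -> : x i.+1 - a = (x i - a) + (x i.+1 - x i) by ring.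
    rewrite cdotDr cdot_self.
    have := cdot_cauchy_schwarz (x i - a) (x i.+1 - x i); rewrite xs.
    have : c <= cabs (x i - a) by apply: (far _ i); rewrite subrr Normc.normc0 ltW.
    rewrite ler_norml => ? /andP[? _]; nra.
  have dq z : disc r' z -> z != a -> cdiff_within (disc r') (dquot phi a) z.
    by move=> rz za; apply: dquot_cdiff => //; exact: dphi.
  have [k0 hk0] := polygon_tends_to0 xN da dx xdot dq hM' e'0.
  have {}hk0 := hk0 _ (leqnn k0); rewrite -Normc.normcM.
  set S := \sum_(j < N) _ in hk0.
  have SG : cabs (S - (w - 1) * G) <= osc * N%:R * s.
    rewrite /S /G mulr_sumr -sumrB (le_trans (ler_cabs_sum _ _ _))//.
    apply: (@le_trans _ _ (\sum_(i < N) osc * s)); last first.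
      by rewrite sumr_const card_ord -[leLHS]mulr_natr; lra.
    apply: ler_sum => i _; have -> : (w - 1) * (dquot phi a (x i) * x i) =
       dquot phi a (x i) * (x i.+1 - x i) by rewrite xx; ring.
    rewrite -[in leRHS](xs i).
    pose K y := disc r' y /\ cabs (y - x i) <= s.
    have cK : midconvex K.
      move=> u v [ru hu] [rv hv]; split; first exact: disc_midconvex.
      have -> : mid u v - x i = (u - x i) / 2 + (v - x i) / 2 by rewrite /mid; field.
      by rewrite (le_trans (le_normcD _ _))// !cabs_half; lra.
    apply: (msum_osc k0 cK) => [v [rv vx]| |]; first exact: osc_ok.
      by split=> //; rewrite subrr Normc.normc0 ltW.
    by split=> //; rewrite xs.
  have := cabs_triangle ((w - 1) * G) S 0; rewrite !subr0 (cabs_sub _ S); lra.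
rewrite interp_error// -/G !Normc.normcM Normc.normcV cabs_nat.
have NR : (0 : R) < N%:R by rewrite ltr0n.
have q2 : cabs (1 - (a / real_complex R r') ^+ N) <= 2.
  rewrite (le_trans (ler_cabsB _ _))// Normc.normc1 cabsX -[leRHS]/(1 + 1) lerD2l.
  rewrite exprn_ile1 ?cabs_ge0// Normc.normcM Normc.normcV cabs_real gtr0_norm//.
  by rewrite ler_pdivrMr// mul1r ltW.
have GN : N%:R^-1 * cabs G <= osc * r'.
  by rewrite ler_pdivrMl//; move: Gle; lra.
have osc0 : 2 * (osc * r') <= e.
  rewrite /osc /eta.
  have -> : 2 * ((e * c / (4 * r') / c + 2 * M * s / c ^+ 2) * r') =
     e / 2 + 4 * M * s * r' / c ^+ 2 by field; rewrite (gt_eqF c0) (gt_eqF r'0).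
  have : 4 * M * s * r' / c ^+ 2 <= e / 2.
    rewrite ler_pdivrMr ?exprn_gt0//.
    have : 0 < s * r' by rewrite mulr_gt0.
    nra.
  lra.
apply: le_trans osc0; apply: ler_pM; rewrite ?cabs_ge0// mulr_ge0 ?cabs_ge0//.
Qed.

End interpolation.

(** * Holomorphic functions on polydiscs *)

Section holomorphy.
Context {R : realType}.
Local Notation C := R[i].

Lemma near_eq_differentiable (V W : normedModType C) (f g : V -> W) (x : V) :
  {near x, f =1 g} -> differentiable f x -> differentiable g x.
Proof.
move=> fg df; have [cdf fE] := (diff_locallyP _ _).1 df.
have gE : g \o shift x = cst (g x) + 'd f x +o_ 0 id.
  apply/eqaddoP => _/posnumP[e].
  have /eqaddoP/(_ e%:num (gt0 e)) := fE.
  have fgx : f x = g x by exact: nbhs_singleton fg.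
  have : \forall h \near (0 : V), f (h + x) = g (h + x).
    have : \forall y \near x, f y = g y by exact: fg.
    by rewrite (near_shift 0); apply: filterS => y /=; rewrite subr0.
  apply: filterS2 => h fgh.
  by rewrite /= /cst /= !fctE -fgx -fgh.
by apply/diff_locallyP; rewrite (diff_unique cdf gE).
Qed.

Lemma nbhs0_cabs (P : set C) : nbhs (0 : C^o) P ->
  exists2 r : R, 0 < r & forall h : C, cabs h < r -> P h.
Proof.
move=> /nbhs_ballP[e /= e0 eP]; have eE : e = real_complex R (complex.Re e).
  by rewrite RRe_real// gtr0_real.
exists (complex.Re e); first by rewrite -ltcR -eE.
move=> h he; apply: eP; rewrite -ball_normE/= sub0r normrN.
by rewrite eE cabsE ltcR.
Qed.

Lemma cdiff_within_differentiable (K : C -> Prop) (phi : C^o -> C^o) (x : C^o) :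
  differentiable phi x -> cdiff_within K phi x.
Proof.
move=> dphi; exists ('d phi (x : C^o) (1 : C^o)) => e e0.
have /eqaddoP/(_ (real_complex R e)) := diff_locally dphi.
rewrite ltcR => /(_ e0) /nbhs0_cabs[r r0 hr]; exists r => // y _ yx.
have := hr _ yx; rewrite /= !fctE /= subrK !cabsE -rmorphM/= lecR.
have -> : 'd phi (x : C^o) (y - x) = 'd phi (x : C^o) (1 : C^o) * (y - x).
  by rewrite -[in LHS](mulr1 (y - x)) [LHS]linearZ/= mulrC.
by rewrite opprD addrA.
Qed.

Context {n : nat}.
Local Notation Cn := ('rV[C]_n : normedModType C).

Lemma polydiscE (z : Cn) : polydisc z <-> forall j, cabs (z 0 j) < 1.
Proof.
by split=> + j => /(_ j); rewrite cabsE -(rmorph1 (real_complex R)) ltcR.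
Qed.

Definition cpolydisc (r : R) : set Cn := [set z | forall j, cabs (z 0 j) <= r].

Lemma cpolydiscS (r s : R) : r <= s -> cpolydisc r `<=` cpolydisc s.
Proof. by move=> rs z rz j; exact: le_trans (rz j) rs. Qed.

Lemma cpolydisc_polydisc (r : R) : r < 1 -> cpolydisc r `<=` @polydisc R n.
Proof. by move=> r1 z rz; apply/polydiscE => j; exact: le_lt_trans (rz j) r1. Qed.

Lemma polydisc_cpolydisc (z : Cn) : polydisc z ->
  exists r, [/\ 0 <= r, r < 1 & cpolydisc r z].
Proof.
move=> /polydiscE hz.
exists (\big[Num.max/0]_(j < n) cabs (z 0 j)); split.
- by apply: bigmax_ge_id.
- by apply: bigmax_lt => // j _; exact: hz.
- by move=> j; exact: le_bigmax_cond.
Qed.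

Lemma ball_cabs (x y : Cn) (e : R) : 0 < e ->
  ball x (real_complex R e) y <-> forall j, cabs (x 0 j - y 0 j) < e.
Proof.
move=> e0; split.
  by move=> [_ h] j; have := h 0 j; rewrite -ball_normE/= cabsE ltcR.
move=> h; split; first by rewrite ltcR.
by move=> i j; rewrite ord1 -ball_normE/= cabsE ltcR.
Qed.

Lemma nbhs_cabs (x : Cn) (P : set Cn) : nbhs x P <->
  exists2 e : R, 0 < e & forall y : Cn, (forall j, cabs (x 0 j - y 0 j) < e) -> P y.
Proof.
split=> [/nbhs_ballP[e /= e0 eP]|[e e0 eP]].
  have eE : e = real_complex R (complex.Re e) by rewrite RRe_real// gtr0_real.
  have e'0 : 0 < complex.Re e by rewrite -ltcR -eE.
  exists (complex.Re e) => // y xy; apply: eP; rewrite eE.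
  exact/ball_cabs.
apply/nbhs_ballP; exists (real_complex R e); first by rewrite /= ltcR.
by move=> y /(ball_cabs _ _ e0); exact: eP.
Qed.

Lemma open_polydisc : open (@polydisc R n : set Cn).
Proof.
rewrite openE => z /polydisc_cpolydisc[r [r0 r1 rz]].
apply/nbhs_cabs; exists (1 - r); first by rewrite subr_gt0.
move=> y zy; apply/polydiscE => j; have := zy j; have := rz j.
have := cabs_triangle (y 0 j) (z 0 j) 0; rewrite !subr0 (cabs_sub (y 0 j)).
lra.
Qed.

Lemma holomorphic_slice (f : Cn -> C^o) (z v : Cn) (K : C -> Prop) (x : C) :
  holomorphic f -> polydisc (z + x *: v) ->
  cdiff_within K (fun t => f (z + t *: v)) x.
Proof.
move=> hf xv; apply: (@cdiff_within_differentiable K (fun t : C^o => f (z + t *: v))).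
have ds : differentiable (fun t : C^o => z + t *: v : Cn) (x : C^o).
  apply: differentiableD; first exact: differentiable_cst.
  by apply: (@differentiableZl _ _ _ (fun t : C^o => t) v); exact: ex_diff.
exact: (@differentiable_comp _ _ _ _ (fun t : C^o => z + t *: v : Cn) f x ds (hf _ xv)).
Qed.

Lemma compact_disc (r : R) : compact (disc r : set C^o).
Proof.
pose h (p : R * R) : C^o := Complex p.1 p.2.
have ch : continuous h.
  move=> p; apply/cvgrPdist_lt => e e0 /=.
  have eE : e = real_complex R (complex.Re e) by rewrite RRe_real// gtr0_real.
  have e20 : 0 < complex.Re e / 2 by rewrite divr_gt0// -ltcR -eE.
  have : \forall q \near p, `|p.1 - q.1| < complex.Re e / 2 /\ `|p.2 - q.2| < complex.Re e / 2.
    exists (ball p.1 (complex.Re e / 2), ball p.2 (complex.Re e / 2)).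
      by split; exact: nbhsx_ballx.
    by move=> q [] /=; rewrite -!ball_normE.
  apply: filterS => q [q1 q2]; rewrite eE cabsE ltcR.
  by rewrite (le_lt_trans (cabs_le_ReIm _))// [ltRHS]splitr !(ReB, ImB) ltrD.
have cI : compact (`[- r, r]%classic `*` `[- r, r]%classic : set (R * R)).
  by apply: compact_setX; exact: segment_compact.
have chI : compact (h @` (`[- r, r]%classic `*` `[- r, r]%classic)).
  by apply: continuous_compact => //; exact: continuous_subspaceT.
apply: (subclosed_compact _ chI).
  move=> x clx; apply: disc_closed => e e0.
  have e0C : 0 < real_complex R e by rewrite ltcR.
  have [y [ry xy]] := clx _ (nbhsx_ballx x _ e0C).
  by exists y => //; move: xy; rewrite -ball_normE/= cabsE ltcR cabs_sub.
move=> x rx; exists (complex.Re x, complex.Im x); last by case: x rx.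
rewrite /disc in rx; have := cabs_Re x; have := cabs_Im x.
by split; rewrite /= in_itv/= -ler_norml; exact: le_trans rx.
Qed.

Lemma compact_cpolydisc (r : R) : compact (cpolydisc r).
Proof.
exact: (@rV_compact C^o n (fun=> disc r : set C^o) (fun=> @compact_disc r)).
Qed.

Section continuous_on_cpolydisc.
Context (f : Cn -> C^o) (r : R).
Hypothesis (cf : forall z, cpolydisc r z -> {for z, continuous f}).

Lemma continuous_cabs (z : Cn) (e : R) : cpolydisc r z -> 0 < e ->
  exists2 d : R, 0 < d & forall y : Cn, (forall j, cabs (z 0 j - y 0 j) < d) ->
    cabs (f z - f y) < e.
Proof.
move=> rz e0; have /cvgrPdist_lt/(_ (real_complex R e)) := cf rz.
rewrite ltcR => /(_ e0)/nbhs_cabs[d d0 hd]; exists d => // y /hd.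
by rewrite cabsE ltcR.
Qed.

(** Compactness is used in its near-covering form: a property of [d] valid near 0 locally uniformly
    in [y] is valid near 0 uniformly on the compact set. [bounded_cpolydisc] does the same with
    bounds near infinity. *)
Lemma uniformly_continuous_cpolydisc (e : R) : 0 < e ->
  exists2 d : R, 0 < d & forall y z : Cn, cpolydisc r y -> cpolydisc r z ->
    (forall j, cabs (y 0 j - z 0 j) < d) -> cabs (f y - f z) <= e.
Proof.
move=> e0; have e20 : 0 < e / 2 by rewrite divr_gt0.
pose P (d : R) (y : Cn) := forall z, cpolydisc r z ->
  (forall j, cabs (y 0 j - z 0 j) < d) -> cabs (f y - f z) <= e.
have := (compact_near_coveringP _).1 (@compact_cpolydisc r) R (0^'+) P _.
case.
  move=> x rx; have [d d0 hd] := continuous_cabs rx e20.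
  have d20 : 0 < d / 2 by rewrite divr_gt0.
  exists ([set y : Cn | forall j, cabs (x 0 j - y 0 j) < d / 2], [set t : R | t < d / 2]).
    split; first by apply/nbhs_cabs; exists (d / 2).
    exact: nbhs_right_lt.
  move=> [y t] [/= hy ht] z rz yz.
  have fy : cabs (f x - f y) < e / 2.
    by apply: hd => j; rewrite (lt_trans (hy j))// ltr_pdivrMr// ltr_pMr// ltr1n.
  have fz : cabs (f x - f z) < e / 2.
    apply: hd => j; have := hy j; have := yz j.
    have := cabs_triangle (x 0 j) (y 0 j) (z 0 j).
    have : d = d / 2 + d / 2 by rewrite -splitr.
    lra.
  have := cabs_triangle (f y) (f x) (f z); rewrite (cabs_sub (f y) (f x)); lra.
move=> d /= d0 hd; exists (d / 2); first by rewrite divr_gt0.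
move=> y z ry; apply: (hd (d / 2)) => //; rewrite ?divr_gt0//=.
by rewrite sub0r normrN gtr0_norm ?divr_gt0// ltr_pdivrMr// ltr_pMr// ltr1n.
Qed.

Lemma bounded_cpolydisc :
  exists2 M : R, 0 <= M & forall z, cpolydisc r z -> cabs (f z) <= M.
Proof.
pose P (M : R) (y : Cn) := cabs (f y) <= M.
have := (compact_near_coveringP _).1 (@compact_cpolydisc r) R (+oo%R) P _.
case.
  move=> x rx; have [d d0 hd] := continuous_cabs rx ltr01.
  exists ([set y : Cn | forall j, cabs (x 0 j - y 0 j) < d],
          [set t : R | cabs (f x) + 1 <= t]).
    split; first by apply/nbhs_cabs; exists d.
    exact: (nbhs_pinfty_ge (num_real _)).
  move=> [y t] [/= hy ht]; apply: le_trans ht; have := hd _ hy.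
  have := cabs_triangle (f y) (f x) 0; rewrite !subr0 (cabs_sub (f y) (f x)); lra.
move=> M [_ hM]; exists (`|M| + 1); first by rewrite addr_ge0.
by move=> z rz; apply: hM => //; rewrite ltr_pwDr// ler_norm.
Qed.

End continuous_on_cpolydisc.

Lemma holomorphic_continuous (f : Cn -> C^o) (r : R) : holomorphic f -> r < 1 ->
  forall z, cpolydisc r z -> {for z, continuous f}.
Proof.
by move=> hf r1 z rz; apply: differentiable_continuous; apply: hf; exact: cpolydisc_polydisc rz.
Qed.

End holomorphy.

(** * Uniform approximation by polynomials on smaller polydiscs *)

Section polynomial_approximation.
Context {R : realType} {n : nat}.
Local Notation C := R[i].
Local Notation Cn := ('rV[C]_n : normedModType C).

Definition polyfun (g : Cn -> C) :=
  exists p : mpoly.mpoly n C, forall z, g z = mpoly.meval (fun j => z 0 j) p.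

Lemma polyfun_cst c : polyfun (fun=> c).
Proof. by exists (mpoly.mpolyC n c) => z; rewrite mpoly.mevalC. Qed.

Lemma polyfun_coord j : polyfun (fun z => z 0 j).
Proof. by exists (mpoly.mpolyX C (mpoly.mnm1 j)) => z; rewrite mpoly.mevalXU. Qed.

Lemma polyfunD g h : polyfun g -> polyfun h -> polyfun (fun z => g z + h z).
Proof. by move=> [p gp] [q hq]; exists (p + q) => z; rewrite mpoly.mevalD gp hq. Qed.

Lemma polyfunM g h : polyfun g -> polyfun h -> polyfun (fun z => g z * h z).
Proof. by move=> [p gp] [q hq]; exists (p * q) => z; rewrite mpoly.mevalM gp hq. Qed.

Lemma polyfun_sum N (g : 'I_N -> Cn -> C) : (forall i, polyfun (g i)) ->
  polyfun (fun z => \sum_i g i z).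
Proof.
move=> pg; have [p hp] := choice pg; exists (\sum_i p i) => z.
by rewrite raddf_sum; apply: eq_bigr => i _; exact: hp.
Qed.

Lemma polyfunX g k : polyfun g -> polyfun (fun z => g z ^+ k).
Proof.
move=> pg; elim: k => [|k IH].
  by under eq_fun do rewrite expr0; exact: polyfun_cst.
by under eq_fun do rewrite exprS; exact: polyfunM.
Qed.

(* The last variable is replaced by its values at roots of unity by
   interpolation, uniformly in the others. *)
Lemma polynomial_approx_vars m (f : Cn -> C^o) : holomorphic f ->
  (forall z z' : Cn, polydisc z -> polydisc z' ->
     (forall j : 'I_n, (j < m)%N -> z 0 j = z' 0 j) -> f z = f z') ->
  forall r e : R, 0 <= r < 1 -> 0 < e ->
  exists2 p : Cn -> C, polyfun p & forall z, cpolydisc r z -> cabs (f z - p z) <= e.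
Proof.
elim: m f => [|m IH] f hf fm r e /andP[r0 r1] e0.
  exists (fun=> f 0); first exact: polyfun_cst.
  move=> z rz; rewrite (fm z 0) ?subrr ?Normc.normc0 ?ltW//.
    exact: cpolydisc_polydisc rz.
  by apply/polydiscE => j; rewrite mxE Normc.normc0.
have [nm|mn] := leqP n m.
  apply: IH => //; last by rewrite r0.
  by move=> z z' Dz Dz' zz'; apply: fm => // j _; apply: zz'; exact: leq_trans (ltn_ord j) nm.
pose jm := Ordinal mn; pose d : Cn := delta_mx 0 jm.
pose upd (z : Cn) (t : C) : Cn := z + (t - z 0 jm) *: d.
have updE z t j : upd z t 0 j = if j == jm then t else z 0 j.
  rewrite /upd /d !mxE eqxx/=; have [->|_] := eqVneq j jm.
    by rewrite mulr1 subrKC.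
  by rewrite mulr0 addr0.
pose r' := (r + 1) / 2; have [rr' r'1] : r < r' /\ r' < 1 by rewrite /r'; split; lra.
have r'0 : 0 < r' := le_lt_trans r0 rr'.
have cf := holomorphic_continuous hf r'1.
have [M M0 fM] := bounded_cpolydisc cf.
have e20 : 0 < e / 2 by rewrite divr_gt0.
have [eta eta0] := interp_approx r0 rr' M0 e20.
have [d1 d10 fu] := uniformly_continuous_cpolydisc cf eta0.
move=> /(_ _ d10)[N [w [N0 hw hint]]].
have upd_r z t : cpolydisc r z -> disc r' t -> cpolydisc r' (upd z t).
  move=> rz rt j; rewrite updE; case: eqP => // _.
  by rewrite (le_trans (rz j))// ltW.
pose x j := real_complex R r' * w ^+ j.
have [_ _ w1] := hw.
have xr j : cabs (x j) = r'.
  by rewrite /x Normc.normcM cabsX w1 expr1n mulr1 cabs_real gtr0_norm.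
have dx j : disc r' (x j) by rewrite /disc xr.
have updD z t : polydisc z -> disc r' t -> polydisc (upd z t).
  move=> /polydiscE Dz rt; apply/polydiscE => j; rewrite updE; case: eqP => // _.
  exact: le_lt_trans rt r'1.
have hfx (i : 'I_N) : holomorphic (fun z => f (upd z (x i))).
  move=> z Dz; have du : differentiable (fun z : Cn => upd z (x i)) z.
    apply: differentiableD; first exact: ex_diff.
    apply: (@differentiableZl _ _ _ (fun z : Cn => x i - z 0 jm : C^o) d).
    apply: differentiableB; first exact: differentiable_cst.
    exact: differentiable_coord.
  apply: (@differentiable_comp _ _ _ _ (fun z : Cn => upd z (x i)) f z du).
  by apply: hf; exact: updD.
(* In the interpolation formula the value at a node is multiplied by a geometric sum of modulus at
   most [N], and [N%:R^-1] cancels the number of nodes: the errors add up to [e / 2]. *)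
have e'0 : 0 < e / (2 * N%:R) by rewrite divr_gt0// mulr_gt0// ltr0n.
have /choice[p hp] (i : 'I_N) : exists p : Cn -> C, polyfun p /\
    forall z, cpolydisc r z -> cabs (f (upd z (x i)) - p z) <= e / (2 * N%:R).
  have [|||p pp hp] := IH _ (hfx i) _ r (e / (2 * N%:R)) => //; last by exists p.
    move=> z z' Dz Dz' zz'; apply: fm; [exact: updD|exact: updD|].
    move=> j; rewrite !updE; case: eqP => // /eqP jjm; rewrite ltnS leq_eqVlt.
    by move=> /orP[/eqP jm'|/zz'//]; case/eqP: jjm; exact: val_inj.
  by rewrite r0.
pose q (z : Cn) := N%:R^-1 * \sum_(i < N) p i z * \sum_(k < N) (z 0 jm * (x i)^-1) ^+ k.
exists q.
  apply: polyfunM; first exact: polyfun_cst.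
  apply: polyfun_sum => i; apply: polyfunM; first exact: (hp i).1.
  apply: polyfun_sum => k; apply: polyfunX; apply: polyfunM; last exact: polyfun_cst.
  exact: polyfun_coord.
move=> z rz; have zjr : disc r (z 0 jm) by exact: rz.
pose phi t := f (upd z t).
have phiE : phi = fun t => f ((z - z 0 jm *: d) + t *: d).
  by apply/funext => t; rewrite /phi /upd scalerBl addrCA addrC -addrA.
have phiz : phi (z 0 jm) = f z by rewrite /phi /upd subrr scale0r addr0.
have H : cabs (f z - interp N r' w phi (z 0 jm)) <= e / 2.
  rewrite cabs_sub -phiz; apply: hint => //.
  - move=> t rt; rewrite phiE; apply: holomorphic_slice => //.
    have <- : upd z t = (z - z 0 jm *: d) + t *: d.
      by rewrite /upd scalerBl addrCA addrC -addrA.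
    exact: (cpolydisc_polydisc r'1 (upd_r _ _ rz rt)).
  - by move=> t rt; apply: fM; exact: upd_r.
  - move=> s t rs rt st; apply: fu; [exact: upd_r|exact: upd_r|].
    by move=> j; rewrite !updE; case: eqP => // _; rewrite subrr Normc.normc0.
suff B : cabs (interp N r' w phi (z 0 jm) - q z) <= e / 2.
  by rewrite (le_trans (cabs_triangle _ (interp N r' w phi (z 0 jm)) _))// [leRHS]splitr lerD.
have NR : (0 : R) < N%:R by rewrite ltr0n.
rewrite /interp /q -mulrBr Normc.normcM Normc.normcV cabs_nat ler_pdivrMl//.
rewrite -sumrB (le_trans (ler_cabs_sum _ _ _))//.
apply: (@le_trans _ _ (\sum_(i < N) (e / 2))); last first.
  by rewrite sumr_const card_ord mulr_natl.
apply: ler_sum => i _; rewrite -mulrBl Normc.normcM -/(x i).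
have s1 : cabs (\sum_(k < N) (z 0 jm / x i) ^+ k) <= N%:R.
  rewrite (le_trans (ler_cabs_sum _ _ _))//.
  rewrite -[leRHS]mulr1 mulr_natl -[in leRHS](card_ord N) -sumr_const ler_sum// => k _.
  rewrite cabsX exprn_ile1 ?cabs_ge0// Normc.normcM Normc.normcV xr.
  by rewrite ler_pdivrMr// mul1r (le_trans zjr)// ltW.
have := (hp i).2 _ rz => h.
apply: (le_trans (ler_pM (cabs_ge0 _) (cabs_ge0 _) h s1)).
by rewrite invfM mulrA divfK// gt_eqF.
Qed.

Lemma polynomial_approx (f : Cn -> C^o) (r e : R) : holomorphic f ->
  r < 1 -> 0 < e ->
  exists2 p : Cn -> C, polyfun p & forall z, cpolydisc r z -> cabs (f z - p z) <= e.
Proof.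
move=> hf r1 e0; have fn (z z' : Cn) : polydisc z -> polydisc z' ->
    (forall j : 'I_n, (j < n)%N -> z 0 j = z' 0 j) -> f z = f z'.
  by move=> _ _ zz'; congr f; apply/rowP => j; exact: zz'.
have r01 : 0 <= Num.max 0 r < 1 by rewrite le_max lexx gt_max ltr01.
have [p pp hp] := polynomial_approx_vars hf fn r01 e0.
exists p => // z rz; apply: hp; apply: cpolydiscS rz.
by rewrite le_max lexx orbT.
Qed.

(* Schwarz-type estimate, read off the interpolation formula. *)
Lemma interp_oscillation N (r M : R) w (phi : C -> C) a : 0 < r -> cabs a <= r / 4 ->
  (0 < N)%N -> root_of_unity N w -> (forall z, disc r z -> cabs (phi z) <= M) ->
  cabs (interp N r w phi a - interp N r w phi 0) <= M / 3.
Proof.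
move=> r0 ar; case: N => // N _ [_ _ w1] phiM.
have M0 : 0 <= M.
  by apply: le_trans (cabs_ge0 _) (phiM 0 _); rewrite /disc Normc.normc0 ltW.
have NR : (0 : R) < N.+1%:R by rewrite ltr0n.
rewrite /interp -mulrBr -sumrB Normc.normcM Normc.normcV cabs_nat ler_pdivrMl//.
rewrite (le_trans (ler_cabs_sum _ _ _))//.
apply: (@le_trans _ _ (\sum_(i < N.+1) (M / 3))); last first.
  by rewrite sumr_const card_ord mulr_natl.
apply: ler_sum => j _; set x := real_complex R r * w ^+ j.
have xr : cabs x = r by rewrite Normc.normcM cabsX w1 expr1n mulr1 cabs_real gtr0_norm.
rewrite -mulrBr Normc.normcM ler_pM ?cabs_ge0 ?phiM// ?/disc ?xr//.
rewrite !big_ord_recl/= !expr0 [X in _ - (_ + X)]big1 ?addr0; last first.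
  by move=> k _; rewrite /bump/= mul0r expr0n.
rewrite addrAC subrr add0r (le_trans (ler_cabs_sum _ _ _))//.
pose q := cabs (a / x); have q0 : 0 <= q := cabs_ge0 _.
have q4 : q <= 1 / 4.
  by rewrite /q Normc.normcM Normc.normcV xr ler_pdivrMr//; lra.
pose S := \sum_(i < N) q ^+ i.
have S43 : S <= 4 / 3.
  have : (q - 1) * S = q ^+ N - 1 by rewrite subrX1.
  have : 0 <= q ^+ N by rewrite exprn_ge0.
  nra.
have -> : \sum_(i < N) cabs ((a / x) ^+ bump 0 i) = q * S.
  by rewrite mulr_sumr; apply: eq_bigr => i _; rewrite cabsX /bump/= add1n exprS.
have S0 : 0 <= S by rewrite sumr_ge0// => i _; rewrite exprn_ge0.
nra.
Qed.

(** Three contributions of [M / 3]: the interpolation errors at [a] and at 0, and the oscillation of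
    the interpolating polynomial. With [M = 1] this keeps two nearby evaluations at distance at most
    1, short of the distance 2 that a separation by an L-projection would impose. *)
Lemma holomorphic_oscillation (f : Cn -> C^o) (r s M : R) (z v : Cn) a :
  holomorphic f -> 0 < r -> s < 1 -> 0 < M ->
  (forall y, polydisc y -> cabs (f y) <= M) ->
  (forall t, disc r t -> cpolydisc s (z + t *: v)) -> cabs a <= r / 8 ->
  cabs (f (z + a *: v) - f z) <= M.
Proof.
move=> hf r0 s1 M0 fM zv ar; pose phi t := f (z + t *: v).
have cf := holomorphic_continuous hf s1.
have M30 : 0 < M / 3 by rewrite divr_gt0.
have r20 : 0 <= r / 2 by rewrite divr_ge0// ltW.
have r2r : r / 2 < r by rewrite ltr_pdivrMr// ltr_pMr// ltr1n.
have [eta eta0] := interp_approx r20 r2r (ltW M0) M30.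
have [d d0 fu] := uniformly_continuous_cpolydisc cf eta0.
(* [V] converts distances of parameters into distances of coordinates; the floor 1 keeps it positive
   when [v = 0]. *)
pose V := \big[Num.max/1]_(j < n) cabs (v 0 j).
have V1 : 1 <= V by exact: bigmax_ge_id.
have V0 : 0 < V by exact: lt_le_trans V1.
have hV j : cabs (v 0 j) <= V by exact: le_bigmax_cond.
move=> /(_ (d / V)) [|N [w [N0 hw hint]]]; first by rewrite divr_gt0.
have phiM t : disc r t -> cabs (phi t) <= M.
  by move=> rt; apply: fM; exact: (cpolydisc_polydisc s1 (zv _ rt)).
have {}hint : forall t, disc (r / 2) t -> cabs (interp N r w phi t - phi t) <= M / 3.
  apply: hint => // [t rt|t u rt ru tu].
    by apply: holomorphic_slice => //; exact: (cpolydisc_polydisc s1 (zv _ rt)).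
  apply: fu; [exact: zv|exact: zv|] => j.
  rewrite !mxE opprD addrACA subrr add0r -mulrBl Normc.normcM.
  rewrite ltr_pdivlMr// in tu; apply: le_lt_trans tu.
  by rewrite ler_wpM2l ?cabs_ge0.
have := hint a; have := hint 0; rewrite /disc Normc.normc0 => /(_ r20) h0.
have h4 : cabs a <= r / 4 by lra.
have h2 : cabs a <= r / 2 by lra.
move=> /(_ h2) ha; have := interp_oscillation r0 h4 N0 hw phiM.
rewrite -/(phi a); have -> : f z = phi 0 by rewrite /phi scale0r addr0.
have := cabs_triangle (phi a) (interp N r w phi a) (phi 0).
have := cabs_triangle (interp N r w phi a) (interp N r w phi 0) (phi 0).
rewrite (cabs_sub (phi a) (interp N r w phi a)); lra.
Qed.

End polynomial_approximation.

(** * Integrals over the torus *)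

Section torus_integrals.
Context {R : realType}.
Local Notation C := R[i].

Lemma cis_2pi (k : int) : cis (k%:~R * (2 * pi)) = 1 :> C.
Proof.
have P (m : nat) : cis (m%:R * (2 * pi)) = 1 :> C.
  by rewrite -cisX [cis _](_ : _ = 1) ?expr1n// /cis mulr_natl cos2pi sin2pi.
case: k => m; first exact: P.
by rewrite -[LHS]mulr1 -(P m.+1) -cisD NegzE mulrNz mulNr addNr cis0.
Qed.

Lemma is_derive_affine (a b x : R) : is_derive x 1 (fun y : R => a + b * y) b.
Proof.
have := is_deriveD (is_derive_cst a x (1 : R)) (is_deriveZ b (is_derive_id x (1 : R))).
by rewrite add0r [_ *: _]mulr1.
Qed.

Lemma integral_cos_period (s : R) (k : int) : k != 0 ->
  (\int[lebesgue_measure]_(x in `[0%R, (2 * pi)%R]) (1 + cos (s + k%:~R * x))%:E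
   = (2 * pi : R)%:E)%E.
Proof.
move=> k0; have kR : k%:~R != 0 :> R by rewrite intr_eq0.
pose F (x : R) := x + k%:~R^-1 * sin (s + k%:~R * x).
have dF (x : R) : is_derive x 1 F (1 + cos (s + k%:~R * x)).
  have dl := is_derive_affine s k%:~R x.
  have ds := @is_derive1_comp _ (@sin R) (fun x : R => s + k%:~R * x) x _ _ (is_derive_sin _) dl.
  have -> : 1 + cos (s + k%:~R * x) = 1 + k%:~R^-1 *: (cos (s + k%:~R * x) * k%:~R).
    by rewrite [_ *: _]mulrCA mulVf// mulr1.
  exact: is_deriveD (is_derive_id x (1 : R)) (is_deriveZ k%:~R^-1 ds).
have cF x : {for x, continuous F}.
  by apply: differentiable_continuous; apply/derivable1_diffP; exact: ex_derive.
have FE : derive1 F = (fun x => 1 + cos (s + k%:~R * x)).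
  by apply/funext => x; rewrite derive1E; exact: derive_val.
have pi2 : (0 : R) < 2 * pi by rewrite mulr_gt0// pi_gt0.
rewrite (@continuous_FTC2 _ _ F)//.
- rewrite -EFinD /F mulr0 addr0 add0r.
  have -> : sin (s + k%:~R * (2 * pi)) = sin s.
    by rewrite -[LHS]/(complex.Im (cis _)) cisD cis_2pi mulr1.
  by rewrite addrK.
- apply: continuous_subspaceT => x; apply: differentiable_continuous.
  apply/derivable1_diffP; have dl := is_derive_affine s k%:~R x.
  have dc := @is_derive1_comp _ (@cos R) (fun x : R => s + k%:~R * x) x _ _ (is_derive_cos _) dl.
  exact: derivableD.
- split; first by move=> x _; exact: ex_derive.
    exact: cvg_at_right_filter (cF _).
  exact: cvg_at_left_filter (cF _).
- by move=> x _; rewrite FE.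
Qed.

Definition phase n (k : 'I_n -> int) (t : n.-tuple (measurableTypeR R)) : R :=
  \sum_j (k j)%:~R * tnth t j.

Lemma measurable_phase n (k : 'I_n -> int) : measurable_fun setT (phase k).
Proof.
apply: measurable_sum => j; apply: measurable_funM; first exact: measurable_cst.
exact: measurable_tnth.
Qed.

Lemma measurable_cos_phase n (s : R) (k : 'I_n -> int) :
  measurable_fun setT (fun t => cos (s + phase k t)).
Proof.
apply: measurableT_comp; first by apply: continuous_measurable_fun; exact: continuous_cos.
by apply: measurable_funD; [exact: measurable_cst|exact: measurable_phase].
Qed.

Lemma cosD1_ge0 (x : R) : 0 <= 1 + cos x.
Proof. by have := cos_geN1 x; lra. Qed.

Lemma torus_measureS n (f : n.+1.-tuple (measurableTypeR R) -> \bar R) :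
  measurable_fun setT f -> (forall t, 0 <= f t)%E ->
  (\int[torus_measure R n.+1]_t f t =
   \int[uniform_prob (@two_pi_gt0 R)]_x \int[torus_measure R n]_t f [tuple of x :: t])%E.
Proof.
move=> mf f0; rewrite /torus_measure -/torus_measure.
rewrite ge0_integral_distribution// fubini_tonelli1//.
  exact: measurableT_comp.
by move=> x; exact: f0.
Qed.

Lemma phase_cons n (k : 'I_n.+1 -> int) (x : R) (t : n.-tuple R) :
  phase k [tuple of x :: t] =
  (k ord0)%:~R * x + phase (fun j => k (lift ord0 j)) t.
Proof.
rewrite /phase big_ord_recl; congr (_ * _ + _).
by apply: eq_bigr => j _; rewrite tnthS.
Qed.

(* The function [1 + cos] is integrated instead of [cos] to stay within the
   theory of integrals of nonnegative functions. *)
Lemma integral_cos_phase n (s : R) (k : 'I_n -> int) (j : 'I_n) : k j != 0 ->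
  (\int[torus_measure R n]_t (1 + cos (s + phase k t))%:E = 1)%E.
Proof.
elim: n s k j => [|n IH] s k j kj; first by case: j kj.
rewrite torus_measureS; last 2 first.
- apply/measurable_EFinP/measurable_funD; first exact: measurable_cst.
  exact: measurable_cos_phase.
- by move=> t; rewrite lee_fin cosD1_ge0.
under eq_integral do under eq_integral do rewrite phase_cons addrA.
(* If a later coordinate has a nonzero frequency, the inner integral is already 1, the first angle
   being absorbed into the shift. Otherwise only the first angle occurs, and its integral runs over
   whole periods. *)
have [[i ki]|k0] := pselect (exists i, k (lift ord0 i) != 0).
  under eq_integral do rewrite (IH _ _ i ki).
  by rewrite integral_cst// mul1e; exact: probability_setT.
have {}k0 i : k (lift ord0 i) = 0.
  by apply/eqP; apply: contra_notT k0 => ?; exists i.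
have p0 t : phase (fun i => k (lift ord0 i)) t = 0.
  by rewrite /phase big1// => i _; rewrite k0 mul0r.
have kj0 : k ord0 != 0.
  by case: (unliftP ord0 j) kj => [i ->|->//]; rewrite k0 eqxx.
under eq_integral do under eq_integral do rewrite p0 addr0.
under eq_integral.
  move=> x _; rewrite integral_cst//.
  rewrite [X in (_ * X)%E](_ : _ = 1%E) ?mule1; last exact: probability_setT.
  over.
rewrite integral_uniform; last 2 first.
- apply/measurable_EFinP/measurable_funD; first exact: measurable_cst.
  apply: measurableT_comp; first by apply: continuous_measurable_fun; exact: continuous_cos.
  apply: measurable_funD; first exact: measurable_cst.
  by apply: measurable_funM; [exact: measurable_cst|exact: measurable_id].
- by move=> t; rewrite lee_fin cosD1_ge0.
rewrite integral_cos_period// -EFinM subr0 mulVf// gt_eqF//.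
by rewrite mulr_gt0// pi_gt0.
Qed.

End torus_integrals.

(** * Parseval's identity for trigonometric polynomials *)

Section parseval.
Context {R : realType} {n : nat}.
Local Notation C := R[i].
Local Notation Cn := ('rV[C]_n : normedModType C).
Local Notation mu := (torus_measure R n).
Implicit Types (m : mpoly.multinom n) (t : n.-tuple (measurableTypeR R)).

Definition mphase m t := phase (fun j => (m j)%:Z) t.

Definition trig_poly (s : seq (mpoly.multinom n)) (a : mpoly.multinom n -> C) t : C :=
  \sum_(m <- s) a m * cis (mphase m t).

Definition cross (a : mpoly.multinom n -> C) m m' : C := a m * conjc (a m').

(** A bound for the modulus of [cross_term], added to make integrands nonnegative and cancelled
    after integration. *)
Definition cross_mass a m m' : R :=
  `|complex.Re (cross a m m')| + `|complex.Im (cross a m m')|.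

Definition cross_term a m m' t : R :=
  complex.Re (cross a m m' * cis (mphase m t - mphase m' t)).

Lemma conjc_cis (x : R) : conjc (cis x : C) = cis (- x).
Proof. by rewrite /cis cosN sinN. Qed.

Lemma sqr_cabs (z : C) : cabs z ^+ 2 = complex.Re (z * conjc z).
Proof.
case: z => a b /=; rewrite sqr_sqrtr ?addr_ge0 ?sqr_ge0//.
by rewrite mulrN opprK !expr2.
Qed.

Lemma Re_sum (I : Type) (r : seq I) (F : I -> C) :
  complex.Re (\sum_(i <- r) F i) = \sum_(i <- r) complex.Re (F i).
Proof. by rewrite (big_morph _ (@ReD R) (erefl : complex.Re (0 : C) = 0)). Qed.

Lemma sqr_cabs_trig_poly s a t : cabs (trig_poly s a t) ^+ 2 =
  \sum_(m <- s) \sum_(m' <- s) cross_term a m m' t.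
Proof.
rewrite sqr_cabs /trig_poly rmorph_sum mulr_suml Re_sum; apply: eq_bigr => m _.
rewrite mulr_sumr Re_sum; apply: eq_bigr => m' _; congr complex.Re.
transitivity (a m * cis (mphase m t) * (conjc (a m') * cis (- mphase m' t))).
  by rewrite -conjc_cis -rmorphM.
by rewrite cisD /cross; ring.
Qed.

(** A shift of the phase by [pi] absorbs a negative sign of the coefficient. *)
Definition sgn_shift (x : R) : R := if 0 <= x then 0 else pi.

Lemma sgn_shiftE (x y : R) : x * cos y = `|x| * cos (sgn_shift x + y).
Proof.
rewrite /sgn_shift; have [x0|x0] := ger0P x; first by rewrite add0r.
by rewrite (addrC pi y) cosDpi mulrNN.
Qed.

Lemma phaseB m m' t :
  mphase m t - mphase m' t = phase (fun j => (m j)%:Z - (m' j)%:Z) t.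
Proof.
by rewrite /mphase /phase -sumrB; apply: eq_bigr => j _; rewrite -mulrBl intrB.
Qed.

(** Minus the sine is the cosine shifted by [pi / 2]; with signs absorbed into shifts, only
    nonnegative multiples of functions [1 + cos] remain. *)
Lemma cross_termE a m m' t : cross_term a m m' t + cross_mass a m m' =
  let k j := (m j)%:Z - (m' j)%:Z in let b := cross a m m' in
  `|complex.Re b| * (1 + cos (sgn_shift (complex.Re b) + phase k t)) +
  `|complex.Im b| * (1 + cos (sgn_shift (complex.Im b) + pi / 2 + phase k t)).
Proof.
rewrite /cross_term /cross_mass phaseB; lazy zeta.
set k := (fun j => _); set b := cross a m m'.
have -> : complex.Re (b * cis (phase k t)) =
    complex.Re b * cos (phase k t) - complex.Im b * sin (phase k t) by case: b.
rewrite (sgn_shiftE (complex.Re b)) -[- (_ * _)]mulrN -cosDpihalf.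
rewrite (addrC (phase k t) (pi / 2)) (sgn_shiftE (complex.Im b))
  (addrA (sgn_shift (complex.Im b))).
ring.
Qed.

Lemma integral_torus_cst (x : \bar R) : (\int[mu]_t x = x)%E.
Proof.
rewrite integral_cst// -[RHS]mule1; congr (_ * _)%E; exact: probability_setT.
Qed.

Lemma measurable_cross_term a m m' :
  measurable_fun setT (fun t => cross_term a m m' t + cross_mass a m m').
Proof.
under eq_fun do rewrite cross_termE/=.
by apply: measurable_funD; apply: measurable_funM; try exact: measurable_cst;
   apply: measurable_funD; try exact: measurable_cst; exact: measurable_cos_phase.
Qed.

Lemma cross_term_ge0 a m m' t : 0 <= cross_term a m m' t + cross_mass a m m'.
Proof. by rewrite cross_termE/= addr_ge0// mulr_ge0// cosD1_ge0. Qed.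

Lemma integral_cross_term a m m' :
  (\int[mu]_t (cross_term a m m' t + cross_mass a m m')%:E =
   ((if m == m' then cabs (a m) ^+ 2 else 0) + cross_mass a m m')%:E)%E.
Proof.
case: eqVneq => [->|mm'].
  rewrite /cross_term; under eq_integral.
    move=> t _; rewrite subrr cis0 mulr1 -sqr_cabs; over.
  by rewrite integral_torus_cst.
have [j kj] : exists j, (m j)%:Z - (m' j)%:Z != 0.
  apply/existsP; rewrite -negb_forall; apply: contra mm' => /forallP h.
  by apply/eqP/mpoly.mnmP => j; have := h j; rewrite subr_eq0 => /eqP[].
under eq_integral do rewrite cross_termE/= EFinD !EFinM.
have mc u : measurable_fun setT
    (fun t => (1 + cos (u + phase (fun j => (m j)%:Z - (m' j)%:Z) t))%:E).
  apply/measurable_EFinP/measurable_funD; first exact: measurable_cst.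
  exact: measurable_cos_phase.
have c0 u t : (0 <= (1 + cos (u + phase (fun j => (m j)%:Z - (m' j)%:Z) t))%:E)%E.
  by rewrite lee_fin cosD1_ge0.
rewrite ge0_integralD//; [|exact: measurable_funeM..].
rewrite !ge0_integralZl_EFin// !(@integral_cos_phase _ _ _ _ j)//.
by rewrite !mule1 add0r.
Qed.

Lemma measurable_trig_poly s a :
  measurable_fun setT (fun t => cabs (trig_poly s a t) ^+ 2).
Proof.
under eq_fun do rewrite sqr_cabs_trig_poly.
apply: measurable_sum => m; apply: measurable_sum => m'.
have -> : cross_term a m m' =
    (fun t => (cross_term a m m' t + cross_mass a m m') - cross_mass a m m').
  by apply/funext => t; rewrite addrK.
by apply: measurable_funB; [exact: measurable_cross_term|exact: measurable_cst].
Qed.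

(** The finite constant [S], the total of the masses, is added on both sides, so that the double sum
    is integrated term by term as a sum of nonnegative functions. *)
Lemma parseval s a : uniq s ->
  (\int[mu]_t (cabs (trig_poly s a t) ^+ 2)%:E = (\sum_(m <- s) cabs (a m) ^+ 2)%:E)%E.
Proof.
move=> us; pose S := \sum_(m <- s) \sum_(m' <- s) cross_mass a m m'.
have S0 : 0 <= S.
  by rewrite !sumr_ge0// => m _; rewrite sumr_ge0// => m' _; rewrite addr_ge0.
suff : (\int[mu]_t (cabs (trig_poly s a t) ^+ 2)%:E + S%:E =
    (\sum_(m <- s) cabs (a m) ^+ 2 + S)%:E)%E.
  set x := (\int[mu]_t _)%E; case: x => // r.
  by rewrite -EFinD => -[/addIr->].
transitivity (\int[mu]_t ((cabs (trig_poly s a t) ^+ 2)%:E + S%:E))%E.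
  rewrite ge0_integralD//.
  - by rewrite integral_torus_cst.
  - by move=> t _; rewrite lee_fin exprn_ge0 ?cabs_ge0.
  - by apply/measurable_EFinP; exact: measurable_trig_poly.
transitivity (\int[mu]_t \sum_(m <- s) \sum_(m' <- s)
    (cross_term a m m' t + cross_mass a m m')%:E)%E.
  apply: eq_integral => t _; rewrite -EFinD sqr_cabs_trig_poly /S -big_split/= -sumEFin.
  by apply: eq_bigr => m _; rewrite -big_split/= -sumEFin.
have mct m m' : measurable_fun setT (fun t => (cross_term a m m' t + cross_mass a m m')%:E).
  by apply/measurable_EFinP; exact: measurable_cross_term.
have ct0 m m' t : (0 <= (cross_term a m m' t + cross_mass a m m')%:E)%E.
  by rewrite lee_fin cross_term_ge0.
rewrite ge0_integral_sum//; last 2 first.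
- by move=> m; exact: emeasurable_sum.
- by move=> m t _; rewrite sume_ge0.
rewrite /S -big_split/= -sumEFin big_seq [RHS]big_seq; apply: eq_bigr => m ms.
rewrite ge0_integral_sum// (eq_bigr _ (fun m' _ => integral_cross_term a m m')).
rewrite sumEFin big_split/=; congr ((_ + _)%:E).
rewrite (bigD1_seq m)//= eqxx big1_seq ?addr0// => m' /andP[m'm _].
by rewrite eq_sym (negbTE m'm).
Qed.

End parseval.

(** * Quadratic means over tori *)

Section torus_means.
Context {R : realType} {n : nat}.
Local Notation C := R[i].
Local Notation Cn := ('rV[C]_n : normedModType C).
Local Notation mu := (torus_measure R n).
Local Notation tuple_n := (n.-tuple (measurableTypeR R)).
Implicit Types (m : mpoly.multinom n) (t : tuple_n) (f g G : Cn -> C^o).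

Lemma torus_pointE (r : R) t j :
  torus_point r t 0 j = real_complex R r * cis (tnth t j).
Proof. by rewrite mxE /cis; simpc. Qed.

Lemma torus_point_cpolydisc (r : R) t : 0 <= r -> cpolydisc r (torus_point r t).
Proof.
by move=> r0 j; rewrite torus_pointE Normc.normcM cabs_cis mulr1 cabs_real ger0_norm.
Qed.

Definition monomial m (z : Cn) : C := \prod_j z 0 j ^+ m j.

Definition deg m : nat := (\sum_j m j)%N.

Lemma monomial_torus_point m (r : R) t :
  monomial m (torus_point r t) = real_complex R (r ^+ deg m) * cis (mphase m t).
Proof.
rewrite /monomial /deg /mphase /phase rmorphXn/=.
transitivity (\prod_j (real_complex R r ^+ m j * cis ((m j)%:R * tnth t j))).
  by apply: eq_bigr => j _; rewrite torus_pointE exprMn cisX.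
rewrite big_split/= expr_sum; congr (_ * _).
by rewrite (big_morph _ (@cisD R) (@cis0 R)); apply: eq_bigr => j _.
Qed.

(** The exponent 0 must be listed, if need be with coefficient 0, so that a constant can be
    subtracted without changing the list. *)
Definition poly_rep g s (c : mpoly.multinom n -> C) :=
  [/\ uniq s, mpoly.mnm0 \in s & forall z, g z = \sum_(m <- s) c m * monomial m z].

Lemma polyfun_rep g : polyfun g -> exists s c, poly_rep g s c.
Proof.
move=> [p gp]; pose c m := mpoly.mcoeff m p.
have E z : g z = \sum_(m <- mpoly.msupp p) c m * monomial m z.
  by rewrite gp mpoly.mevalE.
have us := mpoly.msupp_uniq p.
have [s0|s0] := boolP (mpoly.mnm0 \in mpoly.msupp p).
  by exists (mpoly.msupp p), c.
exists (mpoly.mnm0 :: mpoly.msupp p), c; split; rewrite ?mem_head//= ?s0//.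
by move=> z; rewrite big_cons {1}/c mpoly.memN_msupp_eq0// mul0r add0r.
Qed.

Definition tmean (r : R) (g : Cn -> C) : \bar R :=
  (\int[mu]_t (cabs (g (torus_point r t)) ^+ 2)%:E)%E.

(** By [tmeanE], [fine] loses nothing for holomorphic functions and radii below 1. *)
Definition rmean (r : R) (g : Cn -> C) : R := fine (tmean r g).

Lemma poly_rep_torus g s c (r : R) t : poly_rep g s c ->
  g (torus_point r t) = trig_poly s (fun m => c m * real_complex R (r ^+ deg m)) t.
Proof.
by move=> [_ _ ->]; apply: eq_bigr => m _; rewrite monomial_torus_point mulrA.
Qed.

Lemma tmean_poly g s c (r : R) : poly_rep g s c ->
  tmean r g = (\sum_(m <- s) cabs (c m) ^+ 2 * (r ^+ deg m) ^+ 2)%:E.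
Proof.
move=> gE; rewrite /tmean; under eq_integral do rewrite (poly_rep_torus _ _ gE).
rewrite parseval; last by case: gE.
congr EFin; apply: eq_bigr => m _.
by rewrite Normc.normcM cabs_real exprMn real_normK ?num_real.
Qed.

Lemma rmean_poly g s c (r : R) : poly_rep g s c ->
  rmean r g = \sum_(m <- s) cabs (c m) ^+ 2 * (r ^+ deg m) ^+ 2.
Proof. by move=> gE; rewrite /rmean (tmean_poly _ gE). Qed.

Lemma holomorphic_sum (I : Type) (s : seq I) (F : I -> Cn -> C^o) :
  (forall i, holomorphic (F i)) -> holomorphic (fun z => \sum_(i <- s) F i z).
Proof.
move=> hF z Dz; elim: s => [|i s IH].
  by under eq_fun do rewrite big_nil; exact: differentiable_cst.
under eq_fun do rewrite big_cons.
by apply: differentiableD => //; exact: hF.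
Qed.

Lemma holomorphic_prod (I : Type) (s : seq I) (F : I -> Cn -> C^o) :
  (forall i, holomorphic (F i)) -> holomorphic (fun z => \prod_(i <- s) F i z).
Proof.
move=> hF z Dz; elim: s => [|i s IH].
  by under eq_fun do rewrite big_nil; exact: differentiable_cst.
under eq_fun do rewrite big_cons.
by apply: differentiableM => //; exact: hF.
Qed.

Lemma holomorphicM f g : holomorphic f -> holomorphic g ->
  holomorphic (fun z => f z * g z).
Proof. by move=> hf hg z Dz; apply: differentiableM; [exact: hf|exact: hg]. Qed.

Lemma holomorphicB f g : holomorphic f -> holomorphic g ->
  holomorphic (fun z => f z - g z).
Proof. by move=> hf hg z Dz; apply: differentiableB; [exact: hf|exact: hg]. Qed.

Lemma holomorphic_cst (c : C) : holomorphic (fun _ : Cn => c : C^o).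
Proof. by move=> z _; exact: differentiable_cst. Qed.

Lemma holomorphic_polyfun g : polyfun g -> holomorphic g.
Proof.
move=> /polyfun_rep[s [c [_ _ gE]]]; rewrite (funext gE).
apply: holomorphic_sum => m; apply: holomorphicM; first exact: holomorphic_cst.
apply: holomorphic_prod => j.
have -> : (fun z : Cn => z 0 j ^+ m j : C^o) = (fun z : Cn => \prod_(i < m j) z 0 j).
  by apply/funext => z; rewrite prodr_const card_ord.
by apply: holomorphic_prod => _ z _; exact: differentiable_coord.
Qed.

(** On the torus the function is a pointwise limit of polynomials, whose squared moduli are finite
    sums of cosines. *)
Lemma measurable_torus G (r : R) : holomorphic G -> 0 <= r -> r < 1 ->
  measurable_fun [set: tuple_n] (fun t => cabs (G (torus_point r t)) ^+ 2).
Proof.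
move=> hG r0 r1.
have /choice[p hp] (k : nat) : exists p : Cn -> C, polyfun p /\
    forall z, cpolydisc r z -> cabs (G z - p z) <= k.+1%:R^-1.
  have [|p pp pG] := @polynomial_approx _ _ G r k.+1%:R^-1 hG r1; first by rewrite invr_gt0.
  by exists p.
apply: (@measurable_fun_cvg _ _ _ _ (fun k t => cabs (p k (torus_point r t)) ^+ 2)).
  move=> k; have [s [c pE]] := polyfun_rep (hp k).1.
  under eq_fun do rewrite (poly_rep_torus _ _ pE).
  exact: measurable_trig_poly.
move=> t _; have tr := torus_point_cpolydisc t r0.
suff h : (fun k => cabs (p k (torus_point r t))) @ \oo --> cabs (G (torus_point r t)).
  exact: (cvgM h h).
apply: (@squeeze_cvgr _ _ _ _ (fun k => cabs (G (torus_point r t)) - k.+1%:R^-1)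
                              (fun k => cabs (G (torus_point r t)) + k.+1%:R^-1)).
- near=> k; rewrite /=; have := (hp k).2 _ tr; set x := G _; set y := p k _ => xy.
  have := cabs_triangle x y 0; have := cabs_triangle y x 0.
  rewrite !subr0 (cabs_sub y x) => h1 h2; apply/andP; split.
    by rewrite lerBlDr (le_trans h2)// addrC lerD2l.
  by rewrite (le_trans h1)// addrC lerD2l.
- rewrite -[X in _ --> X]subr0; apply: cvgB; first exact: cvg_cst.
  exact: cvg_harmonic.
- rewrite -[X in _ --> X]addr0; apply: cvgD; first exact: cvg_cst.
  exact: cvg_harmonic.
Unshelve. all: by end_near.
Qed.

Lemma tmeanE G (r : R) : holomorphic G -> 0 <= r -> r < 1 ->
  tmean r G = (rmean r G)%:E.
Proof.
move=> hG r0 r1; have cf := holomorphic_continuous hG r1.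
have [M M0 GM] := bounded_cpolydisc cf.
rewrite /rmean fineK// ge0_fin_numE; last first.
  by apply: integral_ge0 => t _; rewrite lee_fin exprn_ge0 ?cabs_ge0.
apply: (@le_lt_trans _ _ (\int[mu]_t (M ^+ 2)%:E)%E); last first.
  by rewrite integral_torus_cst ltry.
apply: ge0_le_integral => //.
- by move=> t _; rewrite lee_fin exprn_ge0 ?cabs_ge0.
- by apply/measurable_EFinP; exact: measurable_torus.
- move=> t _; rewrite lee_fin lerXn2r ?nnegrE ?cabs_ge0//.
  exact/GM/torus_point_cpolydisc.
Qed.

(** The one comparison principle for means; two functions and a constant suffice for every later
    estimate, with coefficient 0 where a slot is not wanted. *)
Lemma rmean_le (r a b c : R) G A B : holomorphic G -> holomorphic A ->
  holomorphic B -> 0 <= r -> r < 1 -> 0 <= a -> 0 <= b -> 0 <= c ->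
  (forall z, cpolydisc r z ->
     cabs (G z) ^+ 2 <= a * cabs (A z) ^+ 2 + b * cabs (B z) ^+ 2 + c) ->
  rmean r G <= a * rmean r A + b * rmean r B + c.
Proof.
move=> hG hA hB r0 r1 a0 b0 c0 h.
rewrite -lee_fin !EFinD !EFinM -!tmeanE//.
have mA := measurable_torus hA r0 r1; have mB := measurable_torus hB r0 r1.
have cA F t : (0 <= (cabs (F (torus_point r t) : C) ^+ 2)%:E)%E.
  by rewrite lee_fin exprn_ge0 ?cabs_ge0.
apply: (@le_trans _ _ (\int[mu]_t (a%:E * (cabs (A (torus_point r t)) ^+ 2)%:E +
   b%:E * (cabs (B (torus_point r t)) ^+ 2)%:E + c%:E))%E).
  apply: ge0_le_integral => //.
  - by apply/measurable_EFinP; exact: measurable_torus.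
  - apply: emeasurable_funD; last exact: measurable_cst.
    by apply: emeasurable_funD; apply: measurable_funeM; apply/measurable_EFinP.
  - by move=> t _; rewrite -!EFinM -!EFinD lee_fin; exact/h/torus_point_cpolydisc.
rewrite ge0_integralD//; [|by move=> t _; rewrite adde_ge0// mule_ge0|
  by apply: emeasurable_funD; apply: measurable_funeM; apply/measurable_EFinP].
rewrite integral_torus_cst leeD2r// ge0_integralD//;
  [|by move=> t _; rewrite mule_ge0|by apply: measurable_funeM; apply/measurable_EFinP
   |by move=> t _; rewrite mule_ge0|by apply: measurable_funeM; apply/measurable_EFinP].
by rewrite !ge0_integralZl_EFin//; apply/measurable_EFinP.
Qed.

End torus_means.

(** * Density of the polynomials in the Hardy space *)

Section density.
Context {R : realType} {n : nat}.
Local Notation C := R[i].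
Local Notation Cn := ('rV[C]_n : normedModType C).
Implicit Types (m : mpoly.multinom n) (f g p G : Cn -> C^o).

Definition dilation (r : R) g (z : Cn) : C := g (real_complex R r *: z).

Lemma monomial_dilation m (r : R) (z : Cn) :
  monomial m (real_complex R r *: z) = real_complex R (r ^+ deg m) * monomial m z.
Proof.
rewrite /monomial /deg rmorphXn/= expr_sum -big_split/=.
by apply: eq_bigr => j _; rewrite mxE exprMn.
Qed.

(** Coefficientwise, with [x = r ^+ deg m] in the unit interval, this is
    [(1 - x) ^+ 2 + x ^+ 2 <= 1]. The effect of a dilation is thus controlled by the growth of the
    means between two radii. *)
Lemma rmean_dilation p (rho rho' rho0 r : R) : polyfun p ->
  0 <= r <= 1 -> 0 <= rho <= rho' -> 0 <= rho0 <= r * rho' ->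
  rmean rho (fun z => p z - dilation r p z) + rmean rho0 p <= rmean rho' p.
Proof.
move=> /polyfun_rep[s [c pE]] /andP[r0 r1] /andP[h0 hh'] /andP[h00 h0r].
have dE : poly_rep (fun z => p z - dilation r p z) s
    (fun m => c m * real_complex R (1 - r ^+ deg m)).
  have [us s0 pz] := pE; split=> // z; rewrite /dilation !pz -sumrB.
  by apply: eq_bigr => m _; rewrite monomial_dilation rmorphB rmorph1; ring.
rewrite (rmean_poly _ pE) (rmean_poly _ dE) (rmean_poly _ pE) -big_split/=.
apply: ler_sum => m _; rewrite Normc.normcM cabs_real exprMn real_normK ?num_real//.
rewrite -mulrA -mulrDr ler_wpM2l ?exprn_ge0 ?cabs_ge0//.
set x := r ^+ deg m; set A := rho ^+ deg m; set A' := rho' ^+ deg m.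
have x01 : 0 <= x <= 1 by rewrite /x exprn_ge0// exprn_ile1.
have A0 : 0 <= A by rewrite /A exprn_ge0.
have AA' : A <= A' by rewrite /A /A' lerXn2r// nnegrE// (le_trans h0).
have B0 : 0 <= rho0 ^+ deg m by rewrite exprn_ge0.
have BA : rho0 ^+ deg m <= x * A'.
  by rewrite -exprMn lerXn2r// nnegrE// (le_trans h00).
have A'0 : 0 <= A' := le_trans A0 AA'.
case/andP: x01 => x0 x1.
have hA : A ^+ 2 <= A' ^+ 2 by rewrite lerXn2r// nnegrE.
have hB : (rho0 ^+ deg m) ^+ 2 <= x ^+ 2 * A' ^+ 2.
  by rewrite -exprMn lerXn2r// nnegrE mulr_ge0.
apply: (@le_trans _ _ ((1 - x) ^+ 2 * A' ^+ 2 + x ^+ 2 * A' ^+ 2)).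
  by rewrite lerD// ler_wpM2l// sqr_ge0.
rewrite -mulrDl -[leRHS]mul1r ler_wpM2r ?sqr_ge0//; nra.
Qed.

(** Subtracting 1 changes only the constant coefficient, which is [p 0] and enters the mean with
    weight 1. *)
Lemma rmean_poly_sub1 p (r : R) : polyfun p ->
  rmean r (fun z => p z - 1) = rmean r p + 1 - 2 * complex.Re (p 0).
Proof.
move=> /polyfun_rep[s [c pE]]; have [us s0 pz] := pE.
pose m0 : mpoly.multinom n := mpoly.mnm0.
have mono0 (z : Cn) : monomial m0 z = 1.
  by rewrite /monomial big1// => j _; rewrite mpoly.mnm0E expr0.
have deg0 : deg m0 = 0%N by rewrite /deg big1// => j _; rewrite mpoly.mnm0E.
have mono00 m : m != m0 -> monomial m (0 : Cn) = 0.
  move=> mm0; have [j mj] : exists j, m j != 0%N.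
    apply/existsP; rewrite -negb_forall; apply: contra mm0 => /forallP h.
    by apply/eqP/mpoly.mnmP => j; rewrite mpoly.mnm0E; exact/eqP/h.
  by rewrite /monomial (bigD1 j)//= mxE expr0n (negbTE mj) mul0r.
have p0 : p 0 = c m0.
  rewrite pz (bigD1_seq m0)//= mono0 mulr1 big1_seq ?addr0// => m /andP[mm0 _].
  by rewrite mono00// mulr0.
have dE : poly_rep (fun z => p z - 1) s (fun m => c m - (m == m0)%:R).
  split=> // z; rewrite pz; under [RHS]eq_bigr do rewrite mulrBl.
  rewrite sumrB; congr (_ - _); rewrite (bigD1_seq m0)//= eqxx mul1r mono0.
  by rewrite big1_seq ?addr0// => m /andP[/negbTE -> _]; rewrite mul0r.
rewrite (rmean_poly _ pE) (rmean_poly _ dE) p0 !(bigD1_seq m0 _ us)//= eqxx deg0.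
rewrite !expr0 !expr1n !mulr1.
under eq_bigr => m /negbTE mm0 do rewrite mm0 subr0.
have -> : cabs (c m0 - 1) ^+ 2 = cabs (c m0) ^+ 2 + 1 - 2 * complex.Re (c m0).
  case: (c m0) => a b /=; rewrite !sqr_sqrtr ?addr_ge0 ?sqr_ge0//.
  by rewrite subr0; ring.
by ring.
Qed.

Lemma rmean_ge0 (r : R) g : 0 <= rmean r g.
Proof.
rewrite fine_ge0// integral_ge0// => t _.
by rewrite lee_fin exprn_ge0 ?cabs_ge0.
Qed.

Lemma holomorphic_dilation G (r : R) : 0 <= r -> r <= 1 -> holomorphic G ->
  holomorphic (dilation r G).
Proof.
move=> r0 r1 hG z Dz.
apply: (@differentiable_comp _ _ _ _ (fun z : Cn => real_complex R r *: z) G).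
  by apply: differentiableZ; exact: ex_diff.
apply: hG; apply/polydiscE => j; rewrite mxE Normc.normcM cabs_real ger0_norm//.
move/polydiscE: Dz => /(_ j); apply: le_lt_trans.
by rewrite ler_piMl// cabs_ge0.
Qed.

Lemma cpolydisc_dilation (r s : R) (z : Cn) : 0 <= r -> cpolydisc s z ->
  cpolydisc (r * s) (real_complex R r *: z).
Proof.
move=> r0 sz j; rewrite mxE Normc.normcM cabs_real ger0_norm//.
by rewrite ler_wpM2l//; exact: sz.
Qed.

Lemma polyfun_dilation p (r : R) : polyfun p -> polyfun (dilation r p).
Proof.
move=> /polyfun_rep[s [c [_ _ pE]]]; rewrite /dilation (funext pE).
elim: s {pE} => [|m s IH].
  by under eq_fun do rewrite big_nil; exact: polyfun_cst.
under eq_fun do rewrite big_cons.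
apply: polyfunD => //; apply: polyfunM; first exact: polyfun_cst.
rewrite /monomial; elim: (index_enum _) => [|j l IHl].
  by under eq_fun do rewrite big_nil; exact: polyfun_cst.
under eq_fun do rewrite big_cons mxE.
apply: polyfunM => //; apply: polyfunX; apply: polyfunM; first exact: polyfun_cst.
exact: polyfun_coord.
Qed.

Lemma sqr_ler_split (x y z w : R) : 0 <= x -> x <= y + z -> z ^+ 2 <= w ->
  x ^+ 2 <= 2 * y ^+ 2 + 2 * w.
Proof.
move=> x0 xyz zw; have : 0 <= (y - z) ^+ 2 by exact: sqr_ge0.
have : x ^+ 2 <= (y + z) ^+ 2 by rewrite lerXn2r// nnegrE// (le_trans x0).
rewrite !expr2; rewrite expr2 in zw; nra.
Qed.

Lemma sqr_cabs_perturb (x y : C) (M eta : R) : cabs x <= M -> cabs (x - y) <= eta ->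
  cabs y ^+ 2 <= cabs x ^+ 2 + eta * (2 * M + 3 * eta) /\
  cabs x ^+ 2 <= cabs y ^+ 2 + eta * (2 * M + 3 * eta).
Proof.
move=> xM xy; have := cabs_triangle y x 0; have := cabs_triangle x y 0.
rewrite !subr0 (cabs_sub y x); have := cabs_ge0 x; have := cabs_ge0 y.
have := cabs_ge0 (x - y); rewrite !expr2; move: xM xy.
set X := cabs x; set Y := cabs y; set D := cabs (x - y) => XM De D0 Y0 X0 h1 h2.
by split; nra.
Qed.

Lemma rmean_sub_dilation G (rho rho' rho0 r e : R) : holomorphic G -> 0 < e ->
  0 <= r <= 1 -> 0 <= rho <= rho' -> 0 <= rho0 <= r * rho' -> rho' < 1 ->
  rmean rho (fun z => G z - dilation r G z) <= 2 * (rmean rho' G - rmean rho0 G) + e.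
Proof.
move=> hG e0 r01 hrho hrho0 rho'1.
have /andP[r0 r1] := r01; have /andP[h0 hh'] := hrho; have /andP[h00 h0r] := hrho0.
have rho1 : rho < 1 := le_lt_trans hh' rho'1.
have rho'0 : 0 <= rho' := le_trans h0 hh'.
have rr' : r * rho' <= rho' by rewrite ler_piMl.
have rho0' : rho0 <= rho' := le_trans h0r rr'.
have [M M0 GM] := bounded_cpolydisc (holomorphic_continuous hG rho'1).
(* The errors sum to [4 * k + 8 * eta] with [k = eta * (2 * M + 3 * eta)], hence to at most
   [eta * (8 * M + 20)]. *)
pose eta := Num.min 1 (e / (8 * M + 20)).
have den0 : 0 < 8 * M + 20 by rewrite ltr_wpDl// mulr_ge0.
have eta0 : 0 < eta by rewrite lt_min ltr01 divr_gt0.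
have eta1 : eta <= 1 by rewrite ge_min lexx.
have etae : eta * (8 * M + 20) <= e by rewrite -ler_pdivlMr// ge_min lexx orbT.
have [p pp pG] := polynomial_approx hG rho'1 eta0.
have hp := holomorphic_polyfun pp.
have hdG := holomorphic_dilation r0 r1 hG; have hdp := holomorphic_dilation r0 r1 hp.
have := rmean_dilation pp r01 hrho hrho0.
pose k := eta * (2 * M + 3 * eta).
have k0 : 0 <= k by rewrite mulr_ge0 ?(ltW eta0)// addr_ge0// mulr_ge0// ltW.
have cmp z : cpolydisc rho' z -> cabs (p z) ^+ 2 <= cabs (G z) ^+ 2 + k /\
    cabs (G z) ^+ 2 <= cabs (p z) ^+ 2 + k.
  by move=> hz; apply: sqr_cabs_perturb; [exact: GM|exact: pG].
have h1 : rmean rho' p <= 1 * rmean rho' G + 0 * rmean rho' G + k.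
  by apply: rmean_le => // z /cmp[]; rewrite mul1r mul0r addr0.
have h2 : rmean rho0 G <= 1 * rmean rho0 p + 0 * rmean rho0 p + k.
  apply: rmean_le => //; first exact: le_lt_trans rho'1.
  by move=> z /(cpolydiscS rho0')/cmp[]; rewrite mul1r mul0r addr0.
have h3 : rmean rho (fun z => G z - dilation r G z) <=
    2 * rmean rho (fun z => p z - dilation r p z) + 0 * rmean rho p + 2 * (4 * eta).
  have c0 : 0 <= 2 * (4 * eta) by rewrite !mulr_ge0// ltW.
  apply: (rmean_le (holomorphicB hG hdG) (holomorphicB hp hdp) hp h0 rho1
    (ler0n _ 2) (lexx 0) c0).
  move=> z hz; rewrite mul0r addr0.
  have hz' : cpolydisc rho' z by exact: cpolydiscS hz.
  have hrz : cpolydisc rho' (real_complex R r *: z).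
    by apply: (cpolydiscS rr'); exact: cpolydisc_dilation.
  apply: (@sqr_ler_split _ _ (2 * eta)); first exact: cabs_ge0.
    have -> : G z - dilation r G z =
      (p z - dilation r p z) + ((G z - p z) - (dilation r G z - dilation r p z)) by ring.
    rewrite (le_trans (le_normcD _ _))// lerD2l (le_trans (ler_cabsB _ _))//.
    by rewrite mulr_natl mulr2n lerD//; exact: pG.
  by rewrite exprMn expr2; nra.
rewrite /k in h1 h2; nra.
Qed.

(** Once the mean at radius [rho0] nearly reaches the supremum of all means, it can hardly grow any
    more, so a dilation by some [r < 1] moves [G] little at every radius. The dilated function only
    sees [G] on a closed polydisc of radius [r], where polynomials approximate uniformly. *)
Lemma polynomial_density G (B : R) : holomorphic G ->
  (forall r, 0 < r < 1 -> rmean r G <= B) -> forall e, 0 < e ->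
  exists2 p, polyfun p & forall r, 0 < r < 1 -> rmean r (fun z => G z - p z) <= e.
Proof.
move=> hG GB e e0.
pose S := [set rmean r G | r in [set r : R | 0 < r < 1]].
have half : 0 < (2^-1 : R) < 1 by rewrite invr_gt0 ltr0n invf_lt1// ltr1n.
have hS : has_sup S.
  by split; [exists (rmean 2^-1 G), 2^-1|exists B => _ [r hr <-]; exact: GB].
have e8 : 0 < e / 16 by rewrite divr_gt0.
have [_ [rho0 /andP[rho00 rho01] <-] hrho0] := sup_adherent e8 hS.
pose r := (1 + rho0) / 2; have [r0 r1 rr] : [/\ 0 < r, r < 1 & rho0 < r].
  by rewrite /r; split; lra.
(* Any [rho'] above [rho1] satisfies [rho0 <= r * rho']; [rho1] is below 1 because [rho0 < r]. *)
pose rho1 := rho0 / r; have rho1r : rho1 * r = rho0 by rewrite /rho1 divfK// gt_eqF.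
have rho11 : rho1 < 1 by rewrite ltr_pdivrMr// mul1r.
have rho10 : 0 < rho1 by rewrite divr_gt0.
have dG rho : 0 < rho < 1 -> rmean rho (fun z => G z - dilation r G z) <= e / 4.
  move=> /andP[h0 h1]; pose rho' := Num.max rho rho1.
  have hr' : 0 < rho' < 1 by rewrite lt_max h0 gt_max h1.
  have /andP[h'0 h'1] := hr'.
  have := @rmean_sub_dilation G rho rho' rho0 r (e / 8) hG.
  rewrite divr_gt0// (ltW r0) (ltW r1) (ltW h0) le_max lexx (ltW rho00) h'1.
  have -> : rho0 <= r * rho'.
    by rewrite -rho1r mulrC ler_wpM2l ?(ltW r0)// le_max lexx orbT.
  move=> /(_ isT isT isT isT isT) h.
  have : rmean rho' G <= sup S by apply: sup_upper_bound => //; exists rho'.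
  lra.
pose eta := Num.min 1 (e / 8).
have eta0 : 0 < eta by rewrite lt_min ltr01 divr_gt0.
have eta1 : eta <= 1 by rewrite ge_min lexx.
have etae : eta <= e / 8 by rewrite ge_min lexx orbT.
have [q pq qG] := polynomial_approx hG r1 eta0.
have pd := polyfun_dilation r pq.
exists (dilation r q) => // rho /andP[h0 h1].
have hd := holomorphic_dilation (ltW r0) (ltW r1) hG.
have : rmean rho (fun z => G z - dilation r q z) <=
    2 * rmean rho (fun z => G z - dilation r G z) + 0 * rmean rho G + 2 * eta.
  have c0 : 0 <= 2 * eta by rewrite mulr_ge0// ltW.
  apply: (rmean_le (holomorphicB hG (holomorphic_polyfun pd)) (holomorphicB hG hd)
    hG (ltW h0) h1 (ler0n _ 2) (lexx 0) c0).
  move=> z hz; rewrite mul0r addr0.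
  apply: (@sqr_ler_split _ _ eta); first exact: cabs_ge0.
    have -> : G z - dilation r q z =
      (G z - dilation r G z) + (dilation r G z - dilation r q z) by ring.
    rewrite (le_trans (le_normcD _ _))// lerD2l; apply: qG.
    apply: cpolydiscS (cpolydisc_dilation (ltW r0) hz).
    by rewrite ler_piMr// ltW.
  by rewrite expr2 ler_piMl// ltW.
have := dG rho; rewrite h0 h1 => /(_ isT); lra.
Qed.

(** For a polynomial [p] within [d] of [G], the mean of [p] is at most [1 + 8 * d] and the real part
    of [p 0] at least [1 - 2 * d], so [p - 1] has mean at most [12 * d]. Returning to [G] gives
    [2 * 12 * d + 2 * d]. *)
Lemma rmean_sub1 G (r d : R) : holomorphic G -> 0 <= r -> r < 1 -> 0 < d ->
  (forall z, polydisc z -> cabs (G z) <= 1 + d) -> d <= 1 ->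
  1 - d <= complex.Re (G 0) ->
  rmean r (fun z => G z - 1) <= 26 * d.
Proof.
move=> hG r0 r1 d0 GM d1 G0.
have [p pp pG] := polynomial_approx hG r1 d0; have hp := holomorphic_polyfun pp.
have h1 : rmean r p <= 0 * rmean r G + 0 * rmean r G + (1 + 8 * d).
  apply: rmean_le => //; first by rewrite addr_ge0// mulr_ge0// ltW.
  move=> z hz; rewrite !mul0r !add0r.
  have := GM _ (cpolydisc_polydisc r1 hz); have := pG _ hz.
  have := cabs_triangle (p z) (G z) 0; rewrite !subr0 (cabs_sub (p z) (G z)).
  move=> h2 h3 h4; have h5 : cabs (p z) <= 1 + 2 * d by lra.
  apply: (@le_trans _ _ ((1 + 2 * d) ^+ 2)); last first.
    by rewrite expr2; have := ler_wpM2l (ltW d0) d1; lra.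
  by rewrite lerXn2r// nnegrE ?cabs_ge0// addr_ge0// mulr_ge0// ltW.
have p0 : 1 - 2 * d <= complex.Re (p 0).
  have c0 : cpolydisc r (0 : Cn) by move=> j; rewrite mxE Normc.normc0.
  have h := pG _ c0; have := le_trans (cabs_Re _) h; rewrite ReB ler_norml.
  by move=> /andP[_]; lra.
have h2 : rmean r (fun z => G z - 1) <=
    2 * rmean r (fun z => p z - 1) + 0 * rmean r G + 2 * d.
  have c0 : 0 <= 2 * d by rewrite mulr_ge0// ltW.
  have h11 := @holomorphic_cst R n 1.
  apply: (rmean_le (holomorphicB hG h11) (holomorphicB hp h11) hG r0 r1
    (ler0n _ 2) (lexx 0) c0).
  move=> z hz; rewrite mul0r addr0.
  apply: (@sqr_ler_split _ _ d); first exact: cabs_ge0.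
    have -> : G z - 1 = (p z - 1) + (G z - p z) by ring.
    by rewrite (le_trans (le_normcD _ _))// lerD2l; exact: pG.
  by rewrite expr2 ler_piMl// ltW.
move: h2; rewrite (rmean_poly_sub1 r pp); lra.
Qed.

End density.

(** * The complex Hahn-Banach theorem *)

Section hahn_banach.
Context {R : realType}.
Local Notation C := R[i].
Local Notation "r %:C" := (real_complex R r).
Context {X : lmodType C} (p : X -> R).
Hypothesis pD : forall x y, p (x + y) <= p x + p y.
Hypothesis pZ : forall (c : C) x, p (c *: x) = cabs c * p x.
Implicit Types (x y : X) (a b : R) (G : set (X * R)).

(* The graph of a real-linear functional dominated by [p] on a real subspace;
   that it is functional follows from the domination. *)
Definition dominated_graph G :=
  [/\ G (0, 0),
      forall u v, G u -> G v -> G (u.1 + v.1, u.2 + v.2),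
      forall r u, G u -> G (r%:C *: u.1, r * u.2) &
      forall u, G u -> u.2 <= p u.1].

Lemma seminorm0 : p 0 = 0.
Proof. by rewrite -(scale0r (0 : X)) pZ Normc.normc0 mul0r. Qed.

Lemma seminormN x : p (- x) = p x.
Proof. by rewrite -scaleN1r pZ normcN Normc.normc1 mul1r. Qed.

Lemma seminormZ_pos r x : 0 <= r -> p (r%:C *: x) = r * p x.
Proof. by move=> r0; rewrite pZ cabs_real ger0_norm. Qed.

Lemma dominated_graph_functional G x a b : dominated_graph G ->
  G (x, a) -> G (x, b) -> a = b.
Proof.
move=> [_ GD GZ Gp].
have le u v : G (x, u) -> G (x, v) -> u <= v.
  move=> xu /(GZ (-1)) xv; have := Gp _ (GD _ _ xu xv).
  by rewrite /= rmorphN1 scaleN1r subrr seminorm0 mulN1r subr_le0.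
by move=> xa xb; apply/le_anti/andP; split; exact: le.
Qed.

(** The value at [x0] is the supremum of the lower bounds forced by domination, each of which is
    below each upper bound by subadditivity. The other multiples of [x0] follow by homogeneity,
    according to the sign of the scalar. *)
Lemma dominated_graph_extend G x0 : dominated_graph G ->
  exists G', [/\ dominated_graph G', G `<=` G' & exists c, G' (x0, c)].
Proof.
move=> [G0 GD GZ Gp].
pose S := [set u.2 - p (u.1 - x0) | u in G].
have bound u v : G u -> G v -> u.2 - p (u.1 - x0) <= p (v.1 + x0) - v.2.
  move=> Gu Gv; have := Gp _ (GD _ _ Gu Gv) => /=.
  have := pD (u.1 - x0) (v.1 + x0); rewrite addrACA addNr addr0; lra.
have hS : has_sup S.
  split; first by exists (0 - p (0 - x0)), (0, 0).
  by exists (p (0 + x0) - 0) => _ [u Gu <-]; exact: (bound u _ Gu G0).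
pose c := sup S.
have clo u : G u -> u.2 - p (u.1 - x0) <= c.
  by move=> Gu; apply: sup_upper_bound => //; exists u.
have chi v : G v -> c <= p (v.1 + x0) - v.2.
  by move=> Gv; apply: ge_sup; [exact: hS.1|move=> _ [u Gu <-]; exact: bound].
exists [set w | exists r u, G u /\ w = (u.1 + r%:C *: x0, u.2 + r * c)].
split; last by exists c; exists 1, (0, 0); rewrite /= rmorph1 scale1r mul1r !add0r.
- split.
  + by exists 0, (0, 0); rewrite /= scale0r mul0r !addr0.
  + move=> _ _ [r [u [Gu ->]]] [s [v [Gv ->]]].
    exists (r + s), (u.1 + v.1, u.2 + v.2); split; first exact: GD.
    by rewrite /= rmorphD scalerDl mulrDl addrACA (addrACA u.2).
  + move=> s _ [r [u [Gu ->]]]; exists (s * r), (s%:C *: u.1, s * u.2); split.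
      exact: GZ.
    by rewrite /= rmorphM scalerDr scalerA mulrDr mulrA.
  + move=> _ [r [u [Gu ->]]] /=; have [r0|r0|->] := ltgtP r 0.
    * have q0 : 0 < - r by rewrite oppr_gt0.
      have rV : (- r) * (- r)^-1 = 1 by rewrite divff// gt_eqF.
      have := clo _ (GZ (- r)^-1 _ Gu); rewrite /= -(ler_pM2l q0) mulrBr mulrA rV mul1r.
      rewrite -seminormZ_pos ?(ltW q0)// scalerBr scalerA -rmorphM rV rmorph1 scale1r.
      by rewrite rmorphN scaleNr opprK; lra.
    * have rV : r * r^-1 = 1 by rewrite divff// gt_eqF.
      have := chi _ (GZ r^-1 _ Gu); rewrite /= -(ler_pM2l r0) mulrBr mulrA rV mul1r.
      rewrite -seminormZ_pos ?(ltW r0)// scalerDr scalerA -rmorphM rV rmorph1 scale1r.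
      by lra.
    * by rewrite scale0r mul0r !addr0; exact: Gp.
- by move=> u Gu; exists 0, u; rewrite scale0r mul0r !addr0; split=> //; case: u {Gu}.
Qed.

Lemma dominated_graph_maximal G0 : dominated_graph G0 ->
  exists G, [/\ dominated_graph G, G0 `<=` G & forall x, exists a, G (x, a)].
Proof.
move=> dG0; pose P : set (set (X * R)) :=
  [set G | G = set0 \/ (dominated_graph G /\ G0 `<=` G)].
have [F FP Ftot|G [PG Gmax]] := @Zorn_bigcup _ P.
  have [[G1 [FG1 G1P]]|nF] := pselect (exists G, F G /\ (dominated_graph G /\ G0 `<=` G));
    last first.
    left; rewrite -subset0 => u [G FG Gu].
    by case: (FP _ FG) Gu => [->//|dG]; case: nF; exists G.
  have dF u G : F G -> G u -> dominated_graph G.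
    by move=> FG Gu; case: (FP _ FG) Gu => [->//|[]].
  right; split; last first.
    by apply: subset_trans G1P.2 _ => u Gu; exists G1.
  split.
  - by exists G1 => //; case: G1P => -[].
  - move=> u v [G FG Gu] [H FH Hv].
    have [GH|HG] := Ftot _ _ FG FH.
      by exists H => //; have [_ HD _ _] := dF _ _ FH Hv; exact/HD/Hv/GH.
    by exists G => //; have [_ GD _ _] := dF _ _ FG Gu; exact/GD/HG.
  - by move=> r u [G FG Gu]; exists G => //; have [_ _ GZ _] := dF _ _ FG Gu; exact: GZ.
  - by move=> u [G FG Gu]; have [_ _ _] := dF _ _ FG Gu; exact.
have [dG sG] : dominated_graph G /\ G0 `<=` G.
  case: PG => // G_0; exfalso; apply: (Gmax G0); last by right; split.
  rewrite G_0 properEneq; split; last exact: sub0set.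
  by apply/eqP => /esym G00; case: dG0; rewrite G00.
exists G; split=> // x; apply: contrapT => nx.
have [G' [dG' GG' [c G'x]]] := dominated_graph_extend x dG.
apply: (Gmax G'); last by right; split=> //; exact: subset_trans GG'.
rewrite properEneq; split=> //; apply/eqP => GG; apply: nx.
by exists c; rewrite GG.
Qed.

Lemma hahn_banach_real (J : set X) (l : X -> R) :
  J 0 -> (forall x y, J x -> J y -> J (x + y)) ->
  (forall r x, J x -> J (r%:C *: x)) ->
  {morph l : x y / x + y} -> (forall r x, l (r%:C *: x) = r * l x) ->
  (forall x, J x -> l x <= p x) ->
  exists u : X -> R, [/\ {morph u : x y / x + y},
    forall r x, u (r%:C *: x) = r * u x, forall x, J x -> u x = l x &
    forall x, u x <= p x].
Proof.
move=> J0 JD JZ lD lZ lp; have l0 : l 0 = 0.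
  by rewrite -(scale0r (0 : X)) -(rmorph0 (real_complex R)) lZ mul0r.
have dG0 : dominated_graph [set w : X * R | J w.1 /\ w.2 = l w.1].
  split.
  - by rewrite /= l0.
  - by move=> u v [Ju ->] [Jv ->] /=; rewrite lD; split=> //; exact: JD.
  - by move=> r u [Ju ->] /=; rewrite lZ; split=> //; exact: JZ.
  - by move=> u [Ju ->]; exact: lp.
have [G [dG sG /choice[u hu]]] := dominated_graph_maximal dG0.
have fG := dominated_graph_functional dG; have [_ GD GZ Gp] := dG.
exists u; split.
- by move=> x y; apply: (fG (x + y)) => //; exact: (GD _ _ (hu x) (hu y)).
- by move=> r x; apply: (fG (r%:C *: x)) => //; exact: (GZ _ _ (hu x)).
- by move=> x Jx; apply: (fG x) => //; apply: sG.
- by move=> x; exact: (Gp _ (hu x)).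
Qed.

(* A complex functional is recovered from its real part [u] as
   [u x - i u (i x)]. *)
Lemma hahn_banach (J : set X) (l : {linear X -> C^o}) :
  J 0 -> (forall x y, J x -> J y -> J (x + y)) ->
  (forall (c : C) x, J x -> J (c *: x)) ->
  (forall x, J x -> cabs (l x) <= p x) ->
  exists v : X -> C^o, [/\ linear v, forall x, J x -> v x = l x &
    forall x, cabs (v x) <= p x].
Proof.
move=> J0 JD JZ lp.
have [||||||u [uD uZ uJ up]] := @hahn_banach_real J (fun x => complex.Re (l x)) => //.
- by move=> r x; exact: JZ.
- by move=> x y; rewrite linearD ReD.
- move=> r x; rewrite linearZ; case: (l x) => a b.
  by rewrite /= mul0r subr0.
- by move=> x Jx; rewrite (le_trans _ (lp _ Jx))// (le_trans (ler_norm _))// cabs_Re.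
pose i : C := Complex 0 1.
pose v x : C^o := Complex (u x) (- u (i *: x)).
have vD x y : v (x + y) = v x + v y.
  by rewrite /v scalerDr !uD opprD.
have vR r x : v (r%:C *: x) = r%:C * v x.
  rewrite /v scalerA mulrC -scalerA !uZ; apply/eqP.
  by rewrite eq_complex /= !mul0r subr0 addr0 mulrN !eqxx.
have vi x : v (i *: x) = i * v x.
  have ii : i *: (i *: x) = - x.
    rewrite scalerA; have -> : i * i = -1.
      by apply/eqP; rewrite eq_complex /= !(mul0r, mul1r, mulr0, add0r, addr0, oppr0, eqxx).
    by rewrite scaleN1r.
  have uN : u (- x) = - u x.
    by rewrite -scaleN1r -(rmorphN1 (real_complex R)) uZ mulN1r.
  by rewrite /v ii uN; apply/eqP; rewrite eq_complex /= !(mul0r, mul1r, opprK, add0r, eqxx).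
have vZ c x : v (c *: x) = c * v x.
  have -> : c = (complex.Re c)%:C + (complex.Im c)%:C * i.
    case: c => a b; apply/eqP; rewrite eq_complex /=.
    by rewrite !(mul0r, mulr0, mulr1, subrr, oppr0, add0r, addr0, eqxx).
  by rewrite scalerDl vD vR -scalerA vR vi mulrDl mulrA.
exists v; split.
- by move=> c x y; rewrite vD vZ.
- move=> x Jx; have Jix : J (i *: x) by exact: JZ.
  rewrite /v !uJ// linearZ; case: (l x) => a b; apply/eqP.
  by rewrite eq_complex /= !(mul0r, mul1r, add0r, opprK, eqxx).
- move=> x; have [->|vx0] := eqVneq (v x) 0.
    by rewrite Normc.normc0 -[p x]ger0_norm// -(@pmulr_rge0 _ 2)//
      mulr_natl mulr2n -{2}(seminormN x) (le_trans _ (pD _ _))// subrr seminorm0.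
  have vx : 0 < cabs (v x) by rewrite cabs_gt0.
  (* Rotating [x] by [c] makes [v] real and nonnegative there, so that the bound on the real part
     bounds the modulus. *)
  pose c := (cabs (v x))%:C / v x.
  have c1 : cabs c = 1.
    by rewrite Normc.normcM Normc.normcV cabs_real gtr0_norm// divff// gt_eqF.
  have := up (c *: x); rewrite pZ c1 mul1r; apply: le_trans.
  by rewrite -[leRHS]/(complex.Re (v (c *: x))) vZ /c divfK.
Qed.

End hahn_banach.

(** * Point evaluations and M-ideals *)

Section dual_norm.
Context {R : realType}.
Local Notation C := R[i].
Context {X : normedModType C}.
Implicit Types (x y : X) (phi psi : dual X).

Definition rnorm x : R := complex.Re `|x|.

Lemma normE x : `|x| = real_complex R (rnorm x).
Proof. by rewrite /rnorm RRe_real// normr_real. Qed.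

Lemma rnorm_ge0 x : 0 <= rnorm x.
Proof. by rewrite -ler0c -normE. Qed.

Lemma ler_rnormD x y : rnorm (x + y) <= rnorm x + rnorm y.
Proof. by rewrite -lecR rmorphD/= -!normE ler_normD. Qed.

Lemma rnormZ (c : C) x : rnorm (c *: x) = cabs c * rnorm x.
Proof. by apply: (@complexI R); rewrite rmorphM/= -!normE normrZ. Qed.

Lemma rnorm_eq0 x : rnorm x = 0 -> x = 0.
Proof. by move=> x0; apply: normr0_eq0; rewrite normE x0. Qed.

Lemma unit_ballE x : unit_ball x <-> rnorm x <= 1.
Proof. by rewrite /unit_ball /= normE -(rmorph1 (real_complex R)) lecR. Qed.

Lemma bounded_linear_dual (f : X -> C^o) (s : R) : linear f ->
  (forall x, cabs (f x) <= s * rnorm x) -> f \in @dual_pred R X.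
Proof.
move=> lf fs; apply/asboolP; split=> //.
pose L := GRing.isLinear.Build C X C^o *:%R f lf.
pose F : {linear X -> C^o} := HB.pack f L.
apply/(linear_bounded_continuous F)/(linear_boundedP F).
exists (real_complex R s); split; first by rewrite complex_real.
move=> M sM x; apply: (@le_trans _ _ (real_complex R s * `|x|)).
  by rewrite normE cabsE -rmorphM lecR; exact: fs.
by rewrite ler_wpM2r// ltW.
Qed.

Definition dnorm phi : R := supnorm (@unit_ball R X) phi.

Lemma dnormE phi : `|phi| = real_complex R (dnorm phi).
Proof. by []. Qed.

Lemma dnorm_ge0 phi : 0 <= dnorm phi.
Proof. exact: supnorm_ge0. Qed.

Lemma dnormN phi : dnorm (- phi) = dnorm phi.
Proof. by apply: (@complexI R); rewrite -!dnormE normrN. Qed.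

Lemma dnorm_eq0 phi : dnorm phi = 0 -> phi = 0.
Proof. by move=> phi0; apply: normr0_eq0; rewrite dnormE phi0. Qed.

Lemma cabs_dual_le phi x : cabs (phi x) <= dnorm phi * rnorm x.
Proof.
have [->|x0] := eqVneq x 0.
  by rewrite linear0 Normc.normc0 mulr_ge0// ?rnorm_ge0// dnorm_ge0.
have rx : 0 < rnorm x.
  by rewrite lt_neqAle rnorm_ge0 andbT eq_sym; apply: contra_neq x0; exact: rnorm_eq0.
pose c := real_complex R (rnorm x)^-1.
have cx : cabs c = (rnorm x)^-1 by rewrite cabs_real ger0_norm// invr_ge0 ltW.
have := @supnorm_ub _ _ (@unit_ball R X) phi (c *: x) (dual_bounded phi).
rewrite linearZ Normc.normcM cx ler_pdivrMl// mulrC; apply.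
by apply/unit_ballE; rewrite rnormZ cx mulVf// gt_eqF.
Qed.

Lemma cabs_dual_le1 phi x : unit_ball x -> cabs (phi x) <= dnorm phi.
Proof. by move=> x1; apply: supnorm_ub => //; exact: dual_bounded. Qed.

Lemma dnorm_le phi (s : R) : 0 <= s ->
  (forall x, unit_ball x -> cabs (phi x) <= s) -> dnorm phi <= s.
Proof. by move=> s0 h; exact: supnorm_le. Qed.

Lemma dnorm_approx phi (e : R) : 0 < e ->
  exists2 x, unit_ball x & dnorm phi - e < cabs (phi x).
Proof.
move=> e0; apply: contrapT => nx.
suff : dnorm phi <= Num.max 0 (dnorm phi - e).
  rewrite le_max => /orP[h|h]; last by lra.
  apply: nx; exists 0; first by apply/unit_ballE; rewrite /rnorm normr0.
  by rewrite linear0 Normc.normc0 subr_lt0 (le_lt_trans h).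
apply: dnorm_le; first by rewrite le_max lexx.
move=> x x1; rewrite le_max; apply/orP; right; rewrite leNgt.
by apply/negP => h; apply: nx; exists x.
Qed.

Section L_projection.
Context (P : {linear dual X -> dual X}).
Hypothesis PP : forall phi, P (P phi) = P phi.
Hypothesis PL : forall phi, `|P phi| + `|phi - P phi| = `|phi|.

Lemma dnorm_Lprojection phi : dnorm (P phi) + dnorm (phi - P phi) = dnorm phi.
Proof. by apply: (@complexI R); rewrite rmorphD/= -!dnormE PL. Qed.

End L_projection.
End dual_norm.

(** * Point evaluations and states *)

Section point_evaluations.
Context {R : realType} {n : nat}.
Local Notation C := R[i].
Local Notation Cn := ('rV[C]_n : normedModType C).
Local Notation H := (Hinf R n).
Implicit Types (F G K : H) (z : Cn) (phi : dual H).

Lemma rnorm_HinfE F : rnorm F = supnorm (@polydisc R n) F.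
Proof. by []. Qed.

Lemma cabs_Hinf_le F z : polydisc z -> cabs (F z) <= rnorm F.
Proof. by move=> Dz; rewrite rnorm_HinfE supnorm_ub//; exact: Hinf_bounded. Qed.

Lemma rnorm_Hinf_le F (M : R) : 0 <= M ->
  (forall z, polydisc z -> cabs (F z) <= M) -> rnorm F <= M.
Proof. by move=> M0 FM; rewrite rnorm_HinfE; exact: supnorm_le. Qed.

Lemma Hinf_holomorphic F : holomorphic F.
Proof. by case: F => f /= /asboolP[]. Qed.

Lemma HinfNE F z : (- F) z = - F z. Proof. by []. Qed.
Lemma HinfZE (c : C) F z : (c *: F) z = c * F z. Proof. by []. Qed.

Definition Hinf_ext_fun (g : Cn -> C^o) : Cn -> C^o :=
  fun z => if pselect (polydisc z) then g z else 0.

Lemma Hinf_extP (g : Cn -> C^o) : holomorphic g -> bounded_on (@polydisc R n) g ->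
  Hinf_ext_fun g \in @Hinf_pred R n.
Proof.
move=> hg [M gM]; apply/asboolP; split.
- move=> z Dz; apply: near_eq_differentiable (hg _ Dz).
  have : nbhs z (@polydisc R n : set Cn).
    by apply: open_nbhs_nbhs; split=> //; exact: open_polydisc.
  by apply: filterS => y Dy; rewrite /Hinf_ext_fun; case: (pselect (polydisc y)).
- by exists M => z Dz; rewrite /Hinf_ext_fun; case: (pselect (polydisc z)) => //= _; exact: gM.
- by move=> z Dz; rewrite /Hinf_ext_fun; case: (pselect (polydisc z)).
Qed.

Lemma Hinf_ext (g : Cn -> C^o) : holomorphic g -> bounded_on (@polydisc R n) g ->
  exists F : H, forall z, polydisc z -> F z = g z.
Proof.
move=> hg bg; exists (MkHinf (Hinf_extP hg bg)) => z Dz.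
by rewrite /= /Hinf_ext_fun; case: (pselect (polydisc z)).
Qed.

Lemma Hinf_one : exists F : H, forall z, polydisc z -> F z = 1.
Proof.
apply: (@Hinf_ext (fun=> 1)); first by move=> z _; exact: differentiable_cst.
by exists 1 => z _; rewrite Normc.normc1.
Qed.

Lemma eval_dual z : polydisc z -> exists phi : dual H, forall F, phi F = F z.
Proof.
move=> Dz; have h : (fun F : H => F z : C^o) \in @dual_pred R H.
  apply: (@bounded_linear_dual _ _ _ 1) => // F; rewrite mul1r.
  exact: cabs_Hinf_le.
by exists (Dual h).
Qed.

Section states.
Context (one : H) (one1 : forall z, polydisc z -> one z = 1).

Lemma rnorm_one_le : rnorm one <= 1.
Proof.
by apply: rnorm_Hinf_le => // z Dz; rewrite one1// Normc.normc1.
Qed.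

(** States are not normalized: the two parts of an evaluation qualify, even when one of them is
    zero. *)
Definition state phi := phi one = real_complex R (dnorm phi).

(** For large [rho], a function with nonnegative real part satisfies [rnorm (rho - K) <= rho + M ^+
    2 / (2 * rho)], with an excess that tends to 0. Evaluating a state on [rho - K] bounds the real
    part of [phi K] from below by a quantity tending to 0. *)
Lemma state_positive phi K : state phi ->
  (forall z, polydisc z -> 0 <= complex.Re (K z)) -> 0 <= complex.Re (phi K).
Proof.
move=> sphi K0; have N0 := dnorm_ge0 phi.
pose M := rnorm K; have M0 : 0 <= M := rnorm_ge0 K.
have main (rho : R) : 0 < rho ->
    - (dnorm phi * (M ^+ 2 / (2 * rho))) <= complex.Re (phi K).
  move=> rho0; pose G := real_complex R rho *: one - K.
  have r20 : 0 < 2 * rho by rewrite mulr_gt0.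
  have b0 : 0 <= M ^+ 2 / (2 * rho) by rewrite divr_ge0 ?sqr_ge0// ltW.
  have GM : rnorm G <= rho + M ^+ 2 / (2 * rho).
    apply: rnorm_Hinf_le => [|z Dz]; first by rewrite addr_ge0// ltW.
    have -> : G z = real_complex R rho - K z by rewrite -[LHS]/(_ * one z - K z) one1// mulr1.
    have KM : cabs (K z) ^+ 2 <= M ^+ 2.
      by rewrite lerXn2r// ?nnegrE ?cabs_ge0//; exact: cabs_Hinf_le.
    rewrite -(@ler_pXn2r _ 2)// ?nnegrE ?cabs_ge0 ?addr_ge0 ?(ltW rho0)//.
    have -> : (rho + M ^+ 2 / (2 * rho)) ^+ 2 =
        rho ^+ 2 + M ^+ 2 + (M ^+ 2 / (2 * rho)) ^+ 2 by field; rewrite gt_eqF.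
    have -> : cabs (real_complex R rho - K z) ^+ 2 =
        rho ^+ 2 - 2 * rho * complex.Re (K z) + cabs (K z) ^+ 2.
      case: (K z) => a b /=; rewrite !sqr_sqrtr ?addr_ge0 ?sqr_ge0//.
      by rewrite sub0r; ring.
    have := mulr_ge0 (ltW r20) (K0 _ Dz); have := sqr_ge0 (M ^+ 2 / (2 * rho)); lra.
  have := cabs_dual_le phi G; rewrite /G linearB linearZ /= sphi => h.
  have := le_trans (cabs_Re _) h; rewrite ReB => /(le_trans (ler_norm _)).
  have -> : complex.Re (real_complex R rho *: (real_complex R (dnorm phi) : C^o)) =
      rho * dnorm phi by rewrite /= mul0r subr0.
  have := ler_wpM2l N0 GM; rewrite /G; lra.
rewrite leNgt; apply/negP => neg.
pose x := dnorm phi * M ^+ 2; have x0 : 0 <= x by rewrite mulr_ge0// sqr_ge0.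
pose y := - complex.Re (phi K); have y0 : 0 < y by rewrite oppr_gt0.
(* With this [rho] the lower bound is at least [- y / 2], while the real part of [phi K] is
   [- y]. *)
have rho0 : 0 < (x + 1) / y by rewrite divr_gt0// ltr_wpDl.
have := main _ rho0.
have -> : dnorm phi * (M ^+ 2 / (2 * ((x + 1) / y))) = x / (x + 1) * (y / 2).
  by rewrite /x; field; rewrite (gt_eqF y0) gt_eqF// ltr_wpDl.
have q1 : x / (x + 1) <= 1 by rewrite ler_pdivrMr ?ltr_wpDl// mul1r lerDl.
have := ler_wpM2r (ltW (divr_gt0 y0 (ltr0n _ 2))) q1; rewrite mul1r /y; lra.
Qed.

Lemma exists_rotation (w : C) : exists2 u : C, cabs u = 1 & u * w = real_complex R (cabs w).
Proof.
have [->|w0] := eqVneq w 0.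
  by exists 1; rewrite ?Normc.normc1// Normc.normc0 mulr0.
have cw : 0 < cabs w by rewrite cabs_gt0.
exists (real_complex R (cabs w) / w); last by rewrite divfK.
by rewrite Normc.normcM Normc.normcV cabs_real gtr0_norm// divff// gt_eqF.
Qed.

(** Positivity applied to [(a + b) - b F - u G], where the unimodular [u] makes [u * phi G] equal to
    its modulus. *)
Lemma state_bound phi F G (a b : R) : state phi ->
  (forall z, polydisc z -> cabs (G z) <= a + b * (1 - complex.Re (F z))) ->
  cabs (phi G) <= a * dnorm phi + b * (dnorm phi - complex.Re (phi F)).
Proof.
move=> sphi GF; have [u u1 uG] := exists_rotation (phi G).
pose K := real_complex R (a + b) *: one - real_complex R b *: F - u *: G.
have ReR (r : R) (w : C) : complex.Re (real_complex R r * w) = r * complex.Re w.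
  by case: w => x y /=; rewrite mul0r subr0.
have ReC (r : R) : complex.Re (real_complex R r) = r by [].
have phiK : phi K = real_complex R (a + b) * phi one - real_complex R b * phi F - u * phi G.
  by rewrite /K !linearB !linearZ.
have := @state_positive phi K sphi.
rewrite phiK sphi uG !ReB (ReR (a + b)) (ReR b) !ReC => H.
suff : 0 <= (a + b) * dnorm phi - b * complex.Re (phi F) - cabs (phi G) by lra.
apply: H => z Dz.
have -> : K z = real_complex R (a + b) * one z - real_complex R b * F z - u * G z by [].
rewrite one1// mulr1 !ReB (ReR b) ReC.
have := GF _ Dz; have := cabs_Re (u * G z); rewrite Normc.normcM u1 mul1r ler_norml.
by move=> /andP[_]; lra.
Qed.

End states.
End point_evaluations.

(** * Point evaluations under an L-projection *)

Section Mideals_of_Hinf.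
Context {R : realType} {n : nat}.
Local Notation C := R[i].
Local Notation Cn := ('rV[C]_n : normedModType C).
Local Notation H := (Hinf R n).
Implicit Types (F G K : H) (z w : Cn) (phi psi : dual H).

Section point_evaluation_dichotomy.
Context (P : {linear dual H -> dual H}).
Hypothesis PP : forall phi, P (P phi) = P phi.
Hypothesis PL : forall phi, `|P phi| + `|phi - P phi| = `|phi|.
Context (one : H) (one1 : forall z, polydisc z -> one z = 1).

Lemma dnorm_eval z phi : polydisc z -> (forall F, phi F = F z) -> dnorm phi = 1.
Proof.
move=> Dz phiE; apply/le_anti/andP; split.
  apply: dnorm_le => // F /unit_ballE; apply: le_trans.
  by rewrite phiE; exact: cabs_Hinf_le.
have := @cabs_dual_le1 _ _ phi one; rewrite phiE one1// Normc.normc1; apply.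
exact/unit_ballE/(rnorm_one_le one1).
Qed.

Lemma Re_eq_cabs (x : C) (N : R) : cabs x <= N -> N <= complex.Re x -> x = real_complex R N.
Proof.
case: x => a b /= ab Na.
have N0 : 0 <= N := le_trans (sqrtr_ge0 _) ab.
have : a ^+ 2 + b ^+ 2 <= N ^+ 2.
  by rewrite -[leLHS]sqr_sqrtr ?addr_ge0 ?sqr_ge0// lerXn2r// nnegrE sqrtr_ge0.
have : N ^+ 2 <= a ^+ 2 by rewrite lerXn2r// nnegrE (le_trans N0).
have := sqr_ge0 b => b0 h1 h2.
have b2 : b ^+ 2 = 0 by lra.
have a2 : a ^+ 2 = N ^+ 2 by lra.
have -> : b = 0 by apply/eqP; rewrite -sqrf_eq0 b2.
by congr Complex; apply/eqP; rewrite -(@eqrXn2 _ 2)// ?a2// (le_trans N0).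
Qed.

(** On the unit disc [cabs (1 - x) ^+ 2] is at most [2 * (1 - complex.Re x)]. The inequality of
    means removes the square root and leaves the affine form required by [state_bound]. *)
Lemma cabs_1B_le (d : R) (x : C) : 0 < d -> cabs x <= 1 ->
  cabs (1 - x) <= d + d^-1 * (1 - complex.Re x).
Proof.
move=> d0 x1; have x2 : cabs (1 - x) ^+ 2 <= 2 * (1 - complex.Re x).
  case: x x1 => a b /= x1; have : a ^+ 2 + b ^+ 2 <= 1.
    by rewrite -[leLHS]sqr_sqrtr ?addr_ge0 ?sqr_ge0// exprn_ile1// sqrtr_ge0.
  by rewrite sqr_sqrtr ?addr_ge0 ?sqr_ge0// sub0r sqrrN; nra.
rewrite -(ler_pM2l d0) mulrDr mulrA divff ?gt_eqF// mul1r.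
have := sqr_ge0 (d - cabs (1 - x)); nra.
Qed.

Lemma cabs_1B_sqr_le (d : R) (x : C) : 0 < d -> cabs x <= 1 ->
  cabs (1 - x * x) <= 2 * d + 2 * d^-1 * (1 - complex.Re x).
Proof.
move=> d0 x1; have -> : 1 - x * x = (1 - x) * (1 + x) by ring.
have -> : 2 * d + 2 * d^-1 * (1 - complex.Re x) = (d + d^-1 * (1 - complex.Re x)) * 2 by ring.
rewrite Normc.normcM ler_pM ?cabs_ge0//; first exact: cabs_1B_le.
by rewrite (le_trans (le_normcD _ _))// Normc.normc1; lra.
Qed.

Lemma state_near1 phi F (d : R) : state one phi -> dnorm phi <= 1 -> 0 < d ->
  (forall y, polydisc y -> cabs (F y) <= 1) ->
  dnorm phi - complex.Re (phi F) <= d ^+ 2 ->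
  cabs (phi (one - F)) <= 2 * d /\ cabs (phi (one - Hinf_mul F F)) <= 4 * d.
Proof.
move=> sphi N1 d0 F1 hd; have N0 := dnorm_ge0 phi.
have b : d^-1 * (dnorm phi - complex.Re (phi F)) <= d by rewrite ler_pdivrMl// -expr2.
have dN : d * dnorm phi <= d by rewrite ler_piMr// ltW.
split.
  apply: (@le_trans _ _ (d * dnorm phi + d^-1 * (dnorm phi - complex.Re (phi F)))); last by lra.
  apply: (state_bound one1 sphi) => y Dy.
  have -> : (one - F) y = one y - F y by [].
  by rewrite one1//; apply: cabs_1B_le => //; exact: F1.
apply: (@le_trans _ _ (2 * d * dnorm phi + 2 * d^-1 * (dnorm phi - complex.Re (phi F)))).
  apply: (state_bound one1 sphi) => y Dy.
  have -> : (one - Hinf_mul F F) y = one y - F y * F y by [].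
  by rewrite one1//; apply: cabs_1B_sqr_le => //; exact: F1.
by rewrite -!mulrA; lra.
Qed.

(** The square of [2 * t - 1] is close to that of [x], hence to 1, and
    [1 - (2 * t - 1) ^+ 2 = 4 * t * (1 - t)]. *)
Lemma two_point_arith (x : C) (t d : R) : 0 <= t -> t <= 1 -> cabs x <= 1 ->
  cabs (x - real_complex R (2 * t - 1)) <= 4 * d -> cabs (1 - x * x) <= 8 * d ->
  4 * t * (1 - t) <= 16 * d.
Proof.
move=> t0 t1 x1 xt xx.
have a1 : cabs (real_complex R (2 * t - 1)) <= 1.
  by rewrite cabs_real ler_norml; apply/andP; split; lra.
have : cabs (1 - real_complex R (2 * t - 1) ^+ 2) <= 16 * d.
  set a := real_complex R (2 * t - 1) in xt a1 *.
  have -> : 1 - a ^+ 2 = (1 - x * x) + (x - a) * (x + a) by ring.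
  rewrite (le_trans (le_normcD _ _))// Normc.normcM.
  have h2 : cabs (x + a) <= 2 by rewrite (le_trans (le_normcD _ _))//; lra.
  have := ler_pM (cabs_ge0 _) (cabs_ge0 _) xt h2; lra.
rewrite -rmorphXn -(rmorph1 (real_complex R)) -rmorphB cabs_real.
by move=> /(le_trans (ler_norm _)); lra.
Qed.

(* The two parts of an evaluation are multiples of states. If [F] almost
   attains the norm of their difference, then [F] is nearly [1] for the first
   state and nearly [-1] for the second one, so that [F ^ 2] is nearly [1] for
   both; as evaluation is multiplicative, [F z] is then close to [1] or [-1]. *)
Lemma eval_dichotomy z phi : polydisc z -> (forall F, phi F = F z) ->
  P phi = 0 \/ P phi = phi.
Proof.
move=> Dz phiE; pose phi1 := P phi; pose phi2 := phi - P phi.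
have N := dnorm_eval Dz phiE.
have N12 : dnorm phi1 + dnorm phi2 = 1 by rewrite -N; exact: dnorm_Lprojection.
have phi12 F : phi1 F + phi2 F = F z.
  by rewrite -phiE; change (phi1 F + (phi F - phi1 F) = phi F); rewrite addrC subrK.
have one_ball : unit_ball one by apply/unit_ballE/(rnorm_one_le one1).
have l1 := cabs_dual_le1 phi1 one_ball; have l2 := cabs_dual_le1 phi2 one_ball.
have Rez : complex.Re (phi1 one) + complex.Re (phi2 one) = 1.
  by rewrite -ReD phi12 one1.
have r1 := le_trans (ler_norm _) (le_trans (cabs_Re _) l1).
have r2 := le_trans (ler_norm _) (le_trans (cabs_Re _) l2).
(* The values at [one] have real parts summing to 1, as do the norms that bound them, so both bounds
   are attained. *)
have s1 : state one phi1 by apply: Re_eq_cabs => //; lra.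
have s2 : state one phi2 by apply: Re_eq_cabs => //; lra.
set t := dnorm phi1 in N12 l1 r1; have t0 : 0 <= t := dnorm_ge0 phi1.
have N2 : dnorm phi2 = 1 - t by lra.
have t1 : t <= 1 by have := dnorm_ge0 phi2; lra.
(* The L-projection also splits [phi1 - phi2] into [phi1] and [- phi2], so the change of sign does
   not affect the norm. *)
have ND : dnorm (phi1 - phi2) = 1.
  have P1 : P (phi1 - phi2) = phi1.
    by rewrite /phi1 /phi2 linearB (linearB P phi) /= !PP subrr subr0.
  have := dnorm_Lprojection PL (phi1 - phi2); rewrite P1 addrAC subrr add0r dnormN.
  by move=> <-; exact: N12.
have key (d : R) : 0 < d -> d <= 1 -> 4 * t * (1 - t) <= 16 * d.
  move=> d0 d1; have e0 : 0 < d ^+ 2 by rewrite exprn_gt0.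
  have [F0 F01 hF0] := dnorm_approx (phi1 - phi2) e0.
  have [u u1 uF0] := exists_rotation ((phi1 - phi2) F0).
  pose F := u *: F0.
  have FD y : polydisc y -> cabs (F y) <= 1.
    move=> Dy; change (cabs (u * F0 y) <= 1); rewrite Normc.normcM u1 mul1r.
    by move/unit_ballE: F01; apply: le_trans; exact: cabs_Hinf_le.
  have F1 : unit_ball F by apply/unit_ballE/rnorm_Hinf_le.
  have hF : 1 - d ^+ 2 < complex.Re (phi1 F) - complex.Re (phi2 F).
    rewrite -ReB; have -> : phi1 F - phi2 F = u * (phi1 - phi2) F0.
      have h1 : phi1 F = u * phi1 F0 by rewrite /F linearZ.
      have h2 : phi2 F = u * phi2 F0 by rewrite /F linearZ.
      by rewrite h1 h2 -mulrBr.
    by rewrite uF0 -ND.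
  have b1 := le_trans (ler_norm _) (le_trans (cabs_Re _) (cabs_dual_le1 phi1 F1)).
  have b2 : - complex.Re (phi2 F) <= 1 - t.
    by rewrite -N2 (le_trans (ler_norm _))// normrN (le_trans (cabs_Re _))// cabs_dual_le1.
  rewrite -/t in b1.
  have d20 : t - complex.Re (phi1 F) <= d ^+ 2 by lra.
  have NE (phi' : dual H) : phi' (- F) = - phi' F by rewrite linearN.
  have d20' : dnorm phi2 - complex.Re (phi2 (- F)) <= d ^+ 2.
    by rewrite NE N2 -[- phi2 F]sub0r ReB sub0r; lra.
  have N2_1 : dnorm phi2 <= 1 by lra.
  have FD' y : polydisc y -> cabs ((- F) y) <= 1.
    by move=> Dy; rewrite HinfNE normcN; exact: FD.
  have [g1 q1] := state_near1 s1 t1 d0 FD d20.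
  have [g2 q2] := state_near1 s2 N2_1 d0 FD' d20'.
  have FF : Hinf_mul (- F) (- F) = Hinf_mul F F.
    apply/val_inj/funext => y; change ((- F y) * (- F y) = F y * F y).
    by rewrite (mulrNN (F y) (F y)).
  rewrite FF in q2.
  have q12 : phi1 (one - Hinf_mul F F) + phi2 (one - Hinf_mul F F) = 1 - F z * F z.
    rewrite phi12; have -> : (one - Hinf_mul F F) z = one z - F z * F z by [].
    by rewrite one1.
  (* Here [phi1 F] is close to [t] and [phi2 F] to [- (1 - t)], which places [F z] near
     [2 * t - 1]. *)
  have g12 : phi2 (one - - F) - phi1 (one - F) = F z - real_complex R (2 * t - 1).
    have BE (phi' : dual H) (G G' : H) : phi' (G - G') = phi' G - phi' G' by exact: linearB.
    rewrite (BE phi1) (BE phi2) NE s1 s2 -/t N2 -phi12.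
    have -> : real_complex R (2 * t - 1) = real_complex R t - real_complex R (1 - t).
      by rewrite -rmorphB; congr (real_complex R _); ring.
    by ring.
  apply: (@two_point_arith (F z)) => //.
  - exact: FD.
  - by rewrite -g12 (le_trans (ler_cabsB _ _))//; lra.
  - by rewrite -q12 (le_trans (le_normcD _ _))//; lra.
have : t * (1 - t) <= 0.
  apply/ler_addgt0Pr => e e0; rewrite add0r.
  pose d := Num.min 1 (e / 4).
  have d0 : 0 < d by rewrite lt_min ltr01 divr_gt0.
  have d1 : d <= 1 by rewrite ge_min lexx.
  have de : d <= e / 4 by rewrite ge_min lexx orbT.
  have := key _ d0 d1; lra.
move=> tt; have [t00|t00] := eqVneq t 0; first by left; exact: dnorm_eq0.
have tt0 : 0 < t by rewrite lt_neqAle eq_sym t00.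
have t11 : dnorm phi2 = 0.
  rewrite N2; apply/le_anti; rewrite subr_ge0 t1 andbT.
  by rewrite -(pmulr_rle0 _ tt0).
right; apply/esym/eqP; rewrite -subr_eq0; apply/eqP; exact: dnorm_eq0.
Qed.

(** If [P] fixed [psi], then [psi - phi] would split into [psi] and [- phi], both of norm 1. *)
Lemma eval_vanish_near z w phi psi : polydisc z -> polydisc w ->
  (forall F, phi F = F z) -> (forall F, psi F = F w) ->
  (forall F, unit_ball F -> cabs (F w - F z) <= 1) -> P phi = 0 -> P psi = 0.
Proof.
move=> Dz Dw phiE psiE wz P0; have [//|P1] := eval_dichotomy Dw psiE; exfalso.
have := dnorm_Lprojection PL (psi - phi); rewrite linearB /= P0 P1 subr0.
rewrite addrAC subrr add0r dnormN (dnorm_eval Dw psiE) (dnorm_eval Dz phiE) => N.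
have : dnorm (psi - phi) <= 1.
  apply: dnorm_le => // F /wz; congr (cabs _ <= _).
  by rewrite -phiE -psiE.
by rewrite -N; lra.
Qed.

Lemma eval_vanish_at0 w phi psi : polydisc w ->
  (forall F, phi F = F w) -> (forall F, psi F = F 0) -> P phi = 0 -> P psi = 0.
Proof.
move=> Dw phiE psiE P0; have [s [s0 s1 sw]] := polydisc_cpolydisc Dw.
(* Moving by [t] along [w] with [cabs t <= r] multiplies [w] by at most [1 + r] in modulus, and
   [(1 + r) * s <= s + r < 1]. *)
pose r := (1 - s) / 2; have r0 : 0 < r by rewrite divr_gt0// subr_gt0.
(* The segment is walked in [k] steps of parameter [1 / k], at most [r / 8] as
   [holomorphic_oscillation] demands. *)
pose k := (Num.truncn (8 / r)).+1; have k8 : 8 / r < k%:R by exact: truncnS_gt.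
have k0 : (0 : R) < k%:R by rewrite ltr0n.
pose z (m : nat) : Cn := real_complex R (1 - m%:R / k%:R) *: w.
have m01 m : (m <= k)%N -> (0 <= 1 - m%:R / k%:R :> R) && (1 - m%:R / k%:R <= 1 :> R).
  move=> mk; have mk1 : m%:R / k%:R <= 1 :> R by rewrite ler_pdivrMr// mul1r ler_nat.
  have mk0 : 0 <= m%:R / k%:R :> R by rewrite divr_ge0.
  by apply/andP; split; lra.
have s'1 : s + r < 1 by rewrite /r; lra.
have ztD m (t : C) : (m <= k)%N -> disc r t -> cpolydisc (s + r) (z m + t *: w).
  move=> /m01/andP[m0 m1] rt j; rewrite !mxE -mulrDl Normc.normcM.
  have := sw j; have : cabs (real_complex R (1 - m%:R / k%:R) + t) <= 1 + r.
    by rewrite (le_trans (le_normcD _ _))// lerD// cabs_real ger0_norm.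
  have := cabs_ge0 (w 0 j); have := cabs_ge0 (real_complex R (1 - m%:R / k%:R) + t).
  set p := cabs _; set q := cabs _ => p0 q0 pr qs.
  have : p * q <= (1 + r) * s by apply: ler_pM.
  by have := ler_wpM2l (ltW r0) (ltW s1); lra.
have zD m : (m <= k)%N -> polydisc (z m).
  move=> mk; have := ztD m 0 mk; rewrite scale0r addr0 /disc Normc.normc0 => /(_ (ltW r0)).
  exact: cpolydisc_polydisc.
suff h m : (m <= k)%N -> exists phi', (forall F, phi' F = F (z m)) /\ P phi' = 0.
  have [phi' [phi'E <-]] := h k (leqnn k); congr (P _).
  apply/val_inj/funext => F /=; rewrite psiE phi'E; congr (F _).
  by rewrite /z divff ?gt_eqF// subrr scale0r.
elim: m => [_|m IH mk].
  by exists phi; split=> // F; rewrite phiE /z mul0r subr0 rmorph1 scale1r.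
have [phi1 [phi1E P1]] := IH (ltnW mk).
have [phi2 phi2E] := eval_dual (zD _ mk); exists phi2; split=> //.
apply: (eval_vanish_near (zD _ (ltnW mk)) (zD _ mk) phi1E phi2E _ P1) => F F1.
have -> : z m.+1 = z m + real_complex R (- k%:R^-1) *: w.
  rewrite /z -scalerDl -rmorphD -natr1; congr (real_complex R _ *: _).
  by rewrite mulrDl mul1r opprD addrA.
apply: (holomorphic_oscillation (@Hinf_holomorphic _ _ F) r0 s'1 ltr01).
- by move=> y Dy; move/unit_ballE: F1; apply: le_trans; exact: cabs_Hinf_le.
- by move=> t; exact/ztD/ltnW.
- rewrite cabs_real normrN ger0_norm ?invr_ge0 ?ler0n//.
  rewrite -(invf_div 8 r) lef_pV2; first exact: ltW k8.
    by rewrite posrE.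
  by rewrite posrE divr_gt0.
Qed.

End point_evaluation_dichotomy.
End Mideals_of_Hinf.

Section near_unit.
Context {R : realType} {n : nat}.
Local Notation C := R[i].
Local Notation Cn := ('rV[C]_n : normedModType C).
Local Notation H := (Hinf R n).
Implicit Types (F G : H) (z w : Cn).

Lemma Hinf_neq0 F : F != 0 -> exists2 w, polydisc w & F w != 0.
Proof.
move=> F0; apply: contrapT => nw; case/eqP: F0; apply/val_inj/funext => z /=.
have [Dz|nDz] := pselect (polydisc z).
  by apply/eqP; apply: contra_notT nw => Fz; exists z.
by case: F {nw} => f /= /asboolP[_ _ ->].
Qed.

Lemma Hinf_ideal_self (one : H) F : (forall z, polydisc z -> one z = 1) ->
  Hinf_ideal F F.
Proof.
move=> one1; apply: subset_closure; exists one => //.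
apply/val_inj/funext => z; change (F z * one z = F z).
have [Dz|nDz] := pselect (polydisc z); first by rewrite one1// mulr1.
by case: F => f /= /asboolP[_ _ ->]//; rewrite mul0r.
Qed.

(* If the evaluation at [0] had norm [s < 1] on the ideal, a Hahn-Banach
   extension [psi] of its restriction, of norm [s], would differ from it by an
   element of the annihilator; as the L-projection kills the evaluation, this
   forces the norm of [psi] to be at least [1]. *)
Lemma Mideal_norm_attained F (d : R) : F != 0 -> Mideal (Hinf_ideal F) ->
  0 < d -> d <= 1 ->
  exists2 E, Hinf_ideal F E & rnorm E <= 1 /\ 1 - d < cabs (E 0).
Proof.
move=> F0 [[J0 JL] _ [P [_ PP rP PL]]] d0 d1; set J := Hinf_ideal F in J0 JL rP *.
have [one one1] := @Hinf_one R n; have [w Dw Fw] := Hinf_neq0 F0.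
have D0 : polydisc (0 : Cn) by apply/polydiscE => j; rewrite mxE Normc.normc0.
have [phi phiE] := eval_dual Dw; have [delta deltaE] := eval_dual D0.
have Pphi : P phi = 0.
  have [//|Pphi] := eval_dichotomy PP PL one1 Dw phiE; exfalso; case/eqP: Fw.
  rewrite -phiE; have : annihilator J phi by rewrite -rP; exists phi.
  by apply; exact: Hinf_ideal_self one1.
have Pdelta := eval_vanish_at0 PP PL one1 Dw phiE deltaE Pphi.
apply: contrapT => nE; pose s := 1 - d; have s0 : 0 <= s by rewrite subr_ge0.
have JZ (c : C) G : J G -> J (c *: G).
  move=> /mem_set JG; have := JL c _ _ JG J0; rewrite addr0; exact: set_mem.
have bound G : J G -> cabs (delta G) <= s * rnorm G.
  move=> JG; rewrite deltaE; have [G0|G0] := eqVneq (rnorm G) 0.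
    by rewrite (rnorm_eq0 G0) Normc.normc0 mulr_ge0// rnorm_ge0.
  have rG : 0 < rnorm G by rewrite lt_neqAle rnorm_ge0 eq_sym G0.
  pose c := real_complex R (rnorm G)^-1.
  have cc : cabs c = (rnorm G)^-1 by rewrite cabs_real ger0_norm// invr_ge0 ltW.
  rewrite leNgt; apply/negP => h; apply: nE; exists (c *: G); first exact: JZ.
  split; first by rewrite rnormZ cc mulVf.
  by rewrite HinfZE Normc.normcM cc -ltr_pdivrMl ?invr_gt0// invrK mulrC.
have [||||||v [vl vJ vs]] := @hahn_banach R H (fun G => s * rnorm G) _ _ J delta.
- by move=> G G'; rewrite -mulrDr ler_wpM2l// ler_rnormD.
- by move=> c G; rewrite rnormZ mulrCA.
- exact: set_mem J0.
- move=> G G' /mem_set JG /mem_set JG'; have := JL 1 _ _ JG JG'.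
  rewrite scale1r; exact: set_mem.
- exact: JZ.
- exact: bound.
pose psi := Dual (bounded_linear_dual vl vs).
have : annihilator J (delta - psi).
  move=> G JG; change (delta G - v G = 0); by rewrite vJ// subrr.
rewrite -rP => -[chi _ chiE].
have : P (delta - psi) = delta - psi by rewrite -chiE PP.
(* As [P] fixes [delta - psi] and kills [delta], the complementary part of [psi] is [delta], which
   has norm 1. *)
rewrite linearB /= Pdelta sub0r => Ppsi.
have psiE : psi - P psi = delta by rewrite Ppsi addrC subrK.
have := dnorm_Lprojection PL psi; rewrite psiE (dnorm_eval one1 D0 deltaE).
have : dnorm psi <= s.
  apply: dnorm_le => // G /unit_ballE G1; apply: (le_trans (vs G)).
  by rewrite -[leRHS]mulr1 ler_wpM2l.
have := dnorm_ge0 (P psi); rewrite /s; move: d0.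
set a := dnorm (P psi); set b := dnorm psi; clear; lra.
Qed.

(** An element of the closed ideal is only a limit of multiples: half of [d] pays for the
    near-attainment of the norm, half for the approximation. A unimodular factor makes the value at
    0 real and nonnegative. *)
Lemma Mideal_near_unit F (d : R) : F != 0 -> Mideal (Hinf_ideal F) ->
  0 < d -> d <= 1 ->
  exists G, (forall z, polydisc z -> cabs (F z * G z) <= 1 + d) /\
    1 - d <= complex.Re (F 0 * G 0).
Proof.
move=> F0 MF d0 d1; have d20 : 0 < d / 2 by rewrite divr_gt0.
have d21 : d / 2 <= 1 by rewrite ler_pdivrMr// mul1r (le_trans d1)// ler1n.
have {MF F0} [E JE [E1 E0]] := Mideal_norm_attained F0 MF d20 d21.
have D0 : polydisc (0 : Cn) by apply/polydiscE => j; rewrite mxE Normc.normc0.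
have d2C : 0 < real_complex R (d / 2) by rewrite ltcR.
have {JE} [_ [[G _ <-]]] := JE _ (nbhsx_ballx E _ d2C).
rewrite -ball_normE/= normE ltcR => EG.
have EGz z : polydisc z -> cabs (E z - F z * G z) <= d / 2.
  by move=> Dz; apply: le_trans (ltW EG); exact: (cabs_Hinf_le (E - Hinf_mul F G) Dz).
have [u u1 uG] := exists_rotation (F 0 * G 0).
exists (u *: G); split.
  move=> z Dz; rewrite HinfZE mulrCA Normc.normcM u1 mul1r.
  have := cabs_triangle (F z * G z) (E z) 0; rewrite !subr0 (cabs_sub _ (E z)).
  have := EGz _ Dz; have := cabs_Hinf_le E Dz; lra.
rewrite HinfZE mulrCA uG; change (1 - d <= cabs (F 0 * G 0)).
have h1 := cabs_triangle (E 0) (F 0 * G 0) 0; have h2 := EGz _ D0.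
rewrite !subr0 in h1; move: h1 h2 E0.
set a := cabs (E 0); set b := cabs (E 0 - _); set c := cabs _.
by clear; lra.
Qed.

End near_unit.

(** * Density of the polynomial multiples *)

Section H2_density.
Context {R : realType} {n : nat}.
Local Notation C := R[i].
Local Notation Cn := ('rV[C]_n : normedModType C).
Implicit Types (G h : Cn -> C^o) (p q : Cn -> C).

Lemma polyfun_bounded q : polyfun q ->
  exists2 M : R, 0 <= M & forall z, polydisc z -> cabs (q z) <= M.
Proof.
move=> /polyfun_rep[s [c [_ _ qE]]]; exists (\sum_(m <- s) cabs (c m)).
  by rewrite sumr_ge0// => m _; exact: cabs_ge0.
move=> z /polydiscE Dz; rewrite qE (le_trans (ler_cabs_sum _ _ _))//.
apply: ler_sum => m _; rewrite Normc.normcM ler_piMr ?cabs_ge0//.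
rewrite /monomial; elim/big_ind : _ => [|x y x1 y1|j _].
- by rewrite Normc.normc1.
- by rewrite Normc.normcM mulr_ile1 ?cabs_ge0.
- by rewrite cabsX exprn_ile1 ?cabs_ge0// ltW.
Qed.

Lemma H2_norm_bounded G : holomorphic G -> (H2_norm G < +oo)%E ->
  exists B : R, forall r, 0 < r < 1 -> rmean r G <= B.
Proof.
move=> hG; rewrite /H2_norm; set S := ereal_sup _ => Soo.
have ub (r : R) : 0 < r < 1 -> ((rmean r G)%:E <= S)%E.
  move=> /andP[r0 r1]; rewrite -(tmeanE hG (ltW r0) r1).
  by apply: ereal_sup_ubound; exists r => //=; rewrite in_itv/= r0.
case: S Soo ub => [B _ ub|//|_ ub].
  by exists B => r hr; rewrite -lee_fin; exact: ub.
by exists 0 => r /ub.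
Qed.

(** A supremum preserves only weak inequalities, hence the margin [e / 2]. *)
Lemma H2_norm_lt h (e : R) : holomorphic h -> 0 < e ->
  (forall r, 0 < r < 1 -> rmean r h <= (e / 2) ^+ 2) -> (H2_norm h < e%:E)%E.
Proof.
move=> hh e0 hb; have e20 : 0 <= e / 2 by rewrite divr_ge0// ltW.
apply: (@le_lt_trans _ _ (e / 2)%:E); last first.
  by rewrite lte_fin ltr_pdivrMr// ltr_pMr// ltr1n.
have -> : (e / 2)%:E = sqrte (((e / 2) ^+ 2)%:E) by rewrite /= sqrtr_sqr ger0_norm.
rewrite /H2_norm lee_sqrt ?lee_fin ?sqr_ge0//.
apply: ge_ereal_sup => _ [r /= + <-]; rewrite in_itv/= => /andP[r0 r1].
rewrite -[leLHS]/(tmean r h) (tmeanE hh (ltW r0) r1) lee_fin hb//.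
by rewrite r0.
Qed.

Lemma cabs_sqr_add (x y : C) : cabs (x + y) ^+ 2 <= 2 * cabs x ^+ 2 + 2 * cabs y ^+ 2.
Proof. by apply: (@sqr_ler_split _ _ _ (cabs y)); rewrite ?cabs_ge0 ?le_normcD. Qed.

(** A polynomial [q] close to [G] is close to [q f g], as [f g] is close to 1 in mean and [q] is
    bounded. The multiplier [q g] is then replaced by a polynomial close to it in mean, at the cost
    of a factor [Mf ^+ 2]. *)
Lemma near_unit_dense (f : Hinf R n) G (B : R) : holomorphic G ->
  (forall r, 0 < r < 1 -> rmean r G <= B) ->
  (forall d : R, 0 < d -> d <= 1 -> exists g : Hinf R n,
     (forall z, polydisc z -> cabs (f z * g z) <= 1 + d) /\
     1 - d <= complex.Re (f 0 * g 0)) ->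
  forall T : R, 0 < T -> exists2 p, polyfun p &
    forall r, 0 < r < 1 -> rmean r (fun z => G z - p z * f z) <= T.
Proof.
move=> hG GB hf T T0; have T40 : 0 < T / 4 by rewrite divr_gt0.
have [q pq qG] := polynomial_density hG GB T40.
have [Mq Mq0 qM] := polyfun_bounded pq.
have Mq1 : 0 < 416 * (Mq ^+ 2 + 1) by rewrite mulr_gt0// ltr_wpDl// sqr_ge0.
(* The term with [f g - 1] is at most [2 * (2 * Mq ^+ 2) * (26 * d)], that is [104 * Mq ^+ 2 * d],
   and should not exceed [T / 4]. Later the tolerance [T / (16 * (Mf ^+ 2 + 1))] limits
   [4 * Mf ^+ 2] times the error of [p] to [T / 4]; the error of [q] counts twice and takes
   [T / 2]. *)
pose d := Num.min 1 (T / (416 * (Mq ^+ 2 + 1))).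
have d0 : 0 < d by rewrite lt_min ltr01 divr_gt0.
have d1 : d <= 1 by rewrite ge_min lexx.
have dT : d * (416 * (Mq ^+ 2 + 1)) <= T by rewrite -ler_pdivlMr// ge_min lexx orbT.
have [g [fg1 fg0]] := hf _ d0 d1.
have hq : holomorphic (q : Cn -> C^o) := holomorphic_polyfun pq.
have hfh := Hinf_holomorphic f; have hgh := Hinf_holomorphic g.
have hqg := holomorphicM hq hgh; have hfg := holomorphicM hfh hgh.
pose Mf := rnorm f; have Mf0 : 0 <= Mf := rnorm_ge0 f.
have Mf1 : 0 < 16 * (Mf ^+ 2 + 1) by rewrite mulr_gt0// ltr_wpDl// sqr_ge0.
have qgB r : 0 < r < 1 -> rmean r (fun z => q z * g z) <= (Mq * rnorm g) ^+ 2.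
  move=> /andP[r0 r1]; set b := (Mq * rnorm g) ^+ 2.
  suff : rmean r (fun z => q z * g z) <= 0 * rmean r G + 0 * rmean r G + b.
    by rewrite !mul0r !add0r.
  apply: (rmean_le hqg hG hG (ltW r0) r1 (lexx 0) (lexx 0) (sqr_ge0 _)) => z rz.
  rewrite !mul0r !add0r lerXn2r ?nnegrE ?cabs_ge0 ?mulr_ge0 ?rnorm_ge0//.
  have Dz := cpolydisc_polydisc r1 rz.
  by rewrite Normc.normcM ler_pM ?cabs_ge0 ?qM//; exact: cabs_Hinf_le.
have e20 : 0 < T / (16 * (Mf ^+ 2 + 1)) by rewrite divr_gt0.
have [p pp pqg] := polynomial_density hqg qgB e20.
have hp : holomorphic (p : Cn -> C^o) := holomorphic_polyfun pp.
have hpf := holomorphicM hp hfh; have h1 := @holomorphic_cst R n 1.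
exists p => // r r01; have /andP[r0 r1] := r01.
have Y : rmean r (fun z => q z - p z * f z) <=
    2 * Mq ^+ 2 * rmean r (fun z => f z * g z - 1) +
    2 * Mf ^+ 2 * rmean r (fun z => q z * g z - p z) + 0.
  have a0 : 0 <= 2 * Mq ^+ 2 by rewrite mulr_ge0// sqr_ge0.
  have b0 : 0 <= 2 * Mf ^+ 2 by rewrite mulr_ge0// sqr_ge0.
  apply: (rmean_le (holomorphicB hq hpf) (holomorphicB hfg h1)
    (holomorphicB hqg hp) (ltW r0) r1 a0 b0 (lexx 0)) => z rz.
  have Dz := cpolydisc_polydisc r1 rz.
  have -> : q z - p z * f z = q z * (1 - f z * g z) + f z * (q z * g z - p z) by ring.
  rewrite (le_trans (cabs_sqr_add _ _))// addr0 -!(mulrA 2) -!mulrDr ler_wpM2l//.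
  rewrite !Normc.normcM !exprMn (cabs_sub 1) lerD//.
    by rewrite ler_wpM2r ?sqr_ge0// lerXn2r ?nnegrE ?cabs_ge0// qM.
  rewrite ler_wpM2r ?sqr_ge0// lerXn2r ?nnegrE ?cabs_ge0//.
  exact: cabs_Hinf_le.
have Z : rmean r (fun z => G z - p z * f z) <=
    2 * rmean r (fun z => G z - q z) + 2 * rmean r (fun z => q z - p z * f z) + 0.
  apply: (rmean_le (holomorphicB hG hpf) (holomorphicB hG hq)
    (holomorphicB hq hpf) (ltW r0) r1 (ler0n _ 2) (ler0n _ 2) (lexx 0)) => z _.
  have -> : G z - p z * f z = (G z - q z) + (q z - p z * f z) by ring.
  by rewrite addr0; exact: cabs_sqr_add.
have U := rmean_sub1 hfg (ltW r0) r1 d0 fg1 d1 fg0.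
have V := pqg _ r01; have W := qG _ r01.
rewrite ler_pdivlMr// in V.
have Mq2 := sqr_ge0 Mq; have Mf2 := sqr_ge0 Mf.
have := ler_wpM2l Mq2 U; have := rmean_ge0 r (fun z => q z * g z - p z).
set A := rmean r (fun z => f z * g z - 1) in Y U *.
set V' := rmean r (fun z => q z * g z - p z) in Y V * => V'0 MU.
have := mulr_ge0 Mf2 V'0; lra.
Qed.

End H2_density.

Theorem corollary5p7 (R : realType) (n : nat) (n_ge1 : (1 <= n)%N)
    (f : Hinf R n) (f_neq0 : f != 0) :
  Mideal (Hinf_ideal f) -> H2_ideal f = H2 R n.
Proof.
move=> Mf; apply/seteqP; split=> [G [//]|G HG]; split=> // e e0.
have [hG _ Goo] := HG; have [B GB] := H2_norm_bounded hG Goo.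
have T0 : 0 < (e / 2) ^+ 2 by rewrite exprn_gt0// divr_gt0.
have unit_f (d : R) := @Mideal_near_unit R n f d f_neq0 Mf.
have [p pp Gp] := near_unit_dense hG GB unit_f T0; have [P pP] := pp.
exists (fun z : ('rV[R[i]]_n : normedModType R[i]) =>
  mpoly.meval (fun j => z 0 j) P * f z); first by exists P.
have -> : (G - (fun z : ('rV[R[i]]_n : normedModType R[i]) =>
    mpoly.meval (fun j => z 0 j) P * f z))%R =
    (fun z => G z - p z * f z) by apply/funext => z; rewrite pP.
apply: H2_norm_lt => //; apply: holomorphicB => //.
by apply: holomorphicM; [exact: holomorphic_polyfun|exact: Hinf_holomorphic].
Qed.
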